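(* Let $I=[u,v]\subset[0,T]$ be a reset interval for $\mathbf x\in WG\Omega_p(\mathbb R^d)$, let $\Theta$ be the solution on $I$ of the augmented reset RDE $d\Theta_t=V_i(\Theta_t)\,d\mathbf x^i_t$, $\Theta_v=0$, and assume $V_i\in C_b^3(\mathcal E_{\mathrm{jet}};\mathcal E_{\mathrm{jet}})$. For every $\tau=(h,\kappa)\in\mathbb T_{\mathbf x}^p$ there is a unique intrinsic tangent solution $P^\tau$ on $I$. The map $$\mathbb T_{\mathbf x}^p\longrightarrow\mathcal V_p(I;\mathcal E_{\mathrm{jet}}),\qquad\tau\longmapsto P^\tau,$$ is continuous and linear; more precisely, $$\|P^\tau\|_{\mathcal V_p(I;\mathcal E_{\mathrm{jet}})}+\|R^{P^\tau}\|_{q\text{-var};I;\mathcal E_{\mathrm{jet}}}\le C_I\|\tau\|_{\mathbb T_{\mathbf x}^p}.$$ Every finite-norm joint-lift representative $(\mathbf Z,a)$ of $\tau$ yields (through its representative variation equation) the same path $P^\tau$. On a bounded tangent set, $C_I$ can be chosen uniformly over $I\in\Pi(\mathbf x)$ and over representatives with a prescribed quantitative realization budget $\rho_p(\mathbf Z)+\|a\|_{q\text{-var}}\le L$.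
   Context: **Rough paths and tangents.** $2<p<3$, $q=p/2$, $E=\mathbb R^d$. $h_{s,t}=h_t-h_s$; $(\delta K)_{s,u,t}=K_{s,t}-K_{s,u}-K_{u,t}$. $\mathcal V_0^r(F)$: continuous $F$-valued paths on $[0,T]$ started at $0$ with finite $r$-variation; $\mathcal V_2^r(F)$: continuous two-index maps $K$ on $\{0\le s\le t\le T\}$ vanishing on the diagonal with $\|K\|_{r\text{-var}}=(\sup_D\sum|K_{t_i,t_{i+1}}|^r)^{1/r}<\infty$. $WG\Omega_p(E)$: $\mathbf x=(1,x,\mathbb x)$, $x\in\mathcal V_0^p(E)$, $\mathbb x\in\mathcal V_2^q(E\otimes E)$, $(\delta\mathbb x)_{s,u,t}=x_{s,u}\otimes x_{u,t}$, $\operatorname{Sym}\mathbb x_{s,t}=\frac12x_{s,t}^{\otimes2}$; $\rho_p$ is the homogeneous $p$-variation size. $\mathbb T_{\mathbf x}^p$: pairs $\tau=(h,\kappa)\in\mathcal V_0^p(E)\times\mathcal V_2^q(E\otimes E)$ with $(\delta\kappa)_{s,u,t}=x_{s,u}\otimes h_{u,t}+h_{s,u}\otimes x_{u,t}$, $\operatorname{Sym}\kappa_{s,t}=\frac12(x_{s,t}\otimes h_{s,t}+h_{s,t}\otimes x_{s,t})$, normed by $\|h\|_{p\text{-var}}+\|\kappa\|_{q\text{-var}}$. **Augmented reset flow.** $H_i\in C_b^9(\mathbb R)$, $i=1,\dots,d$. The backward reset flow on $I=[u,v]$ is $\phi_t(y)=y+\int_t^vH_i(\phi_r(y))\,d\mathbf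 x^i_r$. $\mathcal E_{\mathrm{jet}}=C_b(\mathbb R;\mathbb R^4)$ with sup norm, and $\Theta=(\phi-\mathrm{Id},\partial_y\phi-1,\partial_{yy}\phi,\partial_{yyy}\phi)$. The fields $V_i$ on $\mathcal E_{\mathrm{jet}}$ are the Nemytskii maps $V_i(\theta)(y)=\mathsf H_i(y+\theta_0(y),1+\theta_1(y),\theta_2(y),\theta_3(y))$, where $\mathsf H_i(r,j,k,\ell)=(-H_i(r),\,-H_i'(r)j,\,-H_i''(r)j^2-H_i'(r)k,\,-H_i'''(r)j^3-3H_i''(r)jk-H_i'(r)\ell)$, with a smooth cutoff applied outside the region reached by the physical jets so that the fields are bounded. $I$ is a reset interval if the rough control of $\mathbf x$ on $I$ is small enough that the cutoff is inactive along $\Theta$. $\Pi(\mathbf x)$ is a fixed finite partition of $[0,T]$ into reset intervals, chosen from the control of the base path $\mathbf x$ only. **Intrinsic tangent solution.** Put $A_i=DV_i$, $Q_{j,i}=DV_iV_j$, $B_{j,i}=DQ_{j,i}$ and, for $\tau=(h,\kappa)$, $$\Xi^\tau_{s,t}(P_s)=A_i(\Theta_s)P_sx^i_{s,t}+V_i(\Theta_s)h^i_{s,t}+B_{j,i}(\Theta_s)P_s\mathbb x^{j,i}_{s,t}+Q_{j,i}(\Theta_s)\kappa^{j,i}_{s,t}.$$ A continuous $\mathcal E_{\mathrm{jet}}$-valued path $P$ on $I$ with $P_v=0$ is an intrinsic tangent solution if $P_{s,t}=\Xi^\tau_{s,t}(P_s)+P^\natural_{s,t}$ with $|P^\natural_{s,t}|\le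 C_\tau\,\omega(s,t)^{3/p}$ for some finite control $\omega$. Its controlled remainder is $R^P_{s,t}=P_{s,t}-A_i(\Theta_s)P_sx^i_{s,t}-V_i(\Theta_s)h^i_{s,t}$. $\|G\|_{\mathcal V_p(I;\mathcal E_{\mathrm{jet}})}=\sup_{t\in I}\|G_t\|+\|G\|_{p\text{-var};I}$. **Representatives.** A joint-lift representative of $\tau$ is $(\mathbf Z,a)$ with $\mathbf Z\in WG\Omega_p(\mathbb R^d_x\oplus\mathbb R^d_h)$ having $x$-marginal $\mathbf x$ and $h$-marginal with first level $h$, and $a\in\mathcal V_0^q(\mathfrak{so}(d))$ (identified with its increments), such that $\kappa=C+a$, $C^{j,i}=\mathbf Z^{x_j,h_i}+\mathbf Z^{h_j,x_i}$ (sum of the two cross blocks of the second level). Writing $a_{s,t}=\sum_{i<j}a^{ij}_{s,t}(e_i\otimes e_j-e_j\otimes e_i)$ and $[V_i,V_j]=DV_jV_i-DV_iV_j$, its representative variation equation is the mixed rough/Young equation $$dP_t=A_i(\Theta_t)P_t\,d\mathbf Z^{x,i}_t+V_i(\Theta_t)\,d\mathbf Z^{h,i}_t+\sum_{i<j}[V_i,V_j](\Theta_t)\,da^{ij}_t,\qquad P_v=0.$$ *)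

(* Defs.v *)
From HB Require Import structures.
From mathcomp Require Import all_boot all_order all_algebra.
From mathcomp Require Import all_classical all_reals all_analysis.
Set Implicit Arguments.
Unset Strict Implicit.
Unset Printing Implicit Defensive.
Import Order.TTheory GRing.Theory Num.Theory.
Import numFieldNormedType.Exports.
Local Open Scope classical_set_scope.
Local Open Scope ring_scope.

Section BoundedContinuous.
Context {R : realType} {W : normedModType R}.

Definition bcont_pred : {pred (R -> W)} :=
  fun f => `[< continuous f /\ exists M : R, forall y, `|f y| <= M >].

Record bcont := BCont { bcont_fun :> R -> W ; _ : bcont_fun \in bcont_pred }.

HB.instance Definition _ := [isSub for bcont_fun].
HB.instance Definition _ := [Choice of bcont by <:].

Fact bcont_submod_closed : submod_closed bcont_pred.
Proof.
split=> [|c f g].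
  apply/asboolP; split; first by move=> y; exact: cvg_cst.
  by exists 0 => y; rewrite normr0.
move=> /asboolP[cf [M Mf]] /asboolP[cg [N Ng]]; apply/asboolP; split.
  move=> y; apply: cvgD; last exact: cg.
  by apply: cvgZl_tmp; exact: cf.
exists (`|c| * M + N) => y.
rewrite (le_trans (ler_normD _ _))// lerD// normrZ.
by rewrite ler_wpM2l.
Qed.

HB.instance Definition _ := GRing.isSubmodClosed.Build R (R -> W) bcont_pred
  bcont_submod_closed.
HB.instance Definition _ := [SubChoice_isSubLmodule of bcont by <:].

Definition sup_norm (f : bcont) : R := sup [set `|f y| | y in [set: R]].

Fact bcont_has_sup (f : bcont) : has_sup [set `|f y| | y in [set: R]].
Proof.
split; first by exists `|f 0|; exists 0.
case: f => f /= /asboolP[_ [M Mf]].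
by exists M => _ [y _ <-]; exact: Mf.
Qed.

Fact sup_norm_ge (f : bcont) y : `|f y| <= sup_norm f.
Proof. by apply: ub_le_sup; [case: (bcont_has_sup f)|exists y]. Qed.

Fact sup_norm_le (f : bcont) M : (forall y, `|f y| <= M) -> sup_norm f <= M.
Proof.
move=> fM; apply: ge_sup; first by case: (bcont_has_sup f).
by move=> _ [y _ <-].
Qed.

Fact sup_normD f g : sup_norm (f + g) <= sup_norm f + sup_norm g.
Proof.
apply: sup_norm_le => y.
by rewrite (le_trans (ler_normD _ _))// lerD// sup_norm_ge.
Qed.

Fact sup_normZ (c : R) f : sup_norm (c *: f) = `|c| * sup_norm f.
Proof.
have le (a : R) g : sup_norm (a *: g) <= `|a| * sup_norm g.
  by apply: sup_norm_le => y; rewrite normrZ ler_wpM2l// sup_norm_ge.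
apply/eqP; rewrite eq_le le/=.
have [->|c0] := eqVneq c 0.
  by rewrite normr0 mul0r (le_trans _ (sup_norm_ge _ 0)).
rewrite -ler_pdivlMl ?normr_gt0// -normfV.
by rewrite -[X in sup_norm X <= _](scalerK c0).
Qed.

Fact sup_norm0_eq0 f : sup_norm f = 0 -> f = 0.
Proof.
move=> f0; apply/val_inj/funext => y; apply/eqP.
by rewrite -normr_le0 -f0 sup_norm_ge.
Qed.

HB.instance Definition _ :=
  Lmodule_isNormed.Build R bcont sup_normD sup_normZ sup_norm0_eq0.

End BoundedContinuous.
Arguments bcont : clear implicits.


Notation Ejet R := (bcont R 'rV[R]_4).

Section FrechetClass.
Context {R : realType} {V W : normedModType R}.

(* [iter_diff f [:: v1; ...; vn] x] is [D^n f(x)[v1, ..., vn]]. *)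
Fixpoint iter_diff (f : V -> W) (vs : seq V) : V -> W :=
  if vs is v :: vs' then fun x => 'd (iter_diff f vs') x v else f.

Definition in_unit_ball n (vs : n.-tuple V) : Prop :=
  forall i, `|tnth vs i| <= 1.

(* [D^n f] is Frechet differentiable at [x], as a map into the space of [n]-linear
   maps with the operator norm, with derivative [D^(n+1) f(x)]. *)
Definition diff_iter_at (f : V -> W) n (x : V) : Prop :=
  (forall vs : n.-tuple V, differentiable (iter_diff f vs) x) /\
  (forall eps : R, 0 < eps -> \forall h \near (0 : V),
    forall vs : n.-tuple V, in_unit_ball vs ->
    `|iter_diff f vs (x + h) - iter_diff f vs x - iter_diff f (h :: vs) x|
      <= eps * `|h|).

Definition Cb_frechet (k : nat) (f : V -> W) : Prop :=
  [/\ forall n, (n < k)%N -> forall x, diff_iter_at f n x,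
      forall n, (n <= k)%N -> exists M : R, forall x (vs : n.-tuple V),
        in_unit_ball vs -> `|iter_diff f vs x| <= M
    & forall x (eps : R), 0 < eps -> \forall y \near x,
        forall vs : k.-tuple V, in_unit_ball vs ->
        `|iter_diff f vs y - iter_diff f vs x| <= eps].

End FrechetClass.

Definition Cb_real {R : realType} (k : nat) (f : R -> R) : Prop :=
  [/\ forall n, (n < k)%N -> forall y, derivable (derive1n n f) y 1,
      forall n, (n <= k)%N -> exists M : R, forall y, `|derive1n n f y| <= M
    & continuous (derive1n k f)].

Section Variation.
Context {R : realType}.

Definition simplex (u v : R) : set (R * R) :=
  [set z | [/\ u <= z.1, z.1 <= z.2 & z.2 <= v]].

Definition incr {F : zmodType} (h : R -> F) (s t : R) : F := h t - h s.

Definition riemann_sum {F : nmodType} (K : R -> R -> F) (u v : R) (D : seq R) :=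
  \sum_(0 <= i < size D) K (nth v (u :: D) i) (nth v (u :: D) i.+1).

Definition partition_piece (a : R) (D : seq R) (u v : R) : Prop :=
  exists i, [/\ (i < size D)%N, u = nth a (a :: D) i & v = nth a (a :: D) i.+1].

Definition var2 {F : normedModType R} (r : R) (K : R -> R -> F) (u v : R)
    : \bar R :=
  poweR (ereal_sup [set (riemann_sum (fun s t => `|K s t| `^ r) u v D)%:E
                   | D in itv_partition u v]) r^-1.

Definition var1 {F : normedModType R} (r : R) (h : R -> F) : R -> R -> \bar R :=
  var2 r (incr h).

Definition V0 {F : normedModType R} (T r : R) (h : R -> F) : Prop :=
  [/\ {within `[0, T], continuous h}, h 0 = 0 & (var1 r h 0 T < +oo)%E].

Definition V2 {F : normedModType R} (T r : R) (K : R -> R -> F) : Prop :=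
  [/\ {within simplex 0 T, continuous (fun z : R * R => K z.1 z.2)},
      forall t, 0 <= t <= T -> K t t = 0
    & (var2 r K 0 T < +oo)%E].

Definition Vp_norm {F : normedModType R} (p : R) (G : R -> F) (u v : R)
    : \bar R :=
  (ereal_sup [set `|G t|%:E | t in `[u, v]] + var1 p G u v)%E.

Definition is_control (u v : R) (w : R -> R -> R) : Prop :=
  [/\ {within simplex u v, continuous (fun z : R * R => w z.1 z.2)},
      forall s t, u <= s -> s <= t -> t <= v -> 0 <= w s t,
      forall t, u <= t <= v -> w t t = 0
    & forall s m t, u <= s -> s <= m -> m <= t -> t <= v ->
        w s m + w m t <= w s t].

Definition riemann_limit {F : normedModType R} (K : R -> R -> F) (s t : R)
    (J : F) : Prop :=
  forall eps : R, 0 < eps -> exists2 delta : R, 0 < delta &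
    forall D, itv_partition s t D ->
      (forall a b, partition_piece s D a b -> b - a < delta) ->
      `|riemann_sum K s t D - J| < eps.

End Variation.

Section RoughPaths.
Context {R : realType}.

(* A path and a two-index second level; entry [(j, i)] of the second level is
   the coefficient of [e_j (x) e_i]. *)
Definition two_level (n : nat) : Type :=
  ((R -> 'rV[R]_n) * (R -> R -> 'M[R]_n))%type.

Definition tens {n} (a b : 'rV[R]_n) : 'M[R]_n := a^T *m b.

Definition sym_part {n} (M : 'M[R]_n) : 'M[R]_n := 2^-1 *: (M + M^T).

Definition delta2 {F : zmodType} (K : R -> R -> F) (s m t : R) : F :=
  K s t - K s m - K m t.

Definition WGOmega (p T : R) {n} (x : two_level n) : Prop :=
  [/\ V0 T p x.1, V2 T (p / 2) x.2,
      forall s m t, 0 <= s -> s <= m -> m <= t -> t <= T ->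
        delta2 x.2 s m t = tens (incr x.1 s m) (incr x.1 m t)
    & forall s t, 0 <= s -> s <= t -> t <= T ->
        sym_part (x.2 s t) = 2^-1 *: tens (incr x.1 s t) (incr x.1 s t)].

Definition rho (p T : R) {n} (x : two_level n) : \bar R :=
  (var1 p x.1 0 T + poweR (var2 (p / 2) x.2 0 T) 2^-1)%E.

Definition rough_control (p : R) {n} (x : two_level n) (u v : R) : \bar R :=
  (poweR (var1 p x.1 u v) p + poweR (var2 (p / 2) x.2 u v) (p / 2))%E.

Definition tangent (p T : R) {n} (x tau : two_level n) : Prop :=
  [/\ V0 T p tau.1, V2 T (p / 2) tau.2,
      forall s m t, 0 <= s -> s <= m -> m <= t -> t <= T ->
        delta2 tau.2 s m t =
          tens (incr x.1 s m) (incr tau.1 m t)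
          + tens (incr tau.1 s m) (incr x.1 m t)
    & forall s t, 0 <= s -> s <= t -> t <= T ->
        sym_part (tau.2 s t) =
          2^-1 *: (tens (incr x.1 s t) (incr tau.1 s t)
                   + tens (incr tau.1 s t) (incr x.1 s t))].

Definition tangent_norm (p T : R) {n} (tau : two_level n) : \bar R :=
  (var1 p tau.1 0 T + var2 (p / 2) tau.2 0 T)%E.

(* The last clause is [kappa = C + a], [a] being identified with its increments;
   in the block form of [Z], the index set is [x_1 .. x_d, h_1 .. h_d]. *)
Definition representative (p T : R) {d} (x tau : two_level d)
    (Z : two_level (d + d)) (a : R -> 'M[R]_d) : Prop :=
  [/\ WGOmega p T Z,
      (forall t, 0 <= t <= T ->
         lsubmx (Z.1 t) = x.1 t /\ rsubmx (Z.1 t) = tau.1 t),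
      (forall s t, 0 <= s -> s <= t -> t <= T -> ulsubmx (Z.2 s t) = x.2 s t),
      (V0 T (p / 2) a /\ forall t, 0 <= t <= T -> (a t)^T = - a t)
    & forall s t, 0 <= s -> s <= t -> t <= T ->
        tau.2 s t = ursubmx (Z.2 s t) + dlsubmx (Z.2 s t) + incr a s t].

End RoughPaths.
Arguments two_level : clear implicits.

Section RoughIntegral.
Context {R : realType} {F : normedModType R} {n : nat}.
Implicit Types (x : two_level R n) (y : R -> F).

Definition first_order x (c : 'I_n -> F) (s t : R) : F :=
  \sum_i (incr x.1 s t) 0 i *: c i.

(* [y] is controlled by [x] with Gubinelli derivative [y' j] in direction [j]. *)
Definition controlled (p : R) x y (y' : 'I_n -> R -> F) (u v : R) : Prop :=
  (forall j, (var1 p (y' j) u v < +oo)%E) /\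
  (var2 (p / 2) (fun s t => incr y s t - first_order x (y'^~ s) s t)%R u v
     < +oo)%E.

(* [J = int_s^t Y_i dx^i], where [Y' j i] is the Gubinelli derivative of [Y i]
   in direction [j]. *)
Definition rough_integral x (Y : 'I_n -> R -> F) (Y' : 'I_n -> 'I_n -> R -> F)
    (s t : R) (J : F) : Prop :=
  riemann_limit (fun s t => first_order x (Y^~ s) s t
    + \sum_j \sum_i x.2 s t j i *: Y' j i s) s t J.

End RoughIntegral.

Section Equations.
Context {R : realType} {E : normedModType R} {d : nat}.
Variables (p : R) (V : 'I_d -> E -> E).
Implicit Types (x tau : two_level R d) (Theta P : R -> E).

Definition Afield i (th : E) (P : E) : E := 'd (V i) th P.

Definition Qfield j i (th : E) : E := 'd (V i) th (V j th).

Definition Bfield j i (th : E) (P : E) : E := 'd (Qfield j i) th P.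

Definition bracket i j (th : E) : E := 'd (V j) th (V i th) - 'd (V i) th (V j th).

(* [d Theta = V_i(Theta) dx^i] on [[u, v]], [Theta_v = 0]. *)
Definition rde_solution x Theta (u v : R) : Prop :=
  [/\ {within `[u, v], continuous Theta}, Theta v = 0,
      controlled p x Theta (fun i t => V i (Theta t)) u v
    & forall s t, u <= s -> s <= t -> t <= v ->
        rough_integral x (fun i r => V i (Theta r))
          (fun j i r => Qfield j i (Theta r)) s t (incr Theta s t)].

Definition Xi x tau Theta (s t : R) (P : E) : E :=
  \sum_i (incr x.1 s t) 0 i *: Afield i (Theta s) P
  + \sum_i (incr tau.1 s t) 0 i *: V i (Theta s)
  + \sum_j \sum_i x.2 s t j i *: Bfield j i (Theta s) P
  + \sum_j \sum_i tau.2 s t j i *: Qfield j i (Theta s).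

Definition intrinsic_solution x tau Theta P (u v : R) : Prop :=
  [/\ {within `[u, v], continuous P}, P v = 0
    & exists (w : R -> R -> R) (C : R), is_control u v w /\
        forall s t, u <= s -> s <= t -> t <= v ->
          `|incr P s t - Xi x tau Theta s t (P s)| <= C * w s t `^ (3 / p)].

Definition tangent_remainder x tau Theta P (s t : R) : E :=
  incr P s t
  - \sum_i (incr x.1 s t) 0 i *: Afield i (Theta s) (P s)
  - \sum_i (incr tau.1 s t) 0 i *: V i (Theta s).

(* The integrand of the rough part [A_i(Theta) P dZ^{x,i} + V_i(Theta) dZ^{h,i}]
   of the variation equation. *)
Definition var_integrand Theta P (k : 'I_(d + d)) (t : R) : E :=
  match fintype.split k with
  | inl i => Afield i (Theta t) (P t)
  | inr i => V i (Theta t)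
  end.

(* Its Gubinelli derivative by the chain rule, [Theta] having derivative
   [V_j(Theta)] along [x_j] and [0] along [h_j], and [P] having derivative
   [A_j(Theta) P] along [x_j] and [V_j(Theta)] along [h_j]. *)
Definition var_integrand' Theta P (l k : 'I_(d + d)) (t : R) : E :=
  match fintype.split l, fintype.split k with
  | inl j, inl i =>
      'd (fun th => Afield i th (P t)) (Theta t) (V j (Theta t))
      + Afield i (Theta t) (Afield j (Theta t) (P t))
  | inr j, inl i => Afield i (Theta t) (V j (Theta t))
  | inl j, inr i => 'd (V i) (Theta t) (V j (Theta t))
  | inr j, inr i => 0
  end.

Definition young_germ (a : R -> 'M[R]_d) Theta (s t : R) : E :=
  \sum_(i < d) \sum_(j < d | (i < j)%N) (incr a s t) i j *: bracket i j (Theta s).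

Definition variation_solution (Z : two_level R (d + d)) (a : R -> 'M[R]_d)
    Theta P (u v : R) : Prop :=
  [/\ {within `[u, v], continuous P}, P v = 0,
      controlled p Z P (var_integrand Theta P) u v
    & forall s t, u <= s -> s <= t -> t <= v -> exists J K : E,
        [/\ rough_integral Z (var_integrand Theta P) (var_integrand' Theta P)
              s t J,
            riemann_limit (young_germ a Theta) s t K
          & incr P s t = J + K]].

End Equations.

Section ResetFlow.
Context {R : realType} {d : nat}.

Definition jet_field (H : R -> R) (r j k l : R) : 'rV[R]_4 :=
  \row_(m < 4) [:: - H r;
                   - derive1n 1 H r * j;
                   - derive1n 2 H r * j ^+ 2 - derive1n 1 H r * k;
                   - derive1n 3 H r * j ^+ 3 - 3 * derive1n 2 H r * j * k
                     - derive1n 1 H r * l]`_m.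

(* The derivative part [(1 + theta_1, theta_2, theta_3)(y)] of the jet. *)
Definition jet_derivs (th : Ejet R) (y : R) : 'rV[R]_3 :=
  \row_(m < 3) [:: 1 + th y 0 1; th y 0 2; th y 0 3]`_m.

(* [U] is the region which the physical jets [(j, k, l)] are meant to stay in; it
   surrounds the jet [(1, 0, 0)] of the identity. *)
Definition is_cutoff (chi : 'rV[R]_3 -> R) (U : set 'rV[R]_3) : Prop :=
  [/\ forall k, Cb_frechet k chi,
      compact (closure [set z | chi z != 0]),
      forall z, 0 <= chi z <= 1,
      open U /\ U (\row_(m < 3) (m == 0)%:R)
    & forall z, U z -> chi z = 1].

Definition reset_field (H : R -> R) (chi : 'rV[R]_3 -> R)
    (V : Ejet R -> Ejet R) : Prop :=
  forall th y, V th y =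
    chi (jet_derivs th y) *:
      jet_field H (y + th y 0 0) (1 + th y 0 1) (th y 0 2) (th y 0 3).

Definition cutoff_inactive (U : set 'rV[R]_3) (Theta : R -> Ejet R) (u v : R) :=
  forall t, u <= t <= v -> forall y, U (jet_derivs (Theta t) y).

(* The control of [x] on [[u, v]] is below a threshold [eta] that guarantees that
   the cutoff is inactive along the solution of the augmented reset equation. *)
Definition reset_interval (p T : R) (U : set 'rV[R]_3)
    (V : 'I_d -> Ejet R -> Ejet R) (x : two_level R d) (u v : R) : Prop :=
  exists eta : R,
    [/\ 0 < eta,
        (rough_control p x u v <= eta%:E)%E
      & forall (x' : two_level R d) (Theta : R -> Ejet R),
          WGOmega p T x' -> rde_solution p V x' Theta u v ->
          (rough_control p x' u v <= eta%:E)%E ->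
          cutoff_inactive U Theta u v].

Definition reset_partition (p T : R) (U : set 'rV[R]_3)
    (V : 'I_d -> Ejet R -> Ejet R) (x : two_level R d) (D : seq R) : Prop :=
  itv_partition 0 T D /\
  forall u v, partition_piece 0 D u v -> reset_interval p T U V x u v.

End ResetFlow.

(* Main.v *)
Require Import Defs.
From mathcomp Require Import all_boot all_order all_algebra.
From mathcomp Require Import all_classical all_reals all_analysis.
From mathcomp Require Import ring lra.
Import Order.TTheory GRing.Theory Num.Theory.
Import numFieldNormedType.Exports.
Set Implicit Arguments.
Unset Strict Implicit.
Unset Printing Implicit Defensive.
Local Open Scope classical_set_scope.
Local Open Scope ring_scope.

(** The tangent equation is affine in [P]; adjoining a constant coordinate turns
    it into a linear equation on [E * R], whose one-step maps [z |-> z + W z],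
    built from [Xi], are multiplicative up to the cube of the [1 / p]-th power of
    a control.  Since [P] is prescribed at the right end point, one multiplies the
    approximate inverses [z - W z + W (W z)] along partitions: sewing gives the
    convergence of these products, existence, uniqueness and the linear bound,
    with constants independent of [tau].  For a joint-lift representative, the
    skewness of [a] turns the sum of [a i j] times [bracket i j] over [i < j] into
    the full sum of [a j i] times [Qfield j i], so that the rough and the Young
    germ of the variation equation add up to [Xi]; hence both notions of solution
    have the same compensated Riemann sums. *)

(** Finite variation provides a supremum over partitions, not a control. The superadditive hull of
    $|K|^r$ is therefore shown to be continuous, and every control is then replaced by the
    increments of one function, for which halving, adding and rescaling are immediate. The constants
    must not depend on [tau], although the control has to dominate it. The variations of [tau] are
    divided by powers of a bound [N] of its norm before they enter the control, so that its total
    mass stays bounded, and the adjoined constant coordinate carries the weight [N]. An intrinsic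
    solution may use any control and any constant in its remainder. Products along fine partitions
    forget both, because the remainder has order $3/p > 1$; uniqueness and the quantitative bounds
    come from this one comparison. That [Xi] composes up to cubes rests on Chen's relations, on
    Taylor bounds of order two, and on the symmetry of $D^2V_i$, which has to be extracted from
    iterated directional differentials. *)

Section Partitions.
Context {R : realType}.
Implicit Types (a b c x y eta : R) (D : seq R).

Lemma partition_piece_cons a b D x y : partition_piece a (b :: D) x y <->
  (x = a /\ y = b) \/ partition_piece b D x y.
Proof.
split=> [[[|i] [/= iD xE yE]]|[[-> ->]|[i [iD xE yE]]]].
- by left.
- right; exists i; split=> //; rewrite ?xE ?yE; apply: set_nth_default => //=.
  exact: ltnW.
- by exists 0%N.
- exists i.+1; split; rewrite ?xE ?yE //=; last exact: set_nth_default.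
  by apply: set_nth_default; rewrite /= ltnS ltnW.
Qed.

Lemma partition_piece_nil a x y : ~ partition_piece a [::] x y.
Proof. by case=> i []. Qed.

Lemma partition_piece_cat a D1 D2 x y : partition_piece a (D1 ++ D2) x y ->
  partition_piece a D1 x y \/ partition_piece (last a D1) D2 x y.
Proof.
elim: D1 a => [|c D1 IH] a /=; first by right.
move=> /partition_piece_cons[xy|/IH[xy|xy]].
- by left; apply/partition_piece_cons; left.
- by left; apply/partition_piece_cons; right.
- by right.
Qed.

Lemma itv_partition_consE a b c D : itv_partition a b (c :: D) ->
  [/\ a < c, c <= b & itv_partition c b D].
Proof.
move=> aD; have cD := itv_partition_cons aD.
by case: aD => /= /andP[ac _] _; split=> //; exact: itv_partition_le cD.
Qed.

Lemma itv_partition_catE a b D1 D2 : itv_partition a b (D1 ++ D2) ->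
  itv_partition a (last a D1) D1 /\ itv_partition (last a D1) b D2.
Proof.
by case; rewrite cat_path last_cat => /andP[p1 p2] /eqP lb; split; split => //; apply/eqP.
Qed.

Lemma itv_partition_mem a b D x : itv_partition a b D -> x \in D -> a < x <= b.
Proof.
elim: D a => // c D IH a /itv_partition_consE[ac cb cD].
rewrite inE => /predU1P[->|xD]; first by rewrite ac.
by have /andP[cx ->] := IH _ cD xD; rewrite (lt_trans ac).
Qed.

Lemma partition_piece_itv a b D x y : itv_partition a b D ->
  partition_piece a D x y -> [/\ a <= x, x < y & y <= b].
Proof.
elim: D a => [a _ /partition_piece_nil//|c D IH a /itv_partition_consE[ac cb cD]].
move=> /partition_piece_cons[[-> ->]//|/(IH _ cD)[cx xy yb]].
by split=> //; rewrite (le_trans (ltW ac)).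
Qed.

Lemma riemann_sum_nil {F : nmodType} (K : R -> R -> F) a b :
  riemann_sum K a b [::] = 0.
Proof. by rewrite /riemann_sum big_nil. Qed.

Lemma riemann_sum_cons {F : nmodType} (K : R -> R -> F) a b c D :
  riemann_sum K a b (c :: D) = K a c + riemann_sum K c b D.
Proof. by rewrite /riemann_sum big_nat_recl. Qed.

Lemma riemann_sum_cat {F : nmodType} (K : R -> R -> F) a b D1 D2 :
  riemann_sum K a b (D1 ++ D2) =
  riemann_sum K a b D1 + riemann_sum K (last a D1) b D2.
Proof.
elim: D1 a => [|c D1 IH] a /=; first by rewrite riemann_sum_nil add0r.
by rewrite !riemann_sum_cons IH addrA.
Qed.

(** The right end point enters [riemann_sum] only as the default value of [nth], which is never
    reached. This lets sums over adjacent intervals be joined. *)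
Lemma riemann_sum_end {F : nmodType} (K : R -> R -> F) a b b' D :
  riemann_sum K a b D = riemann_sum K a b' D.
Proof.
elim: D a => [|c D IH] a; first by rewrite !riemann_sum_nil.
by rewrite !riemann_sum_cons IH.
Qed.

Lemma fine_partition a b eta : a <= b -> 0 < eta ->
  exists2 D, itv_partition a b D &
    forall x y, partition_piece a D x y -> y - x < eta.
Proof.
move=> ab eta0.
have [n] : exists n : nat, b - a <= n%:R * (eta / 2).
  exists (Num.bound ((b - a) / (eta / 2))); rewrite -ler_pdivrMr ?divr_gt0//.
  by apply/ltW/archi_boundP; rewrite divr_ge0 ?subr_ge0// divr_ge0// ltW.
elim: n a ab => [|n IH] a ab ban.
  have -> : a = b by apply/eqP; rewrite eq_le ab/=; move: ban; lra.
  by exists [::] => // x y /partition_piece_nil.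
have [->|anb] := eqVneq a b; first by exists [::] => // x y /partition_piece_nil.
have [small|big] := ltP (b - a) eta.
  exists [:: b]; first by apply: itv_partition1; rewrite lt_neqAle anb.
  by move=> x y /partition_piece_cons[[-> ->]//|/partition_piece_nil].
have [||D cD mD] := IH (a + eta / 2).
- by lra.
- by move: ban; rewrite -natr1; lra.
exists (a + eta / 2 :: D).
  by case: cD => p l; split=> //=; rewrite p andbT; lra.
by move=> x y /partition_piece_cons[[-> ->]|/mD//]; lra.
Qed.

Lemma mem_rcons_split {T : eqType} (z : T) s : z \in s ->
  exists s1 s2, s = rcons s1 z ++ s2.
Proof. by case/splitPr => s1 s2; exists s1, s2; rewrite cat_rcons. Qed.

Lemma itv_partition_split a b D c : itv_partition a b D -> c \in D ->
  exists D1 D2, [/\ D = D1 ++ D2, last a D1 = c, itv_partition a c D1,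
    itv_partition c b D2 & forall x, x \in D -> c < x -> x \in D2].
Proof.
move=> aD cD; have [D1 [D2 DE]] := mem_rcons_split cD.
move: aD; rewrite DE => aD.
have [] := itv_partition_catE aD; rewrite last_rcons => p1 p2.
exists (rcons D1 c), D2; split; rewrite ?last_rcons// => x.
rewrite mem_cat => /orP[/(itv_partition_mem p1)/andP[_ xc]|//].
by rewrite ltNge xc.
Qed.

(** The sorted union of the two lists works. The point to check is that it ends at [b], also in the
    degenerate case [a = b]. *)
Lemma common_refinement a b D D' : itv_partition a b D -> itv_partition a b D' ->
  exists E, [/\ itv_partition a b E, {subset D <= E} & {subset D' <= E}].
Proof.
move=> aD aD'; pose E := sort <=%O (undup (D ++ D')).
have memE x : (x \in E) = (x \in D) || (x \in D').
  by rewrite mem_sort mem_undup mem_cat.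
exists E; split; last 2 first.
- by move=> x xD; rewrite memE xD.
- by move=> x xD; rewrite memE xD orbT.
have Eab x : x \in E -> a < x <= b.
  by rewrite memE => /orP[/(itv_partition_mem aD)|/(itv_partition_mem aD')].
have pE : path <%O a E.
  rewrite lt_path_sortedE sort_lt_sorted undup_uniq andbT.
  by apply/allP => x /Eab/andP[].
split=> //; rewrite eq_le; apply/andP; split.
  have := mem_last a E; rewrite inE => /predU1P[->|/Eab/andP[]//].
  exact: itv_partition_le aD.
have := mem_last a D; case: (aD) => _ /eqP ->; rewrite inE => /predU1P[ba|bD].
  by have := mem_last a E; rewrite ba inE => /predU1P[->//|/Eab/andP[/ltW]].
have bE : b \in E by rewrite memE bD.
have [E1 [E2 EE]] := mem_rcons_split bE.
move: pE; rewrite EE cat_path last_cat last_rcons => /andP[_].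
case: E2 {EE} => //= e E2 /andP[be /lt_path_min/allP eE].
have := mem_last e E2; rewrite inE => /predU1P[->|]; first exact: ltW.
by move/eE => /(lt_trans be)/ltW.
Qed.

End Partitions.

(** * Controls given by the increments of a single function *)

Section AdditiveControls.
Context {R : realType}.
Implicit Types (u v s t p : R) (f g : R -> R).

Lemma ler_eq (x y : R) : x = y -> x <= y.
Proof. by move->. Qed.

(* [f] stands for the control [w(s, t) = f t - f s]. *)
Definition additive_control u v f : Prop :=
  (forall s t, u <= s -> s <= t -> t <= v -> f s <= f t) /\
  (forall eps, 0 < eps -> exists2 delta, 0 < delta &
     forall s t, u <= s -> s <= t -> t <= v -> t - s < delta -> f t - f s < eps).

(** The unit of size for increments: first levels are of order one in it, second levels of order
    two, and cubes are summable to zero along fine partitions when $p < 3$. *)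
Definition radius p f s t : R := (f t - f s) `^ p^-1.

Lemma radius_ge0 p f s t : 0 <= radius p f s t.
Proof. exact: powR_ge0. Qed.

Lemma radius_cube p f s t : 0 < p -> radius p f s t ^+ 3 = (f t - f s) `^ (3 / p).
Proof.
by move=> p0; rewrite -powR_mulrn ?powR_ge0// -powRrM mulrC.
Qed.

Lemma radius_sqr p f s t : 0 < p -> radius p f s t ^+ 2 = (f t - f s) `^ (2 / p).
Proof.
by move=> p0; rewrite -powR_mulrn ?powR_ge0// -powRrM mulrC.
Qed.

Lemma le_radius p f g s t s' t' : 0 < p -> 0 <= f t - f s ->
  f t - f s <= g t' - g s' -> radius p f s t <= radius p g s' t'.
Proof.
move=> p0 f0 fg; apply: ge0_ler_powR; rewrite ?nnegrE ?invr_ge0 ?(ltW p0)//.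
exact: le_trans f0 fg.
Qed.

Lemma additive_controlW u v u' v' f : u <= u' -> v' <= v ->
  additive_control u v f -> additive_control u' v' f.
Proof.
move=> uu vv [mf cf]; split=> [s t us st tv|eps /cf[d d0 fd]].
  by apply: mf => //; [exact: le_trans uu us|exact: le_trans tv vv].
exists d => // s t us st tv; apply: fd => //; first exact: le_trans uu us.
exact: le_trans tv vv.
Qed.

Lemma additive_controlD u v f g : additive_control u v f ->
  additive_control u v g -> additive_control u v (fun t => f t + g t).
Proof.
move=> [mf cf] [mg cg]; split=> [s t us st tv|eps e0].
  by rewrite lerD ?mf ?mg.
have e20 : 0 < eps / 2 by rewrite divr_gt0.
have [d d0 fd] := cf _ e20; have [d' d'0 gd] := cg _ e20.
exists (Num.min d d'); first by rewrite lt_min d0.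
move=> s t us st tv; rewrite lt_min => /andP[td td'].
have := fd _ _ us st tv td; have := gd _ _ us st tv td'; lra.
Qed.

Lemma additive_controlZ u v f k : 0 <= k -> additive_control u v f ->
  additive_control u v (fun t => k * f t).
Proof.
move=> k0 [mf cf]; split=> [s t us st tv|eps e0].
  by rewrite ler_wpM2l ?mf.
have ek : 0 < eps / (k + 1) by rewrite divr_gt0 ?ltr_wpDl.
have [d d0 fd] := cf _ ek; exists d => // s t us st tv td.
have := fd _ _ us st tv td; rewrite ltr_pdivlMr ?ltr_wpDl// => fe.
have := mf _ _ us st tv; nra.
Qed.

End AdditiveControls.

(** * Multiplicative sewing of almost multiplicative families of maps *)

Section OrderedProducts.
Context {R : realType}.

(** The map of the last interval acts first, so that a value prescribed at the right end point is
    carried back to [a]. *)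
Fixpoint oprod {F : Type} (L : R -> R -> F -> F) (a : R) (D : seq R) : F -> F :=
  if D is b :: D' then fun z => L a b (oprod L b D' z) else id.

Lemma oprod_cat {F : Type} (L : R -> R -> F -> F) a D1 D2 z :
  oprod L a (D1 ++ D2) z = oprod L a D1 (oprod L (last a D1) D2 z).
Proof. by elim: D1 a => //= c D1 IH a; rewrite IH. Qed.

Record almost_mult {F : normedModType R} (p c C u v : R) (f : R -> R)
    (L : R -> R -> F -> F) : Prop := AlmostMult {
  am_mono : forall s t, u <= s -> s <= t -> t <= v -> f s <= f t;
  am_sub : forall s t a b, u <= s -> s <= t -> t <= v ->
    L s t (a - b) = L s t a - L s t b;
  am_id : forall s z, u <= s -> s <= v -> L s s z = z;
  am_bound : forall s t z, u <= s -> s <= t -> t <= v ->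
    `|L s t z| <= (1 + c * radius p f s t) * `|z|;
  am_defect : forall s m t z, u <= s -> s <= m -> m <= t -> t <= v ->
    `|L s m (L m t z) - L s t z| <= C * radius p f s t ^+ 3 * `|z|
}.

(** Take for [c] the first point whose mass from [a] reaches [h]. Its predecessor has mass at most
    [h], and additivity leaves at most [h] to the right of [c]. *)
Lemma half_split (f : R -> R) a b D h : itv_partition a b D -> D != [::] ->
  (forall x, x \in D -> f x <= f b) -> 0 <= h -> f b - f a = 2 * h ->
  exists D1 c D2, [/\ D = D1 ++ c :: D2, f (last a D1) - f a <= h &
    f b - f c <= h].
Proof.
move=> aD D0 fD h0 fab.
suff : forall a', itv_partition a' b D -> f a' - f a <= h ->
    exists D1 c D2, [/\ D = D1 ++ c :: D2, f (last a' D1) - f a <= h &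
      f b - f c <= h] by apply => //; lra.
elim: D D0 fD {aD} => // c D IH _ fD a' a'D a'h.
have [ch|ch] := ltP (f c - f a) h; last first.
  by exists [::], c, D; split=> //; lra.
have cD := itv_partition_cons a'D.
have D0 : D != [::].
  by apply/eqP => DE; move: cD ch; rewrite DE => /itv_partition_nil ->; lra.
have [] := IH D0 _ c cD (ltW ch).
  by move=> x xD; apply: fD; rewrite inE xD orbT.
by move=> D1 [d [D2 [-> l fd]]]; exists (c :: D1), d, D2.
Qed.

(** This is $2^{1-3/p} < 1$, the form in which $p < 3$ enters the contraction. *)
Lemma half_powR_lt1 (p : R) : 0 < p < 3 -> 2 * ((2^-1 : R) `^ p^-1) ^+ 3 < 1.
Proof.
move=> /andP[p0 p3]; rewrite -powR_mulrn ?powR_ge0// -powRrM mulrC.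
have e0 : 0 < p^-1 * 3 by rewrite mulr_gt0 ?invr_gt0.
rewrite -(@mulr_powRB1 _ 2^-1)// mulrAC mulVf// mul1r.
have e1 : 0 < p^-1 * 3 - 1 by rewrite subr_gt0 mulrC ltr_pdivlMr ?mul1r.
have /= := @gt0_ltr_powR R _ e1 2^-1 1; rewrite powR1 !nnegrE; apply=> //.
by rewrite invf_lt1// ltr1n.
Qed.

Lemma am_oprod_sub {F : normedModType R} p c C u v f (L : R -> R -> F -> F) :
  almost_mult p c C u v f L -> forall a b D y z, u <= a -> b <= v ->
  itv_partition a b D -> oprod L a D (y - z) = oprod L a D y - oprod L a D z.
Proof.
move=> Lm a b D y z ua bv; elim: D a ua => //= e D IH a ua.
move=> /itv_partition_consE[ae eb eD].
have ue := le_trans ua (ltW ae); rewrite IH// (am_sub Lm)// ?(ltW ae)//.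
exact: le_trans bv.
Qed.

(* Splitting a partition at the step that straddles half of the control leaves
   two pieces whose errors are smaller by the factor [2 `^ (- 3 / p)], and
   [2 * 2 `^ (- 3 / p) < 1]. *)
Lemma oprod_small (p c C : R) : 0 < p < 3 -> 0 <= c -> 0 <= C ->
  exists K r0, [/\ 0 <= K, 0 < r0 &
  forall (F : normedModType R) (u v : R) f (L : R -> R -> F -> F),
    almost_mult p c C u v f L -> forall a b D z, u <= a -> b <= v ->
    itv_partition a b D -> radius p f a b <= r0 ->
    `|oprod L a D z - L a b z| <= K * radius p f a b ^+ 3 * `|z|].
Proof.
move=> p03 c0 C0; have := half_powR_lt1 p03.
set sg := (2^-1 : R) `^ p^-1; have sg0 : 0 <= sg by exact: powR_ge0.
have p0 : 0 < p by case/andP: p03.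
set rho := 2 * sg ^+ 3 => rho1.
have rho0 : 0 <= rho by rewrite mulr_ge0// exprn_ge0.
(* [e] is the slack allowed for the norms [1 + e] of the single steps. With [8 * e = 1 - rho], the
   errors of the two halves amount to $\rho(2+8e)/2 \le (1+\rho)/2$ times [K * r ^+ 3]. *)
have [e [e0 e1 eE]] : exists e : R, [/\ 0 < e, e <= 1 & 8 * e = 1 - rho].
  by exists ((1 - rho) / 8); split; lra.
(* The two defects at the cuts weigh at most [3 * C], which is the remaining share [(1 - rho) / 2]
   of [K]. *)
have [K K0 CK'] : exists2 K, 0 <= K & C = (1 - rho) / 6 * K.
  exists (6 * C / (1 - rho)); first by rewrite divr_ge0 ?mulr_ge0// subr_ge0 ltW.
  by field; lra.
(* Below [r0] both [c * r] and [K * r ^+ 3] are at most [e]. *)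
pose r0 := Num.min 1 (Num.min (e / (c + 1)) (e / (K + 1))).
have r00 : 0 < r0.
  by rewrite !lt_min ltr01 /=; apply/andP; split; apply: divr_gt0 => //;
    rewrite ltr_wpDl.
exists K, r0; split=> //; move=> F u v f L Lm a b D z.
have [n] := ubnP (size D); elim: n a b D z => // n IH a b D z Dn ua bv aD rab.
have [DE|D0] := eqVneq D [::].
  move: aD; rewrite DE => /itv_partition_nil ab; rewrite -ab /= (am_id Lm)//.
    by rewrite subrr normr0 !mulr_ge0 ?exprn_ge0 ?radius_ge0.
  by rewrite ab.
set r := radius p f a b in rab *.
have r_ge0 : 0 <= r by exact: radius_ge0.
have ab := itv_partition_le aD.
have fmono s t : a <= s -> s <= t -> t <= b -> f s <= f t.
  by move=> as' st tb; apply: (am_mono Lm) st _; [exact: le_trans ua as'|exact: le_trans tb bv].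
have rs s t : a <= s -> s <= t -> t <= b -> radius p f s t <= r.
  move=> as' st tb; apply: le_radius => //; first by rewrite subr_ge0 fmono.
  by apply: lerB; apply: fmono => //; [exact: le_trans st|exact: le_trans tb].
have fab := am_mono Lm ua ab bv.
have fD x : x \in D -> f x <= f b.
  move=> /(itv_partition_mem aD)/andP[ax xb].
  by apply: (am_mono Lm) => //; rewrite (le_trans ua)// ltW.
have [||D1 [d [D2 [DE l1 l2]]]] :=
    @half_split f a b D ((f b - f a) / 2) aD D0 fD.
- by rewrite divr_ge0// subr_ge0.
- by rewrite mulrC divfK.
move: aD Dn; rewrite DE => /itv_partition_catE[]; set a' := last a D1.
move=> aD1 /itv_partition_consE[a'd db dD2].
rewrite size_cat /= addnS ltnS => Dn.
have aa' := itv_partition_le aD1.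
have hr s t : u <= s -> s <= t -> t <= v -> f t - f s <= (f b - f a) / 2 ->
    radius p f s t <= sg * r.
  move=> us st tv fst; rewrite /r /sg /radius -powRM ?subr_ge0//.
  apply: ge0_ler_powR; rewrite ?nnegrE ?invr_ge0 ?(ltW p0)//.
  - by rewrite subr_ge0 (am_mono Lm).
  - by rewrite mulr_ge0 ?subr_ge0.
  - by rewrite mulrC.
have ud : u <= d by rewrite (le_trans ua)// (le_trans aa')// ltW.
have ua' : u <= a' by rewrite (le_trans ua).
have dv : d <= v by rewrite (le_trans db).
have r1 := hr _ _ ua aa' (le_trans (ltW a'd) dv) l1.
have r2 := hr _ _ ud db bv l2.
have cr : c * r <= e.
  have : r <= e / (c + 1) by rewrite (le_trans rab)// !ge_min lexx orbT.
  by rewrite ler_pdivlMr ?ltr_wpDl//; nra.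
have Kr : K * r ^+ 3 <= e.
  have : r <= e / (K + 1) by rewrite (le_trans rab)// !ge_min lexx !orbT.
  rewrite ler_pdivlMr ?ltr_wpDl// => Kr.
  have r1' : r <= 1 by rewrite (le_trans rab)// ge_min lexx.
  have r3 : r ^+ 3 <= r by rewrite exprS -[leRHS]mulr1 ler_wpM2l// exprn_ile1.
  by rewrite (le_trans (ler_wpM2l K0 r3))//; nra.
have sgr_le : sg * r <= r.
  rewrite -[leRHS]mul1r ler_wpM2r//.
  case: (leP sg 1) => // sg1; have := exprn_ege1 3 (ltW sg1).
  by move: rho1; rewrite /rho; lra.
have sr3 x : 0 <= x -> x <= sg * r -> K * x ^+ 3 <= rho / 2 * (K * r ^+ 3).
  move=> x0 xs; have : x ^+ 3 <= (sg * r) ^+ 3.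
    by rewrite lerXn2r// nnegrE mulr_ge0.
  move=> /(ler_wpM2l K0)/le_trans; apply.
  by rewrite exprMn /rho; lra.
set X := `|z|; have X0 : 0 <= X by exact: normr_ge0.
set k := rho / 2 * (K * r ^+ 3).
have Kr0 : 0 <= K * r ^+ 3 by rewrite mulr_ge0 ?exprn_ge0.
have k0 : 0 <= k by rewrite mulr_ge0// divr_ge0.
have kE : k <= e by rewrite (le_trans _ Kr)// /k; nra.
have Lb s t y : a <= s -> s <= t -> t <= b -> `|L s t y| <= (1 + e) * `|y|.
  move=> as' st tb.
  have /le_trans := am_bound Lm y (le_trans ua as') st (le_trans tb bv); apply.
  rewrite ler_wpM2r// lerD2l (le_trans _ cr)// ler_wpM2l// rs//.
have a'b : a' <= b by rewrite (le_trans (ltW a'd)).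
have ad : a <= d by rewrite (le_trans aa')// ltW.
rewrite oprod_cat /=; set y := oprod L d D2 z.
have yE : `|y - L d b z| <= k * X.
  have := IH d b D2 z _ ud bv dD2 (le_trans r2 (le_trans sgr_le rab)).
  move=> /(_ _)/le_trans; apply; first by rewrite (leq_trans _ Dn)// ltnS leq_addl.
  by rewrite ler_wpM2r// sr3// radius_ge0.
have lz : `|L d b z| <= (1 + e) * X by exact: Lb.
have yb : `|y| <= (1 + 2 * e) * X.
  rewrite -[y](subrK (L d b z)) (le_trans (ler_normD _ _))//.
  rewrite (le_trans (lerD yE lz))// -mulrDl ler_wpM2r//; lra.
set w := L a' d y.
have wb : `|w| <= (1 + e) * ((1 + 2 * e) * X).
  rewrite (le_trans (Lb _ _ _ _ _ _))// ?(ltW a'd)// ler_wpM2l// addr_ge0// ltW//.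
have e1' : `|oprod L a D1 w - L a a' w| <= k * ((1 + e) * ((1 + 2 * e) * X)).
  have := IH a a' D1 w _ ua (le_trans a'b bv) aD1 (le_trans r1 (le_trans sgr_le rab)).
  move=> /(_ _)/le_trans; apply; first by rewrite (leq_trans _ Dn)// ltnS leq_addr.
  by rewrite ler_pM// ?sr3 ?radius_ge0// mulr_ge0 ?exprn_ge0 ?radius_ge0.
have e2 : `|L a a' w - L a a' (L a' d (L d b z))| <= (1 + e) * ((1 + e) * (k * X)).
  rewrite -(am_sub Lm) ?(le_trans a'b)// -(am_sub Lm) ?(ltW a'd)//.
  rewrite (le_trans (Lb _ _ _ _ _ _))// ler_wpM2l ?addr_ge0 ?(ltW e0)//.
  rewrite (le_trans (Lb _ _ _ _ _ _)) ?(ltW a'd)//.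
  by rewrite ler_wpM2l ?addr_ge0 ?(ltW e0).
have e3 : `|L a a' (L a' d (L d b z)) - L a d (L d b z)| <=
    C * r ^+ 3 * ((1 + e) * X).
  rewrite (le_trans (am_defect Lm _ _ _ _ _)) ?(ltW a'd)//.
  rewrite ler_pM// ?mulr_ge0 ?exprn_ge0 ?radius_ge0//.
  by rewrite ler_wpM2l// lerXn2r ?nnegrE ?radius_ge0// rs.
have e4 : `|L a d (L d b z) - L a b z| <= C * r ^+ 3 * X.
  exact: (am_defect Lm).
(* Four errors: the left product, the right product pushed through two single steps, the defect at
   [a'], and the defect at [d]. *)
have -> : oprod L a D1 w - L a b z = (oprod L a D1 w - L a a' w) +
    (L a a' w - L a a' (L a' d (L d b z))) +
    (L a a' (L a' d (L d b z)) - L a d (L d b z)) +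
    (L a d (L d b z) - L a b z).
  by rewrite !subrKA.
have := ler_normD (oprod L a D1 w - L a a' w +
    (L a a' w - L a a' (L a' d (L d b z))) +
    (L a a' (L a' d (L d b z)) - L a d (L d b z))) (L a d (L d b z) - L a b z).
move=> /le_trans; apply.
rewrite (le_trans (lerD (le_trans (ler_normD _ _) (lerD (le_trans (ler_normD _ _)
  (lerD e1' e2)) e3)) e4))//.
have -> : k * ((1 + e) * ((1 + 2 * e) * X)) + (1 + e) * ((1 + e) * (k * X)) +
   C * r ^+ 3 * ((1 + e) * X) + C * r ^+ 3 * X =
   (k * (2 + 5 * e + 3 * e ^+ 2) + (2 + e) * (C * r ^+ 3)) * X by ring.
rewrite ler_wpM2r//.
have Cr0 : 0 <= C * r ^+ 3 by rewrite mulr_ge0 ?exprn_ge0.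
have CK : C * r ^+ 3 = (1 - rho) / 6 * (K * r ^+ 3) by rewrite CK'; ring.
have k1 : k * (2 + 5 * e + 3 * e ^+ 2) <= k * (2 + 8 * e).
  rewrite ler_wpM2l//; nra.
have k2 : k * (2 + 8 * e) <= (1 + rho) / 2 * (K * r ^+ 3).
  by rewrite /k mulrAC ler_wpM2r//; nra.
have k3 : (2 + e) * (C * r ^+ 3) <= 3 * (C * r ^+ 3).
  by rewrite ler_wpM2r//; lra.
move: (K * r ^+ 3) k1 k2 k3 CK => Q; lra.
Qed.

End OrderedProducts.

Section Sewing.
Context {R : realType}.

(** Doubling in the mass: an interval of mass at most [2 ^+ n.+1 * del] is cut into two pieces of
    half that mass and one straddling step, so each doubling squares the bound up to the norm of
    that step. *)
Lemma oprod_bounded (p c C Om : R) : 0 < p < 3 -> 0 <= c -> 0 <= C ->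
  exists2 B, 0 <= B &
  forall (F : normedModType R) (u v : R) f (L : R -> R -> F -> F),
    almost_mult p c C u v f L -> forall a b D z, u <= a -> b <= v ->
    itv_partition a b D -> f b - f a <= Om -> `|oprod L a D z| <= B * `|z|.
Proof.
move=> p03 c0 C0; have [K [r0 [K0 r00 small]]] := oprod_small p03 c0 C0.
have p0 : 0 < p by case/andP: p03.
(* The mass whose radius is [r0], the range of [oprod_small]. *)
set del := r0 `^ p; have del0 : 0 < del by exact: powR_gt0.
have rad_le (f : R -> R) a b h : f a <= f b -> f b - f a <= h ->
    radius p f a b <= h `^ p^-1.
  move=> fab fh; apply: ge0_ler_powR; rewrite ?nnegrE ?invr_ge0 ?(ltW p0) ?subr_ge0//.
  by apply: le_trans fh; rewrite subr_ge0.
suff Hn n : exists2 B, 1 <= B &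
  forall (F : normedModType R) (u v : R) f (L : R -> R -> F -> F),
    almost_mult p c C u v f L -> forall a b D z, u <= a -> b <= v ->
    itv_partition a b D -> f b - f a <= 2 ^+ n * del -> `|oprod L a D z| <= B * `|z|.
  have [n Hom] : exists n : nat, Om <= 2 ^+ n * del.
    have h := archi_boundP (divr_ge0 (normr_ge0 Om) (ltW del0)).
    move: (Num.bound _) h => n h; exists n; rewrite -ler_pdivrMr//.
    apply: (@le_trans _ _ (`|Om| / del)).
      by rewrite ler_wpM2r ?invr_ge0 ?(ltW del0) ?ler_norm.
    apply: ltW; apply: lt_le_trans h _; rewrite -natrX ler_nat.
    by apply: ltnW; exact: ltn_expl.
  have [B B1 HB] := Hn n; exists B; first exact: le_trans B1.
  move=> F u v f L Lm a b D z ua bv aD fab; apply: HB Lm _ _ _ _ ua bv aD _.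
  exact: le_trans Hom.
elim: n => [|n [B B1 IH]].
  exists (1 + c * r0 + K * r0 ^+ 3).
    by rewrite -addrA lerDl addr_ge0 ?mulr_ge0 ?exprn_ge0 ?(ltW r00).
  move=> F u v f L Lm a b D z ua bv aD; rewrite expr0 mul1r => fab.
  have ab := itv_partition_le aD.
  have rr : radius p f a b <= r0.
    have := rad_le f a b _ (am_mono Lm ua ab bv) fab.
    by rewrite /del -powRrM mulfV ?gt_eqF// powRr1// ltW.
  rewrite -[oprod _ _ _ _](subrK (L a b z)) (le_trans (ler_normD _ _))//.
  have := small _ _ _ _ _ Lm a b D z ua bv aD rr.
  have := am_bound Lm z ua ab bv.
  have r3 : radius p f a b ^+ 3 <= r0 ^+ 3.
    by rewrite lerXn2r ?nnegrE ?radius_ge0 ?(ltW r00).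
  move=> h1 h2; rewrite (le_trans (lerD h2 h1))// -mulrDl ler_wpM2r// addrC.
  by rewrite lerD// ?lerD2l ler_wpM2l.
pose M := B * ((1 + c * (2 ^+ n.+1 * del) `^ p^-1) * B).
have M1 : 1 <= M.
  rewrite /M mulr_ege1// mulr_ege1// lerDl mulr_ge0// powR_ge0//.
exists M => // F u v f L Lm a b D z ua bv aD fab.
have ab := itv_partition_le aD.
have [DE|D0] := eqVneq D [::].
  by rewrite DE/= -[leLHS]mul1r ler_wpM2r.
have fD x : x \in D -> f x <= f b.
  move=> /(itv_partition_mem aD)/andP[ax xb].
  by apply: (am_mono Lm) => //; rewrite (le_trans ua)// ltW.
have [||D1 [d [D2 [DE l1 l2]]]] :=
    @half_split _ f a b D ((f b - f a) / 2) aD D0 fD.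
- by rewrite divr_ge0// subr_ge0 (am_mono Lm).
- by rewrite mulrC divfK.
move: aD; rewrite DE => /itv_partition_catE[]; set a' := last a D1.
move=> aD1 /itv_partition_consE[a'd db dD2].
have aa' := itv_partition_le aD1.
have ua' : u <= a' by exact: le_trans aa'.
have ud : u <= d by exact: le_trans (ltW a'd).
have dv : d <= v by exact: le_trans bv.
have half : (f b - f a) / 2 <= 2 ^+ n * del.
  by rewrite ler_pdivrMr// mulrAC -exprSr.
rewrite oprod_cat /=.
have h1 := IH _ _ _ _ _ Lm d b D2 z ud bv dD2 (le_trans l2 half).
have h2 := am_bound Lm (oprod L d D2 z) ua' (ltW a'd) dv.
have h3 := IH _ _ _ _ _ Lm a a' D1 (L a' d (oprod L d D2 z)) ua
  (le_trans (ltW a'd) dv) aD1 (le_trans l1 half).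
rewrite (le_trans h3)// /M -mulrA ler_wpM2l ?(le_trans ler01)//.
rewrite (le_trans h2)// -mulrA ler_pM//.
  by rewrite addr_ge0// mulr_ge0// radius_ge0.
rewrite lerD2l ler_wpM2l// rad_le ?(am_mono Lm)// ?(ltW a'd)//.
rewrite (le_trans _ fab)// lerB// (am_mono Lm)//.
exact: le_trans (ltW a'd) dv.
Qed.

(** Radii up to [r0] are covered by [oprod_small]. Beyond [r0] the crude bound is already cubic
    after division by [r0 ^+ 3]. [K] is chosen before the space, the interval, the control and the
    maps, which makes all later constants uniform. *)
Lemma sewing (p c C Om : R) : 0 < p < 3 -> 0 <= c -> 0 <= C ->
  exists2 K, 0 <= K &
  forall (F : normedModType R) (u v : R) f (L : R -> R -> F -> F),
    almost_mult p c C u v f L -> forall a b D z, u <= a -> b <= v ->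
    itv_partition a b D -> f b - f a <= Om -> `|oprod L a D z| <= K * `|z| /\
    `|oprod L a D z - L a b z| <= K * radius p f a b ^+ 3 * `|z|.
Proof.
move=> p03 c0 C0; have [K [r0 [K0 r00 small]]] := oprod_small p03 c0 C0.
have [B B0 HB] := oprod_bounded Om p03 c0 C0.
have p0 : 0 < p by case/andP: p03.
pose K' := (B + (1 + c * `|Om| `^ p^-1)) / r0 ^+ 3.
have K'0 : 0 <= K'.
  by rewrite divr_ge0 ?exprn_ge0 ?(ltW r00)// addr_ge0// addr_ge0// mulr_ge0 ?powR_ge0.
exists (B + K + K'); first by rewrite !addr_ge0.
move=> F u v f L Lm a b D z ua bv aD fab.
have ab := itv_partition_le aD; have bound := HB _ _ _ _ _ Lm a b D z ua bv aD fab.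
split; first by rewrite (le_trans bound)// ler_wpM2r// -addrA lerDl addr_ge0.
set r := radius p f a b; have rge0 : 0 <= r ^+ 3 by rewrite exprn_ge0 ?radius_ge0.
have [rr0|rr0] := leP r r0.
  rewrite (le_trans (small _ _ _ _ _ Lm a b D z ua bv aD rr0))// ler_wpM2r//.
  by rewrite ler_wpM2r//; lra.
have rOm : r <= `|Om| `^ p^-1.
  apply: ge0_ler_powR; rewrite ?nnegrE ?invr_ge0 ?(ltW p0) ?subr_ge0 ?(am_mono Lm)//.
  by rewrite (le_trans fab)// ler_norm.
rewrite (le_trans (ler_normB _ _))//.
rewrite (le_trans (lerD bound (am_bound Lm z ua ab bv)))// -mulrDl ler_wpM2r//.
have r03 : 0 < r0 ^+ 3 by rewrite exprn_gt0.
have r3 : r0 ^+ 3 <= r ^+ 3 by rewrite lerXn2r ?nnegrE ?(ltW r00) ?radius_ge0// ltW.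
apply: (@le_trans _ _ (K' * r ^+ 3)); last by rewrite ler_wpM2r//; lra.
apply: (@le_trans _ _ (K' * r0 ^+ 3)); last by rewrite ler_wpM2l.
by rewrite /K' divfK ?gt_eqF// lerD2l lerD2l ler_wpM2l.
Qed.

End Sewing.

(** * Limits along partitions of vanishing mesh *)

Section MeshLimits.
Context {R : realType}.

(** Completeness as a property of a normed module, so that it can be transferred from row vectors to
    [bcont] and to products with the scalars. *)
Definition seq_complete (F : normedModType R) : Prop := forall y : nat -> F,
  (forall eps : R, 0 < eps -> exists N, forall m n, (N <= m)%N -> (N <= n)%N ->
     `|y m - y n| < eps) ->
  exists l, forall eps : R, 0 < eps -> exists N, forall n, (N <= n)%N ->
     `|y n - l| < eps.

Definition finer (delta a : R) (D : seq R) : Prop :=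
  forall x y, partition_piece a D x y -> y - x < delta.

(* [riemann_limit K s t J] is [mesh_limit (riemann_sum K s t) s t J]. *)
Definition mesh_limit {F : normedModType R} (S : seq R -> F) (a b : R) (J : F) :=
  forall eps : R, 0 < eps -> exists2 delta : R, 0 < delta &
    forall D, itv_partition a b D -> finer delta a D -> `|S D - J| < eps.

Lemma finer_cat delta a D1 D2 : finer delta a D1 -> finer delta (last a D1) D2 ->
  finer delta a (D1 ++ D2).
Proof. by move=> h1 h2 x y /partition_piece_cat; case; [exact: h1|exact: h2]. Qed.

Lemma finerW delta delta' a D : delta <= delta' -> finer delta a D ->
  finer delta' a D.
Proof. by move=> dd h x y /h yx; exact: lt_le_trans yx dd. Qed.

Lemma mesh_limit_exists {F : normedModType R} (S : seq R -> F) a b :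
  seq_complete F -> a <= b ->
  (forall eps, 0 < eps -> exists2 delta, 0 < delta &
    forall D D', itv_partition a b D -> itv_partition a b D' ->
      finer delta a D -> finer delta a D' -> `|S D - S D'| < eps) ->
  exists J, mesh_limit S a b J.
Proof.
move=> Fc ab SC.
have /choice[D HD] : forall n : nat, exists D,
    itv_partition a b D /\ finer n.+1%:R^-1 a D.
  move=> n; have n0 : 0 < n.+1%:R^-1 :> R by rewrite invr_gt0.
  by have [D aD fD] := fine_partition ab n0; exists D.
have inv_small (delta : R) : 0 < delta -> exists N, forall n, (N <= n)%N ->
    n.+1%:R^-1 <= delta.
  move=> d0; have di : 0 <= delta^-1 by rewrite invr_ge0 ltW.
  have := archi_boundP di; move: (Num.bound _) => N NE.
  exists N => n Nn; rewrite invf_ple ?posrE//.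
  by rewrite (le_trans (ltW NE))// ler_nat leqW.
have [J HJ] : exists J, forall eps : R, 0 < eps -> exists N, forall n,
    (N <= n)%N -> `|S (D n) - J| < eps.
  apply: Fc => eps /SC[d d0 dS]; have [N HN] := inv_small d d0.
  exists N => m n Nm Nn; have [Dm fm] := HD m; have [Dn fn] := HD n.
  by apply: dS => //; [exact: finerW (HN _ Nm) fm|exact: finerW (HN _ Nn) fn].
exists J => eps e0; have e20 : 0 < eps / 2 by rewrite divr_gt0.
have [d d0 dS] := SC _ e20; have [N1 H1] := HJ _ e20.
have [N2 H2] := inv_small d d0; exists d => // E aE fE.
have [Dn fn] := HD (maxn N1 N2).
have := H1 _ (leq_maxl N1 N2).
have := dS _ _ aE Dn fE (finerW (H2 _ (leq_maxr N1 N2)) fn).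
set y := S (D _) => h1 h2; rewrite -(subrKA y) (le_lt_trans (ler_normD _ _))//.
by rewrite [ltRHS](splitr eps) ltrD.
Qed.

Lemma mesh_limit_le {F : normedModType R} (S : seq R -> F) a b J y r delta :
  a <= b -> mesh_limit S a b J -> 0 < delta ->
  (forall D, itv_partition a b D -> finer delta a D -> `|S D - y| <= r) ->
  `|J - y| <= r.
Proof.
move=> ab SJ d0 Sr; apply/ler_addgt0Pr => e e0; have [d' d'0 dS] := SJ e e0.
have [D aD fD] : exists2 D, itv_partition a b D & finer (Num.min delta d') a D.
  by apply: fine_partition => //; rewrite lt_min d0.
have h1 := Sr D aD (finerW _ fD); have h2 := dS D aD (finerW _ fD).
rewrite -(subrKA (S D)) addrC (le_trans (ler_normD _ _))// lerD//.
  by apply: h1; rewrite ge_min lexx.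
by rewrite distrC ltW// h2// ge_min lexx orbT.
Qed.

End MeshLimits.

(** * The flow generated by an almost multiplicative family *)

Section Flow.
Context {R : realType}.

(** The cube is the mass times the mass to the power $3/p - 1 > 0$, and this second factor is small
    on short intervals. Summed over a fine partition, cubes thus contribute arbitrarily little. *)
Lemma radius_cube_small (p u v : R) f : 0 < p < 3 -> additive_control u v f ->
  forall eps, 0 < eps -> exists2 delta, 0 < delta &
    forall s t, u <= s -> s <= t -> t <= v -> t - s < delta ->
      radius p f s t ^+ 3 <= eps * (f t - f s).
Proof.
move=> /andP[p0 p3] [mf cf] eps e0.
have q0 : 0 < 3 / p by rewrite divr_gt0.
have q1 : 0 < 3 / p - 1 by rewrite subr_gt0 ltr_pdivlMr ?mul1r.
have [|d d0 fd] := cf (eps `^ (3 / p - 1)^-1); first by rewrite powR_gt0.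
exists d => // s t us st tv td; rewrite radius_cube//.
have fst : 0 <= f t - f s by rewrite subr_ge0 mf.
rewrite -mulr_powRB1// mulrC ler_wpM2r//.
have -> : eps = (eps `^ (3 / p - 1)^-1) `^ (3 / p - 1).
  by rewrite -powRrM mulVf ?gt_eqF// powRr1// ltW.
apply: ge0_ler_powR; rewrite ?nnegrE ?powR_ge0 ?(ltW q1)//.
by rewrite ltW// fd.
Qed.

Lemma itv_partitionR_cut (b : R) D x y : itv_partition x b [seq z <- D | x < z] ->
  y \in D -> x < y -> exists2 D1, itv_partition x y D1 &
    [seq z <- D | x < z] = D1 ++ [seq z <- D | y < z] /\
    itv_partition y b [seq z <- D | y < z].
Proof.
move=> xD yD xy.
have [|D1 [D2 [DE l1 p1 p2 _]]] := itv_partition_split xD (c := y).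
  by rewrite mem_filter xy.
exists D1 => //; suff -> : [seq z <- D | y < z] = D2 by rewrite DE.
have -> : [seq z <- D | y < z] = [seq z <- [seq z <- D | x < z] | y < z].
  rewrite -filter_predI; apply: eq_filter => z /=.
  by case: (ltP y z) => // /(lt_trans xy) ->.
rewrite DE filter_cat (_ : [seq z <- D1 | y < z] = [::]) ?cat0s.
  apply/all_filterP/allP => z /(itv_partition_mem p2)/andP[] //.
apply/eqP; rewrite -(negbK (_ == _)) -has_filter; apply/hasPn => z.
by move=> /(itv_partition_mem p1)/andP[_]; rewrite leNgt.
Qed.

Context (F : normedModType R) (p c C K u v : R) (f : R -> R)
  (L : R -> R -> F -> F).
Context (Lm : almost_mult p c C u v f L).
Context (K0 : 0 <= K).
Context (LK : forall a b D z, u <= a -> b <= v -> itv_partition a b D ->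
  `|oprod L a D z| <= K * `|z| /\
  `|oprod L a D z - L a b z| <= K * radius p f a b ^+ 3 * `|z|).

(** The exact value is exchanged for a one-step map on one interval after the other. Each exchange
    costs a local error, transported by the product over the preceding intervals, whose norm is at
    most [K]. The errors are measured by a [g] that may differ from the control [f] of [L]. *)
Lemma oprod_telescope (zt : R -> F) (g : R -> R) E a b D : u <= a -> b <= v ->
  itv_partition a b D ->
  (forall x y, partition_piece a D x y -> `|zt x - L x y (zt y)| <= E * (g y - g x)) ->
  `|zt a - oprod L a D (zt b)| <= K * E * (g b - g a).
Proof.
(* The induction has to carry along the prefix [D0] of intervals already exchanged. *)
suff H a0 D0 : u <= a0 -> b <= v -> itv_partition a0 a D0 -> itv_partition a b D ->
    (forall x y, partition_piece a D x y ->
       `|zt x - L x y (zt y)| <= E * (g y - g x)) ->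
    `|oprod L a0 D0 (zt a) - oprod L a0 (D0 ++ D) (zt b)| <= K * E * (g b - g a).
  by move=> ua bv; apply: (H a [::]) => //; split=> //=.
elim: D a D0 => [|d D IH] a D0 ua0 bv aD0 aD HD.
  by rewrite (itv_partition_nil aD) cats0 !subrr normr0 mulr0.
have [ad db dD] := itv_partition_consE aD.
have dv : d <= v by exact: le_trans bv.
have D0d : itv_partition a0 d (D0 ++ [:: d]).
  by apply: itv_partition_cat aD0 _; exact: itv_partition1.
have HD' x y : partition_piece d D x y ->
    `|zt x - L x y (zt y)| <= E * (g y - g x).
  by move=> xy; apply: HD; apply/partition_piece_cons; right.
have := IH d (D0 ++ [:: d]) ua0 bv D0d dD HD'; rewrite -catA /= => IH'.
rewrite -(subrKA (oprod L a0 (D0 ++ [:: d]) (zt d))).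
rewrite (le_trans (ler_normD _ _))//.
have -> : K * E * (g b - g a) = K * (E * (g d - g a)) + K * E * (g b - g d) by ring.
rewrite lerD//.
have la : last a0 D0 = a by case: aD0 => _ /eqP.
rewrite oprod_cat /= la -(am_oprod_sub Lm _ _ ua0 (le_trans (ltW ad) dv) aD0).
have [h _] := LK (zt a - L a d (zt d)) ua0 (le_trans (ltW ad) dv) aD0.
rewrite (le_trans h)// ler_wpM2l// HD//.
by apply/partition_piece_cons; left.
Qed.

(** The products along the part of [D'] to the right of [x], as a function of [x], serve as the
    exact solution. Over a step of [D] such a product differs from the one-step map by the sewing
    error, and [oprod_telescope] adds these errors up. *)
Lemma oprod_refine eta a b D D' z : 0 <= eta -> u <= a -> b <= v ->
  itv_partition a b D -> itv_partition a b D' -> {subset D <= D'} ->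
  (forall x y, partition_piece a D x y ->
     radius p f x y ^+ 3 <= eta * (f y - f x)) ->
  `|oprod L a D' z - oprod L a D z| <= K * (K * K * `|z| * eta) * (f b - f a).
Proof.
move=> eta0 ua bv aD aD' DD' HD; have ab := itv_partition_le aD.
pose zt x := oprod L x [seq y <- D' | x < y] z.
have fa : [seq y <- D' | a < y] = D'.
  by apply/all_filterP/allP => y /(itv_partition_mem aD')/andP[].
have fb : [seq y <- D' | b < y] = [::].
  apply/eqP; rewrite -(negbK (_ == _)) -has_filter; apply/hasPn => y.
  by move=> /(itv_partition_mem aD')/andP[_]; rewrite leNgt.
have part x : x = a \/ x \in D -> itv_partition x b [seq y <- D' | x < y].
  move=> [->|xD]; first by rewrite fa.
  have /andP[ax _] := itv_partition_mem aD xD.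
  have [|D1 _ [_ //]] := @itv_partitionR_cut b D' a x _ (DD' _ xD) ax.
  by rewrite fa.
have ztb : zt b = z by rewrite /zt fb.
have zta : zt a = oprod L a D' z by rewrite /zt fa.
rewrite -zta -ztb; apply: oprod_telescope => //.
move=> x y xy; have [ax xy' yb] := partition_piece_itv aD xy.
have [xD yD] : (x = a \/ x \in D) /\ y \in D.
  elim: (D) a {aD aD' ab ua fa part zta ax HD} xy => [a /partition_piece_nil//|d E IH a].
  move=> /partition_piece_cons[[-> ->]|/IH[[->|xE] yE]].
  - by split; [left|rewrite inE eqxx].
  - by split; [right; rewrite inE eqxx|rewrite inE yE orbT].
  - by split; [right; rewrite inE xE orbT|rewrite inE yE orbT].
have [D1 pD1 [DE py]] := itv_partitionR_cut (part x xD) (DD' _ yD) xy'.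
have ux : u <= x by exact: le_trans ax.
have yv : y <= v by exact: le_trans bv.
have -> : zt x = oprod L x D1 (zt y).
  by rewrite /zt DE oprod_cat; case: pD1 => _ /eqP ->.
have [_ /le_trans] := LK (zt y) ux yv pD1; apply.
have zty : `|zt y| <= K * `|z|.
  by have [] := LK z (le_trans ux (ltW xy')) bv py.
have -> : K * K * `|zt b| * eta * (f y - f x) =
  K * (eta * (f y - f x)) * (K * `|zt b|) by ring.
by rewrite ler_pM ?mulr_ge0 ?exprn_ge0 ?radius_ge0// ?ztb// ler_wpM2l// HD.
Qed.

Context (p03 : 0 < p < 3).
Context (c0 : 0 <= c).
Context (fc : additive_control u v f).

(** Any two fine partitions are compared through their common refinement, which gives the Cauchy
    criterion. *)
Lemma oprod_limit a b z : seq_complete F -> u <= a -> a <= b -> b <= v ->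
  exists J, mesh_limit (fun D => oprod L a D z) a b J.
Proof.
move=> Fc ua ab bv; apply: mesh_limit_exists => // eps e0.
pose M := K * (K * K * `|z|) * (f b - f a).
have M0 : 0 <= M.
  by rewrite !mulr_ge0// subr_ge0; case: fc => mf _; exact: mf.
have M1 : 0 < 2 * M + 1 by rewrite ltr_wpDl// mulr_ge0.
have [|d d0 fd] := radius_cube_small p03 fc (eps := eps / (2 * M + 1)).
  by rewrite divr_gt0.
exists d => // D D' aD aD' fD fD'.
have small E : itv_partition a b E -> finer d a E -> forall x y,
    partition_piece a E x y -> radius p f x y ^+ 3 <= eps / (2 * M + 1) * (f y - f x).
  move=> aE fE x y xy; have [ax xy' yb] := partition_piece_itv aE xy.
  by apply: fd; rewrite ?(ltW xy') ?fE ?(le_trans ua)// (le_trans yb).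
have [E [aE DE D'E]] := common_refinement aD aD'.
have eta0 : 0 <= eps / (2 * M + 1) by rewrite divr_ge0 ?ltW.
have h1 := oprod_refine z eta0 ua bv aD aE DE (small D aD fD).
have h2 := oprod_refine z eta0 ua bv aD' aE D'E (small D' aD' fD').
rewrite -(subrKA (oprod L a E z)) (le_lt_trans (ler_normD _ _))// distrC.
rewrite (le_lt_trans (lerD h1 h2))//.
apply: (@le_lt_trans _ _ (2 * M * (eps / (2 * M + 1)))).
  by move: (eps / _) => q; rewrite /M; lra.
rewrite mulrA ltr_pdivrMr// mulrC ltr_pM2l//; lra.
Qed.

(** [zt s] is the limit of the products over [[s, v]]. Partitions of [[s, v]] that pass through [t]
    factor, and the sewing error on [[s, t]] survives the limit. *)
Lemma oprod_solution z : seq_complete F -> u <= v -> exists zt : R -> F,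
  [/\ zt v = z, forall s, u <= s -> s <= v -> `|zt s| <= K * `|z| &
    forall s t, u <= s -> s <= t -> t <= v ->
      `|zt s - L s t (zt t)| <= K * radius p f s t ^+ 3 * (K * `|z|)].
Proof.
move=> Fc uv.
have /choice[zt Hzt] : forall s, exists J, u <= s -> s <= v ->
    mesh_limit (fun D => oprod L s D z) s v J.
  move=> s; have [/andP[us sv]|n] := boolP (u <= s <= v); last first.
    by exists 0 => us sv; move: n; rewrite us sv.
  by have [J HJ] := oprod_limit z Fc us sv (lexx v); exists J.
have ztK s : u <= s -> s <= v -> `|zt s| <= K * `|z|.
  move=> us sv; rewrite -[zt s]subr0.
  apply: (mesh_limit_le sv (Hzt s us sv) ltr01) => D aD _.
  by rewrite subr0; have [] := LK z us (lexx v) aD.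
exists zt; split=> //.
  apply/eqP; rewrite -subr_eq0 -normr_le0.
  apply: (mesh_limit_le (lexx v) (Hzt v uv (lexx v)) ltr01) => D aD _.
  by rewrite (itv_partitionxx aD) subrr normr0.
move=> s t us st tv; have ut := le_trans us st; have sv := le_trans st tv.
set r3 := K * _ * _.
have rb : 0 <= 1 + c * radius p f s t.
  by rewrite addr_ge0// mulr_ge0 ?radius_ge0.
apply/ler_addgt0Pr => e e0.
pose e' := e / (1 + c * radius p f s t + 1).
have e'0 : 0 < e' by rewrite divr_gt0// ltr_wpDl.
have [d1 d10 H1] := Hzt t ut tv e' e'0.
have [d2 d20 H2] := Hzt s us sv e' e'0.
have [D1 sD1 fD1] := fine_partition st d20.
have [D3 tD3 fD3] : exists2 D, itv_partition t v D & finer (Num.min d1 d2) t D.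
  by apply: fine_partition => //; rewrite lt_min d10.
have h3 : `|oprod L t D3 z - zt t| < e'.
  by apply: H1 => //; apply: finerW fD3; rewrite ge_min lexx.
have h4 : `|oprod L s (D1 ++ D3) z - zt s| < e'.
  apply: H2; first exact: itv_partition_cat tD3.
  apply: finer_cat => //; have -> : last s D1 = t by case: sD1 => _ /eqP.
  by apply: finerW fD3; rewrite ge_min lexx orbT.
rewrite oprod_cat (_ : last s D1 = t) in h4; last by case: sD1 => _ /eqP.
have -> : zt s - L s t (zt t) = (zt s - oprod L s D1 (oprod L t D3 z)) +
    ((oprod L s D1 (oprod L t D3 z) - L s t (oprod L t D3 z)) +
     (L s t (oprod L t D3 z) - L s t (zt t))) by rewrite !subrKA.
rewrite (le_trans (ler_normD _ _))//.
have [_ h5] := LK (oprod L t D3 z) us tv sD1.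
have [h6 _] := LK z ut (lexx v) tD3.
have h7 : `|L s t (oprod L t D3 z) - L s t (zt t)| <=
    (1 + c * radius p f s t) * e'.
  rewrite -(am_sub Lm)// (le_trans (am_bound Lm _ us st tv))//.
  by rewrite ler_wpM2l// ltW.
have h8 : K * radius p f s t ^+ 3 * `|oprod L t D3 z| <= r3.
  by rewrite /r3 ler_wpM2l// mulr_ge0 ?exprn_ge0 ?radius_ge0.
rewrite distrC in h4.
rewrite (le_trans (lerD (ltW h4) (le_trans (ler_normD _ _)
  (lerD (le_trans h5 h8) h7))))//.
rewrite addrCA lerD2l -[leLHS]addrC -[X in _ + X]mul1r -mulrDl.
by rewrite /e' mulrC divfK ?gt_eqF// ltr_wpDl.
Qed.

(** By [oprod_telescope] such a path is arbitrarily close to products along fine partitions, so it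
    inherits their bounds: [g] and [C'] are replaced by [f] and [K]. A zero value at the right end
    then forces the path to vanish. *)
Lemma oprod_apriori (zt : R -> F) g C' : 0 <= C' -> additive_control u v g ->
  (forall s t, u <= s -> s <= t -> t <= v ->
     `|zt s - L s t (zt t)| <= C' * radius p g s t ^+ 3) ->
  forall s t, u <= s -> s <= t -> t <= v ->
    `|zt s| <= K * `|zt t| /\
    `|zt s - L s t (zt t)| <= K * radius p f s t ^+ 3 * `|zt t|.
Proof.
move=> C'0 gc ztL s t us st tv.
have [mg _] := gc; have g0 : 0 <= g t - g s by rewrite subr_ge0 mg.
have near_oprod e : 0 < e -> exists2 D, itv_partition s t D &
    `|zt s - oprod L s D (zt t)| <= e.
  move=> e0; pose M := K * C' * (g t - g s).
  have M0 : 0 <= M by rewrite !mulr_ge0.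
  have e1 : 0 < e / (M + 1) by rewrite divr_gt0// ltr_wpDl.
  have [d d0 gd] := radius_cube_small p03 gc e1.
  have [D sD fD] := fine_partition st d0; exists D => //.
  have HD x y : partition_piece s D x y ->
      `|zt x - L x y (zt y)| <= C' * (e / (M + 1)) * (g y - g x).
    move=> xy; have [sx xy' yt] := partition_piece_itv sD xy.
    have ux : u <= x by exact: le_trans sx.
    have yv : y <= v by exact: le_trans tv.
    rewrite (le_trans (ztL _ _ ux (ltW xy') yv))// -mulrA ler_wpM2l//.
    by apply: gd => //; [exact: ltW|exact: fD].
  rewrite (le_trans (oprod_telescope us tv sD HD))//.
  apply: (@le_trans _ _ (M * (e / (M + 1)))).
    by move: (e / _) => q; rewrite /M; lra.
  by rewrite mulrA ler_pdivrMr ?ltr_wpDl// mulrC ler_wpM2l ?(ltW e0)// lerDl.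
split; apply/ler_addgt0Pr => e e0; have [D sD he] := near_oprod e e0.
  rewrite -[zt s](subrK (oprod L s D (zt t))) (le_trans (ler_normD _ _))// addrC.
  by rewrite lerD//; have [] := LK (zt t) us tv sD.
rewrite -(subrKA (oprod L s D (zt t))) (le_trans (ler_normD _ _))// addrC.
by rewrite lerD//; have [] := LK (zt t) us tv sD.
Qed.

End Flow.

(** * Linear equations with a terminal condition *)

Section LinearFlow.
Context {R : realType}.

(** The germ comes in forward form, evaluated at the left end point, whereas the data are prescribed
    on the right; [backward] bridges the two. *)
Record rough_generator {F : normedModType R} (p c C u v : R) (f : R -> R)
    (W : R -> R -> F -> F) : Prop := RoughGenerator {
  rg_sub : forall s t a b, u <= s -> s <= t -> t <= v ->
    W s t (a - b) = W s t a - W s t b;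
  rg_id : forall s z, u <= s -> s <= v -> W s s z = 0;
  rg_bound : forall s t z, u <= s -> s <= t -> t <= v ->
    `|W s t z| <= c * radius p f s t * `|z|;
  rg_defect : forall s m t z, u <= s -> s <= m -> m <= t -> t <= v ->
    `|W m t (z + W s m z) + W s m z - W s t z| <= C * radius p f s t ^+ 3 * `|z|
}.

(* [1 - W + W ^ 2] inverts [1 + W] up to [W ^ 3], on either side. *)
Definition backward {F : normedModType R} (W : R -> R -> F -> F) s t z :=
  z - W s t z + W s t (W s t z).

Section Generator.
Context {F : normedModType R} (p c C Om u v : R) (f : R -> R)
  (W : R -> R -> F -> F).
Context (p0 : 0 < p) (c0 : 0 <= c) (C0 : 0 <= C) (fc : additive_control u v f)
  (fOm : f v - f u <= Om) (Wg : rough_generator p c C u v f W).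
Let R0 := `|Om| `^ p^-1.
Let n := 1 + c * R0.
Let b := 1 + (c + c * c * R0) * R0.

Lemma rg_add s t x y : u <= s -> s <= t -> t <= v ->
  W s t (x + y) = W s t x + W s t y.
Proof.
move=> us st tv; have W0 : W s t 0 = 0.
  by have := rg_sub Wg 0 0 us st tv; rewrite subr0 subrr.
have WN z : W s t (- z) = - W s t z by rewrite -(sub0r z) (rg_sub Wg)// W0 sub0r.
by rewrite -{1}(opprK y) (rg_sub Wg)// WN opprK.
Qed.

Lemma radius_le_total s t : u <= s -> s <= t -> t <= v -> radius p f s t <= R0.
Proof.
move=> us st tv; have [mf _] := fc.
apply: ge0_ler_powR; rewrite ?nnegrE ?invr_ge0 ?(ltW p0) ?subr_ge0 ?mf//.
apply: le_trans (ler_norm Om); apply: le_trans fOm; apply: lerB; apply: mf => //.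
  exact: le_trans st.
exact: le_trans tv.
Qed.

Lemma radius_le_sub s t s' t' : u <= s -> s <= s' -> s' <= t' -> t' <= t -> t <= v ->
  radius p f s' t' <= radius p f s t.
Proof.
move=> us ss st tt tv; have [mf _] := fc; apply: le_radius => //.
  by rewrite subr_ge0 mf//; [exact: le_trans ss|exact: le_trans tv].
apply: lerB; apply: mf => //; [exact: le_trans us (le_trans ss st)|].
exact: le_trans st (le_trans tt tv).
Qed.

Let R00 : 0 <= R0. Proof. exact: powR_ge0. Qed.
Let n0 : 0 <= n. Proof. by rewrite addr_ge0// mulr_ge0. Qed.
Let b0 : 0 <= b. Proof. by rewrite addr_ge0// mulr_ge0// addr_ge0// !mulr_ge0. Qed.

Let Wb s t z : u <= s -> s <= t -> t <= v -> `|W s t z| <= c * R0 * `|z|.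
Proof.
move=> us st tv; rewrite (le_trans (rg_bound Wg z us st tv))// ler_wpM2r//.
by rewrite ler_wpM2l// radius_le_total.
Qed.

Lemma generator_cube_le s t z : u <= s -> s <= t -> t <= v ->
  `|W s t (W s t (W s t z))| <= c ^+ 3 * radius p f s t ^+ 3 * `|z|.
Proof.
move=> us st tv; have cr : 0 <= c * radius p f s t by rewrite mulr_ge0 ?radius_ge0.
rewrite (le_trans (rg_bound Wg _ us st tv))//.
rewrite (le_trans (ler_wpM2l cr (rg_bound Wg _ us st tv)))//.
rewrite (le_trans (ler_wpM2l cr (ler_wpM2l cr (rg_bound Wg _ us st tv))))//.
by rewrite -exprMn !exprS expr0 mulr1 !mulrA.
Qed.

Let bwd_le s t z : u <= s -> s <= t -> t <= v ->
  `|backward W s t z| <= (1 + (c + c * c * R0) * radius p f s t) * `|z|.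
Proof.
move=> us st tv; rewrite /backward (le_trans (ler_normD _ _))//.
have h1 := rg_bound Wg z us st tv.
have h2 : `|W s t (W s t z)| <= c * R0 * (c * radius p f s t * `|z|).
  by rewrite (le_trans (Wb _ us st tv))// ler_wpM2l// mulr_ge0.
rewrite (le_trans (lerD (ler_normB _ _) (lexx _)))//.
rewrite (le_trans (lerD (lerD (lexx _) h1) h2))//; lra.
Qed.

Lemma backward_bound s t z : u <= s -> s <= t -> t <= v -> `|backward W s t z| <= b * `|z|.
Proof.
move=> us st tv; rewrite (le_trans (bwd_le z us st tv))// ler_wpM2r//.
by rewrite lerD2l ler_wpM2l ?radius_le_total// addr_ge0// !mulr_ge0.
Qed.

Lemma forward_bound s t z : u <= s -> s <= t -> t <= v -> `|z + W s t z| <= n * `|z|.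
Proof.
move=> us st tv; rewrite (le_trans (ler_normD _ _))// mulrDl mul1r lerD2l.
exact: Wb.
Qed.

Lemma backward_sub s t x y : u <= s -> s <= t -> t <= v ->
  backward W s t (x - y) = backward W s t x - backward W s t y.
Proof.
move=> us st tv; rewrite /backward !(rg_sub Wg)//.
rewrite [in RHS]opprD [RHS]addrACA; congr (_ + _).
by rewrite !opprD !opprK [RHS]addrACA.
Qed.

Lemma backward_add s t x y : u <= s -> s <= t -> t <= v ->
  backward W s t (x + y) = backward W s t x + backward W s t y.
Proof.
move=> us st tv; rewrite /backward !rg_add// [RHS]addrACA; congr (_ + _).
by rewrite opprD addrACA.
Qed.

Lemma backwardK s t z : u <= s -> s <= t -> t <= v ->
  backward W s t z + W s t (backward W s t z) = z + W s t (W s t (W s t z)).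
Proof.
move=> us st tv; rewrite /backward rg_add// (rg_sub Wg)//.
set w1 := W s t z; set w2 := W s t w1; set w3 := W s t w2.
by rewrite -addrA (addrA w2) [w2 + _]addrC subrK subrKA.
Qed.

Lemma backwardVK s t z : u <= s -> s <= t -> t <= v ->
  backward W s t (z + W s t z) = z + W s t (W s t (W s t z)).
Proof.
move=> us st tv; rewrite /backward !rg_add//.
set w1 := W s t z; set w2 := W s t w1; set w3 := W s t w2.
by rewrite opprD [z + _ + _]addrA addrK addrA subrK.
Qed.

(** The backward defect is read off from the forward one. Let [e] be the result of two backward
    steps. The forward maps undo these steps up to cubes, and [rg_defect] merges them into one, so
    [e + W s t e] is [z] plus a cubic [a4]. Applying [backward W s t] compares [e] with
    [backward W s t z]. *)
Lemma backward_almost_mult : almost_mult p (c + c * c * R0)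
  (b * (c ^+ 3 + n * c ^+ 3 * b + C * b ^+ 2) + c ^+ 3 * b ^+ 2)
  u v f (backward W).
Proof.
have c3 : 0 <= c ^+ 3 by rewrite exprn_ge0.
split.
- by case: fc.
- by move=> s t y z us st tv; exact: backward_sub.
- move=> s z us sv; rewrite /backward (rg_id Wg)// subr0.
  by rewrite (rg_id Wg)// addr0.
- by move=> s t z us st tv; exact: bwd_le.
move=> s m t z us sm mt tv.
have um := le_trans us sm; have st := le_trans sm mt; have mv := le_trans mt tv.
set r := radius p f s t; have r0 : 0 <= r by exact: radius_ge0.
have r3 : 0 <= r ^+ 3 by rewrite exprn_ge0.
have rsm : radius p f s m ^+ 3 <= r ^+ 3.
  by rewrite lerXn2r ?nnegrE ?radius_ge0//; exact: radius_le_sub.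
have rmt : radius p f m t ^+ 3 <= r ^+ 3.
  by rewrite lerXn2r ?nnegrE ?radius_ge0//; exact: radius_le_sub.
have W3le s' t' y : u <= s' -> s' <= t' -> t' <= v -> radius p f s' t' ^+ 3 <= r ^+ 3 ->
    `|W s' t' (W s' t' (W s' t' y))| <= c ^+ 3 * r ^+ 3 * `|y|.
  move=> us' st' tv' rr; rewrite (le_trans (generator_cube_le y us' st' tv'))// ler_wpM2r//.
  by rewrite ler_wpM2l.
set y := backward W m t z; set e := backward W s m y.
have yz : `|y| <= b * `|z| by exact: backward_bound.
have ez : `|e| <= b ^+ 2 * `|z|.
  by rewrite (le_trans (backward_bound _ us sm mv))// expr2 -mulrA ler_wpM2l.
pose a1 := W m t (W m t (W m t z)).
pose a2 := W s m (W s m (W s m y)).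
have Ne : e + W s m e = y + a2 by exact: backwardK.
have Ny : y + W m t y = z + a1 by exact: backwardK.
pose a3 := W m t (e + W s m e) + W s m e - W s t e.
pose a4 := a1 + (a2 + W m t a2) - a3.
have NN : e + W s t e = z + a4.
  have -> : e + W s t e = e + W s m e + W m t (e + W s m e) - a3.
    rewrite /a3; set w := W m t (e + W s m e); set x := W s m e.
    by rewrite opprB (addrC w) -[e + x + w]addrA addrACA subrr addr0.
  by rewrite Ne rg_add// addrACA Ny /a4 !addrA.
have -> : e - backward W s t z =
    backward W s t a4 - W s t (W s t (W s t e)).
  have := backwardVK e us st tv; rewrite NN backward_add// => /eqP.
  rewrite -subr_eq => /eqP h; rewrite -[in LHS]h addrAC.
  by rewrite [_ + backward _ _ _ a4]addrC addrK.
have a1b : `|a1| <= c ^+ 3 * r ^+ 3 * `|z| by exact: W3le.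
have a2b : `|a2| <= c ^+ 3 * r ^+ 3 * (b * `|z|).
  by rewrite (le_trans (W3le _ _ _ us sm mv rsm))// ler_wpM2l// mulr_ge0.
have a2b' : `|a2 + W m t a2| <= n * (c ^+ 3 * r ^+ 3 * (b * `|z|)).
  by rewrite (le_trans (forward_bound _ um mt tv))// ler_wpM2l.
have a3b : `|a3| <= C * r ^+ 3 * (b ^+ 2 * `|z|).
  by rewrite (le_trans (rg_defect Wg e us sm mt tv))// ler_wpM2l// mulr_ge0.
have a4b : `|a4| <= (c ^+ 3 + n * c ^+ 3 * b + C * b ^+ 2) * (r ^+ 3 * `|z|).
  rewrite (le_trans (ler_normB _ _))//.
  rewrite (le_trans (lerD (le_trans (ler_normD _ _) (lerD a1b a2b')) a3b))//.
  by apply: ler_eq; ring.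
have eb : `|W s t (W s t (W s t e))| <= c ^+ 3 * r ^+ 3 * (b ^+ 2 * `|z|).
  by rewrite (le_trans (W3le _ _ _ us st tv (lexx _)))// ler_wpM2l// mulr_ge0.
rewrite (le_trans (ler_normB _ _))//.
rewrite (le_trans (lerD (le_trans (backward_bound _ us st tv) (ler_wpM2l b0 a4b)) eb))//.
by apply: ler_eq; ring.
Qed.

End Generator.

(** Since [backward] inverts the forward map up to cubes on both sides, a cubic bound on the
    backward error and one on the forward error imply each other. Existence and the a priori bound
    are then those of the backward products. *)
Lemma linear_flow (p c C Om : R) : 0 < p < 3 -> 0 <= c -> 0 <= C ->
  exists2 K, 0 <= K &
  forall (F : normedModType R) (u v : R) f (W : R -> R -> F -> F),
    additive_control u v f -> u <= v -> f v - f u <= Om ->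
    rough_generator p c C u v f W ->
    (seq_complete F -> forall z, exists zt : R -> F, [/\ zt v = z,
       forall s, u <= s -> s <= v -> `|zt s| <= K * `|z| &
       forall s t, u <= s -> s <= t -> t <= v ->
       `|zt t - zt s - W s t (zt s)| <= K * radius p f s t ^+ 3 * `|z|]) /\
    (forall (zt : R -> F) g C' M, 0 <= C' -> additive_control u v g ->
       (forall s, u <= s -> s <= v -> `|zt s| <= M) ->
       (forall s t, u <= s -> s <= t -> t <= v ->
          `|zt t - zt s - W s t (zt s)| <= C' * radius p g s t ^+ 3) ->
       forall s t, u <= s -> s <= t -> t <= v -> `|zt s| <= K * `|zt v| /\
         `|zt t - zt s - W s t (zt s)| <= K * radius p f s t ^+ 3 * `|zt v|).
Proof.
move=> p03 c0 C0; have p0 : 0 < p by case/andP: p03.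
pose R0 := `|Om| `^ p^-1; have R00 : 0 <= R0 by exact: powR_ge0.
pose n := 1 + c * R0; have n0 : 0 <= n by rewrite addr_ge0// mulr_ge0.
pose b := 1 + (c + c * c * R0) * R0.
have b0 : 0 <= b by rewrite addr_ge0// mulr_ge0// addr_ge0// !mulr_ge0.
have c3 : 0 <= c ^+ 3 by rewrite exprn_ge0.
have c'0 : 0 <= c + c * c * R0 by rewrite addr_ge0// !mulr_ge0.
pose C' := b * (c ^+ 3 + n * c ^+ 3 * b + C * b ^+ 2) + c ^+ 3 * b ^+ 2.
have C'0 : 0 <= C' by rewrite !(addr_ge0, mulr_ge0, exprn_ge0).
have [K K0 HK] := sewing Om p03 c'0 C'0.
exists (K + c ^+ 3 * K + n * (K * K)); first by rewrite !addr_ge0 ?mulr_ge0.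
move=> F u v f W fc uv fOm Wg.
have Lm : almost_mult p (c + c * c * R0) C' u v f (backward W).
  exact: (backward_almost_mult p0 c0 C0 fc fOm Wg).
have LK a e D z : u <= a -> e <= v -> itv_partition a e D ->
    `|oprod (backward W) a D z| <= K * `|z| /\
    `|oprod (backward W) a D z - backward W a e z|
      <= K * radius p f a e ^+ 3 * `|z|.
  move=> ua ev aD; apply: (HK F u v f _ Lm a e D z ua ev aD).
  have [mf _] := fc; have ae := itv_partition_le aD.
  apply: le_trans fOm; apply: lerB; apply: mf => //; first exact: le_trans ae.
  exact: le_trans ev.
have bwd_fwd (zt : R -> F) s t X : u <= s -> s <= t -> t <= v ->
    `|zt s - backward W s t (zt t)| <= K * radius p f s t ^+ 3 * (K * X) ->
    `|zt t| <= K * X -> 0 <= X ->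
    `|zt t - zt s - W s t (zt s)| <= (K + c ^+ 3 * K + n * (K * K)) *
       radius p f s t ^+ 3 * X.
  move=> us st tv; set y := backward W s t (zt t) => h1 h2 X_ge0.
  have r3 : 0 <= radius p f s t ^+ 3 by rewrite exprn_ge0 ?radius_ge0.
  have [d dE] : exists d, zt s = y + d by exists (zt s - y); rewrite addrC subrK.
  have dy : zt s - y = d by rewrite dE addrC addKr.
  have -> : zt t - zt s - W s t (zt s) =
      - W s t (W s t (W s t (zt t))) - (d + W s t d).
    rewrite dE (rg_add Wg)// -addrA -opprD addrACA (backwardK Wg)//.
    by rewrite [in LHS]opprD addrA; congr (_ - _); rewrite opprD addrA subrr add0r.
  rewrite (le_trans (ler_normB _ _))// normrN.
  rewrite dy in h1.
  have h3 := generator_cube_le c0 Wg (zt t) us st tv.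
  have h4 := forward_bound p0 c0 fc fOm Wg d us st tv.
  have h5 : `|W s t (W s t (W s t (zt t)))| <= c ^+ 3 * radius p f s t ^+ 3 * (K * X).
    by rewrite (le_trans h3)// ler_wpM2l// mulr_ge0.
  have h6 : `|d + W s t d| <= n * (K * radius p f s t ^+ 3 * (K * X)).
    by rewrite (le_trans h4)// ler_wpM2l.
  have X0 : 0 <= K * radius p f s t ^+ 3 * X.
    by rewrite mulr_ge0 ?(mulr_ge0 K0).
  rewrite (le_trans (lerD h5 h6))//; lra.
split=> [Fc z|zt g C1 M C10 gc ztM ztW].
  have [zt [ztv ztK ztL]] := oprod_solution Lm K0 LK p03 c'0 fc z Fc uv.
  exists zt; split=> // [s us sv|s t us st tv].
    apply: le_trans (ztK s us sv) _; rewrite ler_wpM2r// -addrA lerDl.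
    by rewrite addr_ge0 ?mulr_ge0.
  apply: bwd_fwd => //; first exact: ztL.
  exact: ztK (le_trans us st) tv.
have M0 : 0 <= M by exact: le_trans (normr_ge0 _) (ztM u (lexx u) uv).
(* The bound [M] of the path only enters this provisional constant, which [oprod_apriori] replaces
   by [K]. *)
pose C2 := c ^+ 3 * M + b * C1.
have C20 : 0 <= C2 by rewrite addr_ge0 ?mulr_ge0.
have ztL s t : u <= s -> s <= t -> t <= v ->
    `|zt s - backward W s t (zt t)| <= C2 * radius p (fun x => f x + g x) s t ^+ 3.
  move=> us st tv; set e := zt t - zt s - W s t (zt s).
  have [mf _] := fc; have [mg _] := gc.
  have fst := mf _ _ us st tv; have gst := mg _ _ us st tv.
  have -> : zt s - backward W s t (zt t) =
      - (W s t (W s t (W s t (zt s))) + backward W s t e).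
    have -> : zt t = zt s + W s t (zt s) + e.
      by rewrite /e -[zt t - zt s - _]addrA -opprD [RHS]addrC subrK.
    rewrite (backward_add Wg)// (backwardVK Wg)// -/e.
    by rewrite !opprD !addrA subrr add0r.
  rewrite normrN (le_trans (ler_normD _ _))// mulrDl lerD//.
    rewrite (le_trans (generator_cube_le c0 Wg _ us st tv))//.
    rewrite -[leLHS]mulrA -[leRHS]mulrA ler_wpM2l// [leLHS]mulrC.
    apply: ler_pM; rewrite ?exprn_ge0 ?radius_ge0//.
      by apply: ztM => //; exact: le_trans st tv.
    rewrite lerXn2r ?nnegrE ?radius_ge0//; apply: le_radius => //; lra.
  rewrite (le_trans (backward_bound p0 c0 fc fOm Wg _ us st tv))//.
  rewrite -[leRHS]mulrA ler_wpM2l// (le_trans (ztW _ _ us st tv))// ler_wpM2l//.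
  rewrite lerXn2r ?nnegrE ?radius_ge0//; apply: le_radius => //; lra.
have ap := oprod_apriori Lm K0 LK p03 C20 (additive_controlD fc gc) ztL.
move=> s t us st tv; have sv := le_trans st tv; have ut := le_trans us st.
have K1 : 0 <= c ^+ 3 * K + n * (K * K) by rewrite addr_ge0 ?mulr_ge0.
split.
  have [h _] := ap s v us sv (lexx v).
  by rewrite (le_trans h)// ler_wpM2r// -addrA lerDl.
have [h1 _] := ap t v ut tv (lexx v); have [_ h2] := ap s t us st tv.
apply: bwd_fwd => //; rewrite (le_trans h2)// ler_wpM2l//.
by rewrite mulr_ge0 ?exprn_ge0 ?radius_ge0.
Qed.

End LinearFlow.

(** * Additive sewing *)

Section AdditiveSewing.
Context {R : realType}.

Lemma complete_seq_complete (F : completeNormedModType R) : seq_complete F.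
Proof.
move=> y yC.
have /cauchy_cvg/cvg_ex[l yl] : cauchy (y @ \oo).
  apply/cauchy_ballP => e e0; have [N HN] := yC e e0.
  near_simpl; near=> m n.
  by rewrite -ball_normE /=; apply: HN; [near: m|near: n]; exact: nbhs_infty_ge.
exists l => e e0; move/cvgrPdistC_lt : yl => /(_ _ e0)[N _ HN].
by exists N => n Nn; exact: HN.
Unshelve. all: by end_near. Qed.

Lemma pair_seq_complete (E : normedModType R) : seq_complete E ->
  seq_complete (E * R^o)%type.
Proof.
move=> Ec y yC.
have [l1 H1] : exists l, forall eps : R, 0 < eps -> exists N, forall n, (N <= n)%N ->
    `|(y n).1 - l| < eps.
  apply: Ec => e /yC[N HN]; exists N => m n Nm Nn; apply: le_lt_trans (HN _ _ Nm Nn).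
  by rewrite [leRHS]prod_normE le_max lexx.
have [l2 H2] : exists l, forall eps : R, 0 < eps -> exists N, forall n, (N <= n)%N ->
    `|(y n).2 - l| < eps.
  apply: (@complete_seq_complete R^o) => e /yC[N HN]; exists N => m n Nm Nn.
  by apply: le_lt_trans (HN _ _ Nm Nn); rewrite [leRHS]prod_normE le_max lexx orbT.
exists (l1, l2) => e e0; have [N1 h1] := H1 e e0; have [N2 h2] := H2 e e0.
exists (maxn N1 N2) => n; rewrite geq_max => /andP[n1 n2].
by rewrite prod_normE gt_max h1 ?h2.
Qed.

(** The unipotent case of the multiplicative statement: the maps that add [z.2 *: G s t] to the
    first coordinate and keep the second one have the Riemann sums of [G] as their products, and
    their defect is that of [G]. *)
Lemma additive_sewing (p c C Om : R) : 0 < p < 3 -> 0 <= c -> 0 <= C ->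
  exists2 K, 0 <= K &
  forall (E : normedModType R) (u v : R) f (G : R -> R -> E),
    additive_control u v f -> f v - f u <= Om ->
    (forall s, u <= s -> s <= v -> G s s = 0) ->
    (forall s t, u <= s -> s <= t -> t <= v -> `|G s t| <= c * radius p f s t) ->
    (forall s m t, u <= s -> s <= m -> m <= t -> t <= v ->
      `|G s m + G m t - G s t| <= C * radius p f s t ^+ 3) ->
    (forall a b D, u <= a -> b <= v -> itv_partition a b D ->
      `|riemann_sum G a b D - G a b| <= K * radius p f a b ^+ 3) /\
    (seq_complete E -> forall a b, u <= a -> a <= b -> b <= v ->
      exists J, riemann_limit G a b J).
Proof.
move=> p03 c0 C0; have p0 : 0 < p by case/andP: p03.
have [K K0 HK] := sewing Om p03 c0 C0.
exists K => // E u v f G fc fOm G0 Gc Gd; have [mf _] := fc.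
pose L s t (z : E * R^o) : (E * R^o)%type := (z.1 + z.2 *: G s t, z.2).
have nE (z : E * R^o) : `|z| = Num.max `|z.1| `|z.2| by exact: prod_normE.
have n1 (z : E * R^o) : `|z.1| <= `|z| by rewrite nE le_max lexx.
have n2 (z : E * R^o) : `|z.2| <= `|z| by rewrite nE le_max lexx orbT.
have Lm : almost_mult p c C u v f L.
  split=> //.
  - move=> s t y z us st tv; rewrite /L; congr (_, _) => /=.
    by rewrite scalerBl opprD addrACA.
  - by move=> s [z1 z2] us sv; rewrite /L G0//= scaler0 addr0.
  - move=> s t z us st tv; rewrite [leLHS]nE /= ge_max; apply/andP; split; last first.
      rewrite (le_trans (n2 z))// -[leLHS]mul1r ler_wpM2r// lerDl.
      by rewrite mulr_ge0 ?radius_ge0.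
    rewrite (le_trans (ler_normD _ _))// mulrDl mul1r lerD// normrZ mulrC.
    by apply: ler_pM => //; exact: Gc.
  - move=> s m t z us sm mt tv; rewrite [leLHS]nE /= ge_max subrr normr0.
    apply/andP; split; last by rewrite !mulr_ge0 ?exprn_ge0 ?radius_ge0.
    rewrite -[_ + _ + z.2 *: G s m]addrA -scalerDr opprD addrACA subrr add0r -scalerBr normrZ mulrC.
    by apply: ler_pM => //; rewrite [G m t + _]addrC; exact: Gd.
have LE a b D (z : E * R^o) : oprod L a D z = (z.1 + z.2 *: riemann_sum G a b D, z.2).
  elim: D a => [|d D IH] a /=; first by rewrite riemann_sum_nil scaler0 addr0; case: z.
  by rewrite IH riemann_sum_cons /L/= scalerDr -addrA [_ *: G a d + _]addrC.
have LK a b D z : u <= a -> b <= v -> itv_partition a b D ->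
    `|oprod L a D z| <= K * `|z| /\
    `|oprod L a D z - L a b z| <= K * radius p f a b ^+ 3 * `|z|.
  move=> ua bv aD; apply: (HK _ u v f _ Lm a b D z ua bv aD).
  have ab := itv_partition_le aD.
  apply: le_trans fOm; apply: lerB; apply: mf => //; first exact: le_trans ab.
  exact: le_trans bv.
have e1 : `|(0 : E, 1 : R^o)| = 1 :> R.
  by rewrite nE/= normr0 normr1; apply/max_idPr.
split=> [a b D ua bv aD|Ec a b ua ab bv].
  have [_] := LK a b D (0, 1) ua bv aD; rewrite e1 mulr1; apply: le_trans.
  by rewrite (LE a b)/= /L/=; apply: le_trans (n1 _); rewrite /= !add0r !scale1r.
have [J HJ] := oprod_limit Lm K0 LK p03 fc (0, 1) (pair_seq_complete Ec) ua ab bv.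
exists J.1 => e /HJ[d d0 dJ]; exists d => // D aD fD.
apply: le_lt_trans (dJ D aD fD); apply: le_trans (n1 _).
by rewrite (LE a b)/= add0r scale1r.
Qed.

End AdditiveSewing.

(** * Continuity and compactness tools *)

Section Variation.
Context {R : realType}.

Lemma within_continuousP {T : pseudoMetricType R} {F : normedModType R}
    (A : set T) (f : T -> F) : {within A, continuous f} <->
  (forall x, A x -> forall eps, 0 < eps -> exists2 delta, 0 < delta &
     forall y, A y -> ball x delta y -> `|f y - f x| < eps).
Proof.
split=> [/subspace_continuousP cf x Ax eps e0|H].
  have /cvgrPdistC_lt/(_ _ e0) := cf x Ax.
  rewrite near_withinE => /nbhs_ballP[d /= d0 dA].
  by exists d => // y Ay xy; exact: dA.
apply/subspace_continuousP => x Ax; apply/cvgrPdistC_lt => eps e0.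
have [d d0 dA] := H x Ax eps e0; rewrite near_withinE; apply/nbhs_ballP.
by exists d => // y xy Ay; exact: dA.
Qed.

(** Monotonicity of the power and of its inverse gives the neighbourhood, including at [a = 0]; when
    [a ^ r < eps], the lower inequality is automatic. *)
Lemma powR_continuous_ge0 (r a : R) : 0 < r -> 0 <= a -> forall eps, 0 < eps ->
  exists2 delta, 0 < delta &
    forall b, 0 <= b -> `|b - a| < delta -> `|b `^ r - a `^ r| < eps.
Proof.
move=> r0 a0 eps e0.
have rK x : 0 <= x -> (x `^ r^-1) `^ r = x.
  by move=> x0; rewrite -powRrM mulVf ?gt_eqF// powRr1.
have lt_powR x y : 0 <= x -> x < y -> x `^ r < y `^ r.
  by move=> x0 xy; apply: gt0_ltr_powR; rewrite ?nnegrE// (le_trans x0)// ltW.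
have lt_root x y : 0 <= x -> x < y -> x `^ r^-1 < y `^ r^-1.
  by move=> x0 xy; apply: gt0_ltr_powR; rewrite ?nnegrE ?invr_gt0// (le_trans x0)// ltW.
have aK : (a `^ r) `^ r^-1 = a by rewrite -powRrM mulfV ?gt_eqF// powRr1.
have ar0 : 0 <= a `^ r by exact: powR_ge0.
pose U := (a `^ r + eps) `^ r^-1.
have aU : a < U by rewrite -{1}aK; apply: lt_root => //; rewrite ltrDl.
have upper b : 0 <= b -> b < U -> b `^ r < a `^ r + eps.
  by move=> b0 /(lt_powR _ _ b0); rewrite rK// addr_ge0// ltW.
have [ae|ae] := ltP (a `^ r) eps.
  exists (U - a); first by rewrite subr_gt0.
  move=> b b0 ba; rewrite ltr_norml; apply/andP; split.
    by rewrite ltrBrDl (lt_le_trans _ (powR_ge0 _ _))//; lra.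
  rewrite ltrBlDl upper//; move: ba; rewrite ltr_norml => /andP[_]; lra.
pose L := (a `^ r - eps) `^ r^-1.
have La : L < a.
  rewrite -[ltRHS]aK; apply: lt_root; [by rewrite subr_ge0|lra].
exists (Num.min (U - a) (a - L)); first by rewrite lt_min !subr_gt0 aU.
move=> b b0; rewrite lt_min !ltr_norml => /andP[/andP[_ h1] /andP[h2 _]].
apply/andP; split; last by rewrite ltrBlDl upper//; lra.
rewrite ltrBrDl; have : L `^ r < b `^ r by apply: lt_powR; [exact: powR_ge0|lra].
by rewrite rK ?subr_ge0//; lra.
Qed.

(** A Lebesgue number argument: near each point one threshold serves all neighbours and all smaller
    [delta], and compactness extracts a common [delta]. *)
Lemma segment_uniform (u v : R) (P : R -> R -> Prop) :
  (forall x, u <= x <= v -> exists2 eta, 0 < eta & forall delta y, 0 < delta ->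
     delta < eta -> u <= y <= v -> `|y - x| < eta -> P delta y) ->
  exists2 delta, 0 < delta & forall x, u <= x <= v -> P delta x.
Proof.
move=> H.
have : \forall d \near 0^'+, `[u, v]%classic `<=` (fun x => u <= x <= v -> P d x).
  have /compact_near_coveringP := @segment_compact R u v; apply => x /=.
  rewrite in_itv/= => xuv; have [eta e0 He] := H x xuv.
  exists (ball x eta, [set d | 0 < d < eta]) => /=.
    split; first exact: nbhsx_ballx.
    by near=> d; apply/andP; split.
  move=> [y d] /= [xy /andP[d0 de] yuv]; apply: He => //.
  by move: xy; rewrite -ball_normE /= distrC.
move=> [e /= e0 He]; have e20 : 0 < e / 2 by rewrite divr_gt0.
exists (e / 2) => // x xuv; apply: (He (e / 2)) => //=.
  by rewrite sub0r normrN gtr0_norm//; lra.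
Unshelve. all: by end_near. Qed.

End Variation.

(** * The superadditive hull of a continuous two-index function *)

Section SuperadditiveHull.
Context {R : realType} (k : R -> R -> R) (u v B : R).
Context (k0 : forall s t, u <= s -> s <= t -> t <= v -> 0 <= k s t)
  (kd : forall t, u <= t -> t <= v -> k t t = 0)
  (kB : forall D, itv_partition u v D -> riemann_sum k u v D <= B)
  (kc : forall s t, u <= s -> s <= t -> t <= v -> forall eps, 0 < eps ->
     exists2 delta, 0 < delta & forall s' t', u <= s' -> s' <= t' -> t' <= v ->
       `|s' - s| < delta -> `|t' - t| < delta -> `|k s' t' - k s t| < eps).

(** The smallest superadditive majorant of [k]; for [k] equal to $|K|^r$ it is the $r$-th power of
    the $r$-variation. *)
Definition hull s t : R := sup [set riemann_sum k s t D | D in itv_partition s t].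

(** Partitions increase strictly, so the trivial partition of a one-point interval is the empty
    list. *)
Let step (a b : R) : seq R := if a == b then [::] else [:: b].

Let stepP a b : a <= b -> itv_partition a b (step a b).
Proof.
move=> ab; rewrite /step; case: eqVneq => [->|n]; first by split.
by apply: itv_partition1; rewrite lt_neqAle n.
Qed.

Let step_sum a b : u <= a -> a <= b -> b <= v -> riemann_sum k a b (step a b) = k a b.
Proof.
move=> ua ab bv; rewrite /step; case: eqVneq => [->|_].
  by rewrite riemann_sum_nil kd// (le_trans ua).
by rewrite riemann_sum_cons riemann_sum_nil addr0.
Qed.

Let sum_le s t D : u <= s -> t <= v -> itv_partition s t D -> riemann_sum k s t D <= B.
Proof.
move=> us tv sD; have st := itv_partition_le sD.
have p1 := stepP us; have p2 := stepP tv.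
have pD := itv_partition_cat p1 (itv_partition_cat sD p2).
have lE : last u (step u s) = s by case: p1 => _ /eqP.
have lE2 : last s D = t by case: sD => _ /eqP.
apply: le_trans (kB pD); rewrite !riemann_sum_cat lE lE2.
have us' := le_trans us st; have sv := le_trans st tv.
rewrite (riemann_sum_end k u v s) (riemann_sum_end k s v t) !step_sum//.
by have := k0 (lexx u) us (le_trans st tv); have := k0 (le_trans us st) tv (lexx v); lra.
Qed.

Let hull_has_sup s t : u <= s -> s <= t -> t <= v ->
  has_sup [set riemann_sum k s t D | D in itv_partition s t].
Proof.
move=> us st tv; split.
  by exists (riemann_sum k s t (step s t)), (step s t) => //; exact: stepP.
by exists B => _ [D sD <-]; exact: sum_le.
Qed.

Lemma hull_ge s t D : u <= s -> t <= v -> itv_partition s t D ->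
  riemann_sum k s t D <= hull s t.
Proof.
move=> us tv sD; apply: ub_le_sup; last by exists D.
by have [] := hull_has_sup us (itv_partition_le sD) tv.
Qed.

Lemma hull_le s t M : s <= t ->
  (forall D, itv_partition s t D -> riemann_sum k s t D <= M) -> hull s t <= M.
Proof.
move=> st H; apply: ge_sup; last by move=> _ [D sD <-]; exact: H.
by exists (riemann_sum k s t (step s t)), (step s t) => //; exact: stepP.
Qed.

Lemma hull_approx s t eps : u <= s -> s <= t -> t <= v -> 0 < eps ->
  exists2 D, itv_partition s t D & hull s t - eps < riemann_sum k s t D.
Proof.
move=> us st tv e0; have [_ [D sD <-] h] := sup_adherent e0 (hull_has_sup us st tv).
by exists D.
Qed.

Lemma le_hull s t : u <= s -> s <= t -> t <= v -> k s t <= hull s t.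
Proof.
move=> us st tv; rewrite -step_sum//; apply: hull_ge => //; exact: stepP.
Qed.

Lemma hull_ge0 s t : u <= s -> s <= t -> t <= v -> 0 <= hull s t.
Proof. by move=> us st tv; apply: le_trans (le_hull us st tv); exact: k0. Qed.

Lemma hull_superadd s m t : u <= s -> s <= m -> m <= t -> t <= v ->
  hull s m + hull m t <= hull s t.
Proof.
move=> us sm mt tv; rewrite -lerBrDr; apply: hull_le => // D sD.
rewrite lerBrDr addrC -lerBrDr; apply: hull_le => // E mE.
rewrite lerBrDr addrC; have := hull_ge us tv (itv_partition_cat sD mE).
rewrite riemann_sum_cat (_ : last s D = m); last by case: sD => _ /eqP.
by rewrite (riemann_sum_end k s t m).
Qed.

Lemma hull_bound : u <= v -> hull u v <= B.
Proof. by move=> uv; apply: hull_le => // D uD; exact: kB. Qed.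

Lemma hull_mono a s t : u <= a -> a <= s -> s <= t -> t <= v -> hull a s <= hull a t.
Proof.
move=> ua as' st tv; apply: le_trans (hull_superadd ua as' st tv).
by rewrite lerDl hull_ge0// (le_trans ua).
Qed.

(* Otherwise arbitrarily many disjoint intervals accumulating at [t] would each
   carry a mass at least [eps / 2]. *)
Lemma hull_right0 t eps : u <= t -> t <= v -> 0 < eps -> exists2 delta, 0 < delta &
  forall b, t <= b -> b <= v -> b - t < delta -> hull t b < eps.
Proof.
move=> ut tv e0; apply: contrapT => N.
have big b : t < b -> b <= v -> eps <= hull t b.
  move=> tb bv; rewrite leNgt; apply/negP => hb; apply: N.
  exists (b - t); rewrite ?subr_gt0// => b' tb' b'v; rewrite ltrD2r => b'b.
  exact: le_lt_trans (hull_mono ut tb' (ltW b'b) bv) hb.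
have [tv'|vt] := ltP t v; last first.
  apply: N; exists 1 => // b tb bv _; have -> : b = t by apply/eqP; rewrite eq_le tb (le_trans bv).
  by apply: le_lt_trans e0; apply: hull_le => // D /itv_partitionxx ->; rewrite riemann_sum_nil.
have all_n (n : nat) : forall b, t < b -> b <= v -> n%:R * (eps / 2) <= hull t b.
  elim: n => [|n IH] b tb bv; first by rewrite mul0r hull_ge0// ltW.
  have e4 : 0 < eps / 4 by rewrite divr_gt0.
  have [[|t1 D] tD hD] := hull_approx ut (ltW tb) bv e4.
    by move: tb; rewrite (itv_partition_nil tD) ltxx.
  have [tt1 t1b t1D] := itv_partition_consE tD.
  have t1v := le_trans t1b bv.
  have [d d0 kd'] := kc ut (ltW tt1) t1v e4.
  (* Moving the left end of the first step from [t] to [t'] costs at most [eps / 4], as does the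
     choice of [D]. So [[t', b]] keeps mass [eps / 2], and the induction hypothesis applies to the
     disjoint interval [[t, t']]. *)
  pose t' := t + Num.min (d / 2) ((t1 - t) / 2).
  have m0 : 0 < Num.min (d / 2) ((t1 - t) / 2).
    by rewrite lt_min !divr_gt0// subr_gt0.
  have m1 : Num.min (d / 2) ((t1 - t) / 2) <= d / 2 by rewrite ge_min lexx.
  have m2 : Num.min (d / 2) ((t1 - t) / 2) <= (t1 - t) / 2 by rewrite ge_min lexx orbT.
  have tt' : t < t' by rewrite /t' ltrDl.
  have t't1 : t' < t1 by rewrite /t'; lra.
  have ut' := le_trans ut (ltW tt').
  have := kd' t' t1 ut' (ltW t't1) t1v.
  rewrite subrr normr0 {1}/t' addrC addKr gtr0_norm// => /(_ _ d0).
  have md : Num.min (d / 2) ((t1 - t) / 2) < d by lra.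
  move=> /(_ md); rewrite ltr_norml => /andP[h1 _].
  have t'D : itv_partition t' b (t1 :: D).
    by case: t1D => p l; split=> //=; rewrite t't1.
  have h2 := hull_ge ut' bv t'D.
  have h3 := hull_superadd ut (ltW tt') (le_trans (ltW t't1) t1b) bv.
  have h4 := IH t' tt' (le_trans (ltW t't1) t1v).
  move: hD h2; rewrite !riemann_sum_cons -[n.+1%:R]natr1 => hD h2.
  have := big b tb bv; lra.
have [n nB] : exists n : nat, B < n%:R * (eps / 2).
  have := archi_boundP (divr_ge0 (normr_ge0 B) (ltW (divr_gt0 e0 (ltr0n R 2)))).
  move: (Num.bound _) => n; rewrite ltr_pdivrMr ?divr_gt0// => h.
  by exists n; apply: le_lt_trans h; exact: ler_norm.
have := all_n n v tv' (lexx v); rewrite leNgt => /negP; apply.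
apply: le_lt_trans nB; apply: hull_le => // D tD; exact: sum_le tD.
Qed.

(** The step [[x, y]] of [D] that straddles [t] is cut at [t]; everything else is superadditive. *)
Lemma hull_split t b a D : u <= a -> a <= t -> t <= b -> b <= v ->
  itv_partition a b D -> exists x y, [/\ u <= x <= t, t <= y <= b &
    riemann_sum k a b D <= hull a t + hull t b + (k x y - k x t)].
Proof.
elim: D a => [|c D IH] a ua at' tb bv aD.
  have ab := itv_partition_nil aD; exists t, t; rewrite subrr addr0 lexx (le_trans ua)//=.
  split; rewrite ?lexx ?tb// riemann_sum_nil addr_ge0// hull_ge0//.
    exact: le_trans bv.
  exact: le_trans at'.
have [ac cb cD] := itv_partition_consE aD.
have cv := le_trans cb bv; have uc := le_trans ua (ltW ac).
have tv := le_trans tb bv; have ut := le_trans ua at'.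
rewrite riemann_sum_cons; have [ct|tc] := leP c t.
  have [x [y [xt yb h]]] := IH c uc ct tb bv cD.
  exists x, y; split=> //; have := hull_superadd ua (ltW ac) ct tv.
  have := le_hull ua (ltW ac) cv; lra.
exists a, c; rewrite ua at' (ltW tc) cb; split=> //.
have h1 := le_hull ua at' tv; have h2 := hull_ge uc bv cD.
have := hull_superadd ut (ltW tc) cb bv; have := hull_ge0 ut (ltW tc) cv; lra.
Qed.

Lemma hull_right_continuous t eps : u <= t -> t <= v -> 0 < eps ->
  exists2 delta, 0 < delta & forall b, t <= b -> b <= v -> b - t < delta ->
    hull u b - hull u t < eps.
Proof.
move=> ut tv e0; have e2 : 0 < eps / 2 by rewrite divr_gt0.
have [d1 d10 H1] := hull_right0 ut tv e2.
have e4 : 0 < eps / 4 by rewrite divr_gt0.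
have e8 : 0 < eps / 8 by rewrite divr_gt0.
(* The left end [x] of the straddling step is unknown, so the continuity of [k] at [(x, t)] is
   needed uniformly in [x]. *)
have [|d2 d20 H2] := @segment_uniform R u t
  (fun d x => forall y, t <= y <= v -> y - t < d -> `|k x y - k x t| < eps / 4).
  move=> x /andP[ux xt]; have [d d0 kd'] := kc ux xt tv e8.
  exists d => // d' y d'0 d'd /andP[uy yt] yx z /andP[tz zv] zt.
  have h1 := kd' y z uy (le_trans yt tz) zv yx.
  have h2 := kd' y t uy yt tv yx; rewrite subrr normr0 in h2.
  have /h1 : `|z - t| < d by rewrite ger0_norm ?subr_ge0//; lra.
  by have := h2 d0; rewrite !ltr_norml => /andP[? ?] /andP[? ?]; lra.
exists (Num.min d1 d2); first by rewrite lt_min d10.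
move=> b tb bv; rewrite lt_min => /andP[b1 b2].
have h1 := H1 b tb bv b1.
suff : hull u b <= hull u t + hull t b + eps / 4 by lra.
apply: hull_le => [|D uD]; first exact: le_trans tb.
have [x [y [xt /andP[ty yb] h]]] := hull_split (lexx u) ut tb bv uD.
have := H2 x xt y; rewrite ty (le_trans yb bv) => /(_ isT).
move=> /(_ (le_lt_trans (lerB yb (lexx t)) b2)).
by rewrite ltr_norml => /andP[_]; lra.
Qed.

(** A nearly optimal partition of [[u, t]] has a last step [[a, t]]. Ending that step at a nearby
    [s] changes a single term, and by little. *)
Lemma hull_left_continuous t eps : u <= t -> t <= v -> 0 < eps ->
  exists2 delta, 0 < delta & forall s, u <= s -> s <= t -> t - s < delta ->
    hull u t - hull u s < eps.
Proof.
move=> ut tv e0; have e2 : 0 < eps / 2 by rewrite divr_gt0.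
have [D uD hD] := hull_approx (lexx u) ut tv e2.
case/lastP: D uD hD => [|D t'] uD hD.
  have tu := itv_partition_nil uD; exists 1 => // s us st _.
  have -> : s = t by apply/eqP; rewrite eq_le st -tu.
  by rewrite subrr.
move: uD hD; rewrite -cats1 => /[dup] uD' /itv_partition_catE[].
set a := last u D => uD /itv_partition_consE[at' t't /itv_partition_nil tE].
rewrite riemann_sum_cat riemann_sum_cons riemann_sum_nil addr0 -/a tE => hD.
rewrite {}tE {t' t't uD'} in at' hD *.
have ua := itv_partition_le uD.
have [d d0 kd'] := kc ua (ltW at') tv e2.
exists (Num.min d (t - a)); first by rewrite lt_min d0 subr_gt0.
move=> s us st; rewrite lt_min => /andP[h1 h2].
have as' : a < s by lra.
have := kd' a s ua (ltW as') (le_trans st tv).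
rewrite subrr normr0 => /(_ d0); rewrite distrC ger0_norm ?subr_ge0// => /(_ h1).
rewrite ltr_norml => /andP[h3 _].
have := hull_ge (lexx u) (le_trans st tv) (itv_partition_cat uD (itv_partition1 as')).
rewrite riemann_sum_cat riemann_sum_cons riemann_sum_nil addr0 -/a.
by rewrite (riemann_sum_end k u s t); lra.
Qed.

Lemma hull_additive_control : u <= v -> additive_control u v (hull u).
Proof.
move=> uv; split=> [s t us st tv|eps e0]; first exact: hull_mono.
have e2 : 0 < eps / 2 by rewrite divr_gt0.
have [|d d0 H] := @segment_uniform R u v
  (fun d x => forall s, x <= s -> s <= v -> s - x < d -> hull u s - hull u x < eps).
  move=> x /andP[ux xv].
  have [d1 d10 H1] := hull_right_continuous ux xv e2.
  have [d2 d20 H2] := hull_left_continuous ux xv e2.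
  exists (Num.min (d1 / 2) d2); first by rewrite lt_min d20 divr_gt0.
  move=> d y d0; rewrite !lt_min => /andP[dd1 dd2] /andP[uy yv] /andP[].
  rewrite !ltr_norml => /andP[? ?] /andP[? ?] s ys sv sy.
  have hs : hull u s - hull u x < eps / 2.
    have [xs|sx] := leP x s; first by apply: H1 => //; lra.
    by have := hull_mono (lexx u) (le_trans uy ys) (ltW sx) xv; lra.
  have hy : hull u x - hull u y < eps / 2.
    have [yx|xy] := leP y x; first by apply: H2 => //; lra.
    by have := hull_mono (lexx u) ux (ltW xy) yv; lra.
  lra.
exists d => // s t us st tv td; apply: H => //.
by rewrite us (le_trans st).
Qed.

End SuperadditiveHull.

(** * Finite variation and controls *)

Section VariationControl.
Context {R : realType} {F : normedModType R}.

Lemma powRK (r x : R) : 0 < r -> 0 <= x -> (x `^ r^-1) `^ r = x.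
Proof. by move=> r0 x0; rewrite -powRrM mulVf ?gt_eqF// powRr1. Qed.

Lemma powRVK (r x : R) : 0 < r -> 0 <= x -> (x `^ r) `^ r^-1 = x.
Proof. by move=> r0 x0; rewrite -powRrM mulfV ?gt_eqF// powRr1. Qed.

Lemma riemann_sum_ge0 (k : R -> R -> R) a b D :
  (forall s t, 0 <= k s t) -> 0 <= riemann_sum k a b D.
Proof.
move=> k0; elim: D a => [|c D IH] a; first by rewrite riemann_sum_nil.
by rewrite riemann_sum_cons addr_ge0.
Qed.

(** The control is the hull of $|K|^r$ based at [u]. The explicit bound on its mass is what later
    makes constants depend on the tangent norm alone. *)
Lemma var2_control (r u v : R) (K : R -> R -> F) : 0 < r -> u <= v ->
  {within simplex u v, continuous (fun z : R * R => K z.1 z.2)} ->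
  (forall t, u <= t -> t <= v -> K t t = 0) -> (var2 r K u v < +oo)%E ->
  exists f, [/\ additive_control u v f,
    forall s t, u <= s -> s <= t -> t <= v -> `|K s t| <= (f t - f s) `^ r^-1
    & forall N, 0 <= N -> (var2 r K u v <= N%:E)%E -> f v - f u <= N `^ r].
Proof.
move=> r0 uv Kc K0 Kfin; pose k s t := `|K s t| `^ r.
have k0 s t : 0 <= k s t by exact: powR_ge0.
set S := ereal_sup [set (riemann_sum k u v D)%:E | D in itv_partition u v].
have varE : var2 r K u v = poweR S r^-1 by [].
have [D0 uD0] : exists D, itv_partition u v D.
  by have [D] := fine_partition uv (@ltr01 R); exists D.
have S0 : (0 <= S)%E.
  apply: (@le_trans _ _ (riemann_sum k u v D0)%:E).
    by rewrite lee_fin riemann_sum_ge0.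
  by apply: ereal_sup_ubound; exists D0.
have Sy : (S < +oo)%E.
  by apply: (@lty_poweRy _ _ r^-1); rewrite ?invr_neq0 ?gt_eqF// -varE.
have [B SB] : exists B : R, S = B%:E.
  by exists (fine S); rewrite fineK// ge0_fin_numE.
have B0 : 0 <= B by move: S0; rewrite SB lee_fin.
have kB D : itv_partition u v D -> riemann_sum k u v D <= B.
  by move=> uD; rewrite -lee_fin -SB; apply: ereal_sup_ubound; exists D.
have kd t : u <= t -> t <= v -> k t t = 0.
  by move=> ut tv; rewrite /k K0// normr0 powR0 ?gt_eqF.
have kc s t : u <= s -> s <= t -> t <= v -> forall eps, 0 < eps ->
     exists2 delta, 0 < delta & forall s' t', u <= s' -> s' <= t' -> t' <= v ->
       `|s' - s| < delta -> `|t' - t| < delta -> `|k s' t' - k s t| < eps.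
  move=> us st tv eps e0.
  have [d d0 dk] := powR_continuous_ge0 r0 (normr_ge0 (K s t)) e0.
  have /within_continuousP/(_ (s, t)) := Kc.
  have sst : simplex u v (s, t) by [].
  move=> /(_ sst d d0)[d' d'0 H]; exists d' => // s' t' us' st' tv' hs ht.
  apply: dk => //; apply: le_lt_trans (ler_dist_dist _ _) _.
  by apply: (H (s', t')) => //; split; rewrite -ball_normE /= distrC.
have k0' s t : u <= s -> s <= t -> t <= v -> 0 <= k s t by [].
exists (hull k u); split.
- exact: (hull_additive_control k0' kd kB kc uv).
- move=> s t us st tv; rewrite -[leLHS](@powRVK r)//.
  apply: ge0_ler_powR; rewrite ?nnegrE ?invr_ge0 ?(ltW r0) ?powR_ge0//.
    have := hull_superadd k0' kd kB (lexx u) us st tv.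
    have := hull_ge0 k0' kd kB us st tv; lra.
  have := hull_superadd k0' kd kB (lexx u) us st tv.
  have := le_hull k0' kd kB us st tv; rewrite /k; lra.
- move=> N N0; rewrite varE SB poweR_EFin lee_fin => BN.
  apply: (@le_trans _ _ B).
    have := hull_bound kB uv.
    have := hull_ge0 k0' kd kB (lexx u) (lexx u) uv; lra.
  rewrite -[leLHS](@powRK r)//.
  by apply: ge0_ler_powR; rewrite ?nnegrE ?powR_ge0 ?(ltW r0).
Qed.

Lemma var2_le (r u v c : R) (K : R -> R -> F) f : 0 < r -> 0 <= c -> u <= v ->
  (forall s t, u <= s -> s <= t -> t <= v -> f s <= f t) ->
  (forall s t, u <= s -> s <= t -> t <= v -> `|K s t| <= c * (f t - f s) `^ r^-1) ->
  (var2 r K u v <= (c * (f v - f u) `^ r^-1)%:E)%E.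
Proof.
move=> r0 c0 uv mf Kf.
have cf : c * (f v - f u) `^ r^-1 = (c `^ r * (f v - f u)) `^ r^-1.
  by rewrite powRM ?powR_ge0 ?subr_ge0 ?mf// powRVK.
rewrite cf -poweR_EFin; apply: gt0_ler_poweR.
- by rewrite invr_ge0 ltW.
- rewrite in_itv /= leey andbT.
  have [D uD _] := fine_partition uv (@ltr01 R).
  apply: (@le_trans _ _ (riemann_sum (fun s t => `|K s t| `^ r) u v D)%:E).
    by rewrite lee_fin riemann_sum_ge0// => s t; exact: powR_ge0.
  by apply: ereal_sup_ubound; exists D.
- by rewrite in_itv /= leey andbT lee_fin mulr_ge0 ?powR_ge0// subr_ge0 mf.
apply: ge_ereal_sup => _ [D uD <-]; rewrite lee_fin.
suff H a : u <= a -> itv_partition a v D ->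
    riemann_sum (fun s t => `|K s t| `^ r) a v D <= c `^ r * (f v - f a) by exact: H.
elim: D a {uD} => [|d D IH] a ua aD.
  by rewrite riemann_sum_nil (itv_partition_nil aD) subrr mulr0.
have [ad dv dD] := itv_partition_consE aD; have ud := le_trans ua (ltW ad).
rewrite riemann_sum_cons; have := IH d ud dD.
have := Kf a d ua (ltW ad) dv.
move=> /(ge0_ler_powR (ltW r0)); rewrite !nnegrE => /(_ (normr_ge0 _)).
rewrite mulr_ge0 ?powR_ge0// => /(_ isT).
by rewrite powRM ?powR_ge0// powRK ?subr_ge0 ?mf ?(ltW ad)//; lra.
Qed.

End VariationControl.

(** * Mean value inequalities in normed modules *)

Section MeanValue.
Context {R : realType} {W : normedModType R}.

(** The supremum of the times at which the bound holds is such a time itself, and below [1] the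
    local hypothesis would push it further. *)
Lemma local_lipschitz (g : R -> W) (M : R) :
  (forall t, 0 <= t <= 1 -> exists2 eta, 0 < eta & forall s, 0 <= s <= 1 ->
     `|s - t| < eta -> `|g s - g t| <= M * `|s - t|) ->
  `|g 1 - g 0| <= M.
Proof.
move=> H; pose S := [set t | 0 <= t <= 1 /\ `|g t - g 0| <= M * t].
have S0 : S 0 by split; rewrite ?lexx ?ler01// subrr normr0 mulr0.
have Ssup : has_sup S by split; [exists 0|exists 1 => t [/andP[]]].
set t := sup S.
have S_le s : S s -> s <= t by move=> Ss; apply: ub_le_sup => //; case: Ssup.
have t0 : 0 <= t by exact: S_le.
have t1 : t <= 1 by apply: ge_sup; [exists 0|move=> s [/andP[]]].
have [|eta e0 He] := H t; first by rewrite t0.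
have [s [/andP[s0 s1] sM] st] := sup_adherent e0 Ssup.
have s_le : s <= t by apply: S_le; split; rewrite ?s0.
have St : S t.
  split; first by rewrite t0.
  have := He s; rewrite s0 s1 => /(_ isT).
  have se : t - s < eta by move: st; rewrite -/t; lra.
  rewrite ler0_norm ?subr_le0// opprB => /(_ se) h1.
  rewrite -(subrKA (g s)) (le_trans (ler_normD _ _))// distrC.
  by rewrite (le_trans (lerD h1 sM))//; lra.
have [t_lt|t_ge] := ltP t 1; last first.
  have tE : t = 1 by apply/eqP; rewrite eq_le t1.
  by case: St; rewrite tE mulr1.
pose t' := Num.min 1 (t + eta / 2).
have tt' : t < t' by rewrite lt_min t_lt ltrDl divr_gt0.
have t'1 : t' <= 1 by rewrite ge_min lexx.
have t'e : t' <= t + eta / 2 by rewrite ge_min lexx orbT.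
have [_ tM] := St.
suff /S_le : S t' by rewrite leNgt tt'.
have t'0 : 0 <= t' by rewrite (le_trans t0)// ltW.
split; first by rewrite t'1 t'0.
have := He t'; rewrite t'0 t'1 => /(_ isT).
have te : t' - t < eta by lra.
rewrite gtr0_norm ?subr_gt0// => /(_ te) h1.
rewrite -(subrKA (g t)) (le_trans (ler_normD _ _))//.
by rewrite (le_trans (lerD h1 tM))//; lra.
Qed.

Definition has_slope (g : R -> W) (t : R) (d : W) : Prop :=
  forall eps, 0 < eps -> exists2 eta, 0 < eta & forall s, `|s - t| < eta ->
    `|g s - g t - (s - t) *: d| <= eps * `|s - t|.

Lemma mean_value_inequality (g d : R -> W) (M : R) :
  (forall t, 0 <= t <= 1 -> has_slope g t (d t) /\ `|d t| <= M) ->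
  `|g 1 - g 0| <= M.
Proof.
move=> H; apply/ler_addgt0Pr => e e0; apply: local_lipschitz => t t01.
have [gd dM] := H t t01; have [eta eta0 He] := gd e e0.
exists eta => // s _ st; rewrite -[g s - g t](subrK ((s - t) *: d t)).
rewrite (le_trans (ler_normD _ _))// mulrDl addrC lerD// ?He// normrZ mulrC.
by rewrite ler_wpM2r.
Qed.

Lemma has_slopeB g1 g2 t d1 d2 : has_slope g1 t d1 -> has_slope g2 t d2 ->
  has_slope (fun s => g1 s - g2 s) t (d1 - d2).
Proof.
move=> h1 h2 e e0; have e2 : 0 < e / 2 by rewrite divr_gt0.
have [a a0 H1] := h1 _ e2; have [b b0 H2] := h2 _ e2.
exists (Num.min a b) => [|s]; first by rewrite lt_min a0.
rewrite lt_min => /andP[sa sb].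
have -> : g1 s - g2 s - (g1 t - g2 t) - (s - t) *: (d1 - d2) =
    (g1 s - g1 t - (s - t) *: d1) - (g2 s - g2 t - (s - t) *: d2).
  have swap (a1 a2 a3 a4 : W) : a1 - a2 - (a3 - a4) = a1 - a3 - (a2 - a4).
    by rewrite !opprD !opprK addrACA.
  by rewrite scalerBr swap [LHS]swap.
rewrite (le_trans (ler_normB _ _))// (le_trans (lerD (H1 s sa) (H2 s sb)))//.
by rewrite -mulrDl -splitr.
Qed.

Lemma has_slopeZ (w : W) t : has_slope (fun s => s *: w) t w.
Proof.
move=> e e0; exists 1 => // s _; rewrite -scalerBl subrr normr0.
by rewrite mulr_ge0// ltW.
Qed.

Lemma diff_local {V : normedModType R} (g : V -> W) x : differentiable g x ->
  forall eps, 0 < eps -> exists2 eta, 0 < eta & forall h, `|h| < eta ->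
    `|g (x + h) - g x - 'd g x h| <= eps * `|h|.
Proof.
move=> /diff_locally/eqaddoP gx eps e0.
have /nbhs_ballP[eta /= eta0 He] := gx eps e0.
exists eta => // h hd; have := He h; rewrite -ball_normE /= sub0r normrN => /(_ hd).
by rewrite !fctE /= opprD addrA [h + x]addrC.
Qed.

Lemma has_slope_line {V : normedModType R} (g : V -> W) x h t :
  differentiable g (x + t *: h) ->
  has_slope (fun s => g (x + s *: h)) t ('d g (x + t *: h) h).
Proof.
move=> gx e e0; have e1 : 0 < e / (`|h| + 1) by rewrite divr_gt0// ltr_wpDl.
have [eta eta0 He] := diff_local gx e1.
exists (eta / (`|h| + 1)) => [|s]; first by rewrite divr_gt0// ltr_wpDl.
rewrite ltr_pdivlMr ?ltr_wpDl// => st.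
have := He ((s - t) *: h); rewrite normrZ linearZ -[x + _ + _]addrA -scalerDl [t + _]addrC subrK.
have sth : `|s - t| * `|h| <= `|s - t| * (`|h| + 1) by rewrite ler_wpM2l// lerDl.
move=> /(_ (le_lt_trans sth st))/le_trans; apply.
rewrite mulrAC ler_pdivrMr ?ltr_wpDl// -mulrA ler_wpM2l// ltW//.
Qed.

Lemma diff_lipschitz {V : normedModType R} (g : V -> W) M x y :
  (forall z, differentiable g z) -> (forall z h, `|'d g z h| <= M * `|h|) ->
  `|g y - g x| <= M * `|y - x|.
Proof.
move=> gd gM; have := @mean_value_inequality (fun t => g (x + t *: (y - x)))
  (fun t => 'd g (x + t *: (y - x)) (y - x)) (M * `|y - x|).
rewrite scale1r scale0r addr0 [x + _]addrC subrK; apply=> t _.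
by split; [exact: has_slope_line|exact: gM].
Qed.

Lemma taylor1 {V : normedModType R} (g : V -> W) L x y :
  (forall z, differentiable g z) -> 0 <= L ->
  (forall z h, `|'d g z h - 'd g x h| <= L * `|z - x| * `|h|) ->
  `|g y - g x - 'd g x (y - x)| <= L * `|y - x| ^+ 2.
Proof.
move=> gd L0 gL; have := @mean_value_inequality
  (fun t => g (x + t *: (y - x)) - t *: 'd g x (y - x))
  (fun t => 'd g (x + t *: (y - x)) (y - x) - 'd g x (y - x)) (L * `|y - x| ^+ 2).
rewrite !scale1r !scale0r subr0 addr0 [x + _]addrC subrK addrAC; apply=> t /andP[t0 t1].
split; first by apply: has_slopeB; [exact: has_slope_line|exact: has_slopeZ].
rewrite (le_trans (gL _ _))// expr2 mulrA ler_wpM2r// ler_wpM2l//.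
by rewrite addrC addKr normrZ ger0_norm// ler_piMl.
Qed.

End MeanValue.

(** * Bounds on differentials up to order three *)

Section IteratedDifferentials.
Context {R : realType} {V W : normedModType R}.

(** The head direction scales by linearity of a differential; the deeper ones because the identity
    holds at all points and can be differentiated. This extends bounds on the unit ball to all
    directions. *)
Lemma iter_diff_scale (f : V -> W) n :
  (forall vs, (size vs < n)%N -> forall x, differentiable (iter_diff f vs) x) ->
  forall cs vs, (size vs <= n)%N -> size cs = size vs -> forall x,
  iter_diff f [seq z.1 *: z.2 | z <- zip cs vs] x =
  (\prod_(c <- cs) c) *: iter_diff f vs x.
Proof.
move=> fd; elim=> [|c cs IH] [|w vs] //= sn.
  by move=> _ x; rewrite big_nil scale1r.
move=> [sz] x; have {}IH := IH vs (ltnW sn) sz.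
rewrite big_cons linearZ -scalerA.
have -> : iter_diff f [seq z.1 *: z.2 | z <- zip cs vs] =
    (\prod_(j <- cs) j) \*: iter_diff f vs by apply/funext => y; rewrite IH.
by rewrite diffZ//; exact: fd.
Qed.

Lemma iter_diff_bound (f : V -> W) n k M :
  (forall vs, (size vs < n)%N -> forall x, differentiable (iter_diff f vs) x) ->
  (k <= n)%N ->
  (forall x (vs : k.-tuple V), in_unit_ball vs -> `|iter_diff f vs x| <= M) ->
  forall vs, size vs = k -> forall x,
  `|iter_diff f vs x| <= M * \prod_(w <- vs) `|w|.
Proof.
move=> fd kn fM vs vk x; pose cs := [seq `|w| | w <- vs].
pose ws := [seq `|w|^-1 *: w | w <- vs].
have vsE : vs = [seq z.1 *: z.2 | z <- zip cs ws].
  rewrite /cs /ws; elim: (vs) => //= w vs' <-; rewrite scalerA.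
  have [->|w0] := eqVneq w 0; first by rewrite scaler0.
  by rewrite mulfV ?normr_eq0// scale1r.
have cE : \prod_(c <- cs) c = \prod_(w <- vs) `|w| by rewrite /cs big_map.
rewrite {1}vsE (iter_diff_scale fd) ?size_map ?vk// normrZ cE.
have wk : size ws == k by rewrite size_map vk.
have unit : in_unit_ball (Tuple wk).
  move=> i; rewrite (tnth_nth 0) /= (nth_map 0) ?vk ?ltn_ord//.
  rewrite normrZ normfV normr_id; set w := nth _ _ _.
  have [->|w0] := eqVneq w 0; first by rewrite normr0 mulr0.
  by rewrite mulVf ?normr_eq0.
rewrite mulrC ger0_norm ?prodr_ge0// ler_wpM2r ?prodr_ge0//.
exact: fM (Tuple wk) unit.
Qed.

End IteratedDifferentials.

Section ThriceDifferentiable.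
Context {R : realType} {V W : normedModType R}.

(** Linear in the outer direction [a] by construction; linearity in [b] is drawn from
    [diff2_sym]. *)
Definition diff2 (f : V -> W) (x a b : V) : W := 'd (fun y => 'd f y b) x a.

(** The working form of [Cb_frechet 3], with one constant; the third derivative appears as the
    Lipschitz bound [C3_lip2]. *)
Record C3_bounded (M : R) (f : V -> W) : Prop := C3Bounded {
  C3_ge0 : 0 <= M;
  C3_diff0 : forall x, differentiable f x;
  C3_diff1 : forall b x, differentiable (fun y => 'd f y b) x;
  C3_bound0 : forall x, `|f x| <= M;
  C3_bound1 : forall x a, `|'d f x a| <= M * `|a|;
  C3_bound2 : forall x a b, `|diff2 f x a b| <= M * `|a| * `|b|;
  C3_lip2 : forall x y a b,
    `|diff2 f y a b - diff2 f x a b| <= M * `|y - x| * `|a| * `|b|;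
  C3_scale2 : forall x c c' a b,
    diff2 f x (c *: a) (c' *: b) = (c * c') *: diff2 f x a b
}.

Lemma Cb_frechet_C3_bounded (f : V -> W) : Cb_frechet 3 f ->
  exists M, C3_bounded M f.
Proof.
move=> [fd fb _].
have sd vs : (size vs < 3)%N -> forall x, differentiable (iter_diff f vs) x.
  by move=> vs3 x; have [h _] := fd _ vs3 x; exact: (h (in_tuple vs)).
have [M0 H0] := fb 0%N isT; have [M1 H1] := fb 1%N isT.
have [M2 H2] := fb 2%N isT; have [M3 H3] := fb 3%N isT.
have b0 := iter_diff_bound (k := 0) sd isT H0; have b1 := iter_diff_bound (k := 1) sd isT H1.
have b2 := iter_diff_bound (k := 2) sd isT H2; have b3 := iter_diff_bound (k := 3) sd isT H3.
pose M := `|M0| + `|M1| + `|M2| + `|M3|.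
have Mi : [/\ M0 <= M, M1 <= M, M2 <= M & M3 <= M].
  have := ler_norm M0; have := ler_norm M1; have := ler_norm M2.
  have := ler_norm M3; rewrite /M; have := normr_ge0 M0; have := normr_ge0 M1.
  have := normr_ge0 M2; have := normr_ge0 M3; split; lra.
have [M0M M1M M2M M3M] := Mi.
exists M; split.
- by rewrite !addr_ge0.
- exact: (sd [::]).
- by move=> b; exact: (sd [:: b]).
- by move=> x; have := b0 [::] erefl x; rewrite big_nil mulr1 => /le_trans; apply.
- move=> x a; have := b1 [:: a] erefl x; rewrite big_seq1 => /le_trans; apply.
  by rewrite ler_wpM2r.
- move=> x a b; have := b2 [:: a; b] erefl x; rewrite big_cons big_seq1 mulrA.
  by move=> /le_trans; apply; rewrite !ler_wpM2r.
- move=> x y a b.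
  have := @diff_lipschitz _ _ _ (iter_diff f [:: a; b]) (M * `|a| * `|b|) x y.
  have -> : M * `|y - x| * `|a| * `|b| = M * `|a| * `|b| * `|y - x| by ring.
  apply; first exact: (sd [:: a; b]).
  move=> z h; have := b3 [:: h; a; b] erefl z; rewrite !big_cons big_nil mulr1.
  move=> /le_trans; apply.
  have -> : M * `|a| * `|b| * `|h| = M * (`|h| * (`|a| * `|b|)) by ring.
  by rewrite ler_wpM2r// !mulr_ge0.
- move=> x c c' a b; have := iter_diff_scale sd (cs := [:: c; c']) (vs := [:: a; b]).
  by move=> /(_ isT erefl x) /=; rewrite !big_cons big_nil mulr1.
Qed.

Section Estimates.
Context (M : R) (f : V -> W) (fM : C3_bounded M f).

Lemma C3_lip0 x y : `|f y - f x| <= M * `|y - x|.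
Proof. exact: diff_lipschitz (C3_diff0 fM) (C3_bound1 fM). Qed.

Lemma C3_lip1 x y a : `|'d f y a - 'd f x a| <= M * `|y - x| * `|a|.
Proof.
rewrite mulrAC; apply: (@diff_lipschitz _ _ _ (fun z => 'd f z a)).
  exact: (C3_diff1 fM).
by move=> z h; rewrite mulrAC; exact: (C3_bound2 fM).
Qed.

Lemma C3_taylor0 x y : `|f y - f x - 'd f x (y - x)| <= M * `|y - x| ^+ 2.
Proof.
apply: taylor1 (C3_diff0 fM) (C3_ge0 fM) _ => z h; exact: C3_lip1.
Qed.

Lemma C3_taylor1 x y a :
  `|'d f y a - 'd f x a - diff2 f x (y - x) a| <= M * `|y - x| ^+ 2 * `|a|.
Proof.
rewrite mulrAC; apply: (@taylor1 _ _ _ (fun z => 'd f z a)).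
- exact: (C3_diff1 fM).
- by rewrite mulr_ge0// (C3_ge0 fM).
move=> z h; have := C3_lip2 fM x z h a; rewrite /diff2.
by rewrite (_ : M * `|a| * `|z - x| * `|h| = M * `|z - x| * `|h| * `|a|)//; ring.
Qed.

(* Both orders of differentiation are the limit of the second difference
   [f (x + t a + t b) - f (x + t a) - f (x + t b) + f x] divided by [t ^ 2]. *)
Lemma diff2_sym x a b : diff2 f x a b = diff2 f x b a.
Proof.
pose D t a b := f (x + t *: a + t *: b) - f (x + t *: a) - (f (x + t *: b) - f x).
have Dsym t : D t a b = D t b a.
  have swap (a1 a2 a3 a4 : W) : a1 - a2 - (a3 - a4) = a1 - a3 - (a2 - a4).
    by rewrite !opprD !opprK addrACA.
  by rewrite /D swap [x + t *: a + _]addrAC.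
pose N := M * (`|a| ^+ 2 * `|b| + `|b| ^+ 2 * `|a|).
(* The mean value inequality along [a'] for the difference of [f] on two parallel segments; the
   error is cubic in [t], so it vanishes after division by [t * t]. *)
have key t a' b' : 0 < t ->
    `|D t a' b' - (t * t) *: diff2 f x b' a'| <=
    M * t ^+ 3 * (`|a'| ^+ 2 * `|b'| + `|b'| ^+ 2 * `|a'|).
  move=> t0.
  have := @mean_value_inequality _ _ (fun s => f (x + t *: b' + s *: (t *: a'))
     - f (x + s *: (t *: a')) - s *: ((t * t) *: diff2 f x b' a'))
     (fun s => 'd f (x + t *: b' + s *: (t *: a')) (t *: a')
       - 'd f (x + s *: (t *: a')) (t *: a') - (t * t) *: diff2 f x b' a')
     (M * t ^+ 3 * (`|a'| ^+ 2 * `|b'| + `|b'| ^+ 2 * `|a'|)).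
  rewrite !scale0r !addr0 subr0 !scale1r /D [x + t *: a' + _]addrAC.
  rewrite (addrAC (f _ - f _)); apply=> s /andP[s0 s1]; split.
    apply: has_slopeB; last exact: has_slopeZ.
    by apply: has_slopeB; apply: has_slope_line; exact: (C3_diff0 fM).
  set y := x + s *: (t *: a').
  have -> : x + t *: b' + s *: (t *: a') = y + t *: b' by rewrite addrAC.
  have h1 := C3_taylor1 y (y + t *: b') (t *: a').
  have h2 := C3_lip2 fM x y b' a'.
  have yx : y - x = (s * t) *: a' by rewrite /y addrC addKr scalerA.
  have yt : y + t *: b' - y = t *: b' by rewrite addrC addKr.
  rewrite yt (C3_scale2 fM) in h1; rewrite yx in h2.
  rewrite -(subrKA ((t * t) *: diff2 f y b' a')) (le_trans (ler_normD _ _))//.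
  have t2 : 0 <= t * t by rewrite mulr_ge0// ltW.
  rewrite -scalerBr [X in _ + X <= _]normrZ (ger0_norm t2).
  rewrite (le_trans (lerD h1 (ler_wpM2l t2 h2)))// !normrZ ?normrM.
  rewrite (ger0_norm s0) (gtr0_norm t0).
  have st3 : s * (M * t ^+ 3 * (`|a'| ^+ 2 * `|b'|)) <= M * t ^+ 3 * (`|a'| ^+ 2 * `|b'|).
    by rewrite ler_piMl// !mulr_ge0 ?exprn_ge0 ?(C3_ge0 fM)// ltW.
  rewrite (le_trans (lerD (lexx _) (_ : _ <= M * t ^+ 3 * (`|a'| ^+ 2 * `|b'|))))//.
    by apply: le_trans st3; apply: ler_eq; ring.
  by apply: ler_eq; ring.
have N0 : 0 <= N.
  by rewrite mulr_ge0 ?(C3_ge0 fM)// addr_ge0// mulr_ge0// exprn_ge0.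
suff small t : 0 < t -> `|diff2 f x a b - diff2 f x b a| <= t * (2 * N).
  apply/eqP; rewrite -subr_eq0 -normr_le0; apply/ler_addgt0Pr => e e0; rewrite add0r.
  have N1 : 0 < 2 * N + 1 by rewrite ltr_wpDl// mulr_ge0.
  rewrite (le_trans (small (e / (2 * N + 1)) _)) ?divr_gt0//.
  by rewrite mulrAC ler_pdivrMr// ler_wpM2l ?(ltW e0)// lerDl.
move=> t0; have t2 : 0 < t * t by rewrite mulr_gt0.
have h1 := key t a b t0; have h2 := key t b a t0.
rewrite -(ler_pM2l t2) -{1}(gtr0_norm t2) -normrZ scalerBr.
rewrite -(subrKA (D t b a)) (le_trans (ler_normD _ _))//.
rewrite distrC -[X in _ + `|X - _|]Dsym (le_trans (lerD h2 h1))//.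
by apply: ler_eq; rewrite /N; ring.
Qed.

End Estimates.
End ThriceDifferentiable.

(** * Identities in abelian groups by reflection *)

Section ZmoduleIdentities.
Context {V : zmodType}.

Inductive zexpr := ZZero | ZAtom of nat | ZAdd of zexpr & zexpr | ZOpp of zexpr.

Fixpoint zeval (env : seq V) (e : zexpr) : V :=
  match e with
  | ZZero => 0
  | ZAtom n => env`_n
  | ZAdd a b => zeval env a + zeval env b
  | ZOpp a => - zeval env a
  end.

Fixpoint zcoef (k : nat) (e : zexpr) : int :=
  match e with
  | ZZero => 0
  | ZAtom n => (k == n)%:R
  | ZAdd a b => zcoef k a + zcoef k b
  | ZOpp a => - zcoef k a
  end.

Lemma zevalE env e : zeval env e = \sum_(k < size env) env`_k *~ zcoef k e.
Proof.
elim: e => [|n|a IHa b IHb|a IHa] /=.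
- by rewrite big1.
- have [nl|ln] := ltnP n (size env).
    rewrite (bigD1 (Ordinal nl))//= eqxx big1 ?addr0//= => i.
    by rewrite -val_eqE /= => /negPf->.
  rewrite nth_default// big1// => i _.
  by rewrite (_ : _ == _ = false)//; apply/negbTE; rewrite neq_ltn (leq_trans (ltn_ord i)).
- by rewrite IHa IHb -big_split; apply: eq_bigr => i _; rewrite mulrzDr.
- by rewrite IHa -sumrN; apply: eq_bigr => i _; rewrite mulrNz.
Qed.

Lemma zeval_eq env e1 e2 :
  all (fun k => zcoef k e1 == zcoef k e2) (iota 0 (size env)) ->
  zeval env e1 = zeval env e2.
Proof.
move=> /allP H; rewrite !zevalE; apply: eq_bigr => i _.
by rewrite (eqP (H (nat_of_ord i) _))// mem_iota leq0n ltn_ord.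
Qed.

End ZmoduleIdentities.

Ltac zmem l e :=
  lazymatch l with
  | ?a :: ?l' => match constr:(Set) with
    | _ => let _ := match constr:(Set) with _ => unify a e end in constr:(true)
    | _ => zmem l' e
    end
  | _ => constr:(false)
  end.

Ltac zatoms l e :=
  lazymatch e with
  | (?a + ?b)%R => let l := zatoms l a in zatoms l b
  | (- ?a)%R => zatoms l a
  | 0%R => l
  | _ => lazymatch zmem l e with true => l | _ => constr:(e :: l) end
  end.

Ltac zindex l e :=
  lazymatch l with
  | ?a :: ?l' => match constr:(Set) with
    | _ => let _ := match constr:(Set) with _ => unify a e end in constr:(O)
    | _ => let n := zindex l' e in constr:(S n)
    end
  end.

Ltac zreify l e :=
  lazymatch e with
  | (?a + ?b)%R => let a := zreify l a in let b := zreify l b in constr:(ZAdd a b)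
  | (- ?a)%R => let a := zreify l a in constr:(ZOpp a)
  | 0%R => constr:(ZZero)
  | _ => let n := zindex l e in constr:(ZAtom n)
  end.

Ltac zmod :=
  lazymatch goal with
  | |- ?x = ?y :> ?T =>
    let l := zatoms (@nil T) x in let l := zatoms l y in
    let a := zreify l x in let b := zreify l y in
    change (zeval l a = zeval l b); apply: zeval_eq; vm_compute; reflexivity
  end.

(** * Compensated Riemann sums *)

Section RiemannLimits.
Context {R : realType} {F : normedModType R}.
Implicit Types (K : R -> R -> F).

Lemma riemann_sum_eq K K' a b D : itv_partition a b D ->
  (forall s t, a <= s -> s <= t -> t <= b -> K s t = K' s t) ->
  riemann_sum K a b D = riemann_sum K' a b D.
Proof.
move=> aD KK; rewrite /riemann_sum; apply: eq_big_nat => i /andP[_ iD].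
have [|h1 h2 h3] := @partition_piece_itv _ a b D (nth b (a :: D) i)
  (nth b (a :: D) i.+1) aD.
  exists i; split=> //; apply: set_nth_default => //=; exact: ltnW.
by apply: KK => //; exact: ltW.
Qed.

Lemma riemann_limit_eq K K' a b J :
  (forall s t, a <= s -> s <= t -> t <= b -> K s t = K' s t) ->
  riemann_limit K a b J -> riemann_limit K' a b J.
Proof.
move=> KK KJ e e0; have [dl d0 H] := KJ e e0; exists dl => // D aD fD.
by rewrite -(riemann_sum_eq aD KK); exact: H.
Qed.

(** Applied with [c] equal to [1] or [-1], to add the Young germ or to remove it. *)
Lemma riemann_limit_lincomb K K' (c a b : R) J J' : `|c| <= 1 ->
  riemann_limit K a b J -> riemann_limit K' a b J' ->
  riemann_limit (fun s t => K s t + c *: K' s t) a b (J + c *: J').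
Proof.
move=> c1 KJ KJ' e e0; have e2 : 0 < e / 2 by rewrite divr_gt0.
have [d1 d10 H1] := KJ _ e2; have [d2 d20 H2] := KJ' _ e2.
exists (Num.min d1 d2); first by rewrite lt_min d10.
move=> D aD fD.
have h1 : `|riemann_sum K a b D - J| < e / 2.
  by apply: H1 => // s t /fD; rewrite lt_min => /andP[].
have h2 : `|riemann_sum K' a b D - J'| < e / 2.
  by apply: H2 => // s t /fD; rewrite lt_min => /andP[].
have -> : riemann_sum (fun s t => K s t + c *: K' s t) a b D - (J + c *: J') =
    (riemann_sum K a b D - J) + c *: (riemann_sum K' a b D - J').
  by rewrite /riemann_sum big_split /= -scaler_sumr scalerBr; zmod.
rewrite (splitr e) (le_lt_trans (ler_normD _ _))// ltrD// normrZ.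
by apply: le_lt_trans h2; rewrite ler_piMl.
Qed.

(** The local errors are cubes, so their sum over a fine partition is as small as desired. *)
Lemma germ_riemann_limit (p u v C : R) f (P : R -> F) K :
  0 < p < 3 -> 0 <= C -> additive_control u v f ->
  (forall s t, u <= s -> s <= t -> t <= v ->
    `|P t - P s - K s t| <= C * radius p f s t ^+ 3) ->
  forall s t, u <= s -> s <= t -> t <= v -> riemann_limit K s t (incr P s t).
Proof.
move=> p03 C0 fc PK s t us st tv e e0; have [mf _] := fc.
have fst : 0 <= f t - f s by rewrite subr_ge0 mf.
have K0 : 0 < C * (f t - f s) + 1 by rewrite ltr_wpDl// mulr_ge0.
have [dl d0 H] := radius_cube_small p03 fc (divr_gt0 e0 K0).
exists dl => // D sD fD.
apply: (@le_lt_trans _ _ (C * (e / (C * (f t - f s) + 1)) * (f t - f s))); last first.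
  rewrite mulrAC mulrA ltr_pdivrMr// mulrC ltr_pM2l//; lra.
move: (e / _) H => q H {K0 fst}.
elim: D s us st sD fD => [|c D IH] s us st sD fD.
  by rewrite riemann_sum_nil (itv_partition_nil sD) /incr !subrr normr0 mulr0.
have [sc ct cD] := itv_partition_consE sD; have uc := le_trans us (ltW sc).
have cs : c - s < dl by apply: fD; apply/partition_piece_cons; left.
have h1 : `|riemann_sum K c t D - incr P c t| <= C * q * (f t - f c).
  by apply: (IH c uc ct cD) => x y xy; apply: fD; apply/partition_piece_cons; right.
have cv := le_trans ct tv.
have h2 := PK s c us (ltW sc) cv; rewrite distrC in h2.
have h3 := H s c us (ltW sc) cv cs.
rewrite riemann_sum_cons.
have -> : K s c + riemann_sum K c t D - incr P s t =
    (riemann_sum K c t D - incr P c t) + (K s c - (P c - P s)).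
  by rewrite /incr; zmod.
rewrite (le_trans (ler_normD _ _))//.
rewrite (le_trans (lerD h1 (le_trans h2 (ler_wpM2l C0 h3))))//; lra.
Qed.

End RiemannLimits.

(** * Estimates for the derived fields *)

Section FieldEstimates.
Context {R : realType} {E : normedModType R} {d : nat} (V : 'I_d -> E -> E) (M : R).
Context (VM : forall i, C3_bounded M (V i)).

Lemma diff2_subr i th a b c :
  diff2 (V i) th a b - diff2 (V i) th a c = diff2 (V i) th a (b - c).
Proof.
by rewrite (diff2_sym (VM i) th a b) (diff2_sym (VM i) th a c)
  (diff2_sym (VM i) th a (b - c)) /diff2 linearB.
Qed.

Lemma Qfield_le i j th : `|Qfield V j i th| <= M * M.
Proof.
rewrite (le_trans (C3_bound1 (VM i) _ _))// ler_wpM2l ?(C3_ge0 (VM i))//.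
exact: C3_bound0 (VM j) _.
Qed.

Lemma Qfield_lip i j th th' :
  `|Qfield V j i th' - Qfield V j i th| <= 2 * M * M * `|th' - th|.
Proof.
have M0 := C3_ge0 (VM i).
rewrite -(subrKA ('d (V i) th' (V j th))) (le_trans (ler_normD _ _))//.
rewrite -linearB.
have h1 := C3_bound1 (VM i) th' (V j th' - V j th).
have h2 := C3_lip0 (VM j) th th'.
have h3 := C3_lip1 (VM i) th th' (V j th).
have h4 := C3_bound0 (VM j) th.
rewrite (le_trans (lerD (le_trans h1 (ler_wpM2l M0 h2)) (le_trans h3
  (ler_wpM2l (mulr_ge0 M0 (normr_ge0 _)) h4))))//.
by apply: ler_eq; ring.
Qed.

(** The product rule, proved directly: ['d (V i)] is differentiable in each fixed direction, while
    here the direction [V j th] moves with the point, which the uniform Taylor and Lipschitz bounds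
    control. *)
Lemma Bfield_E i j th P : Bfield V j i th P =
  diff2 (V i) th P (V j th) + 'd (V i) th ('d (V j) th P).
Proof.
have M0 := C3_ge0 (VM i).
pose df : {linear E -> E} :=
  'd (fun y => 'd (V i) y (V j th)) th \+ ('d (V i) th \o 'd (V j) th).
rewrite -[RHS]/(df P) /Bfield.
suff -> : 'd (Qfield V j i) th = df :> (E -> E) by [].
apply: diff_unique.
  move=> y; apply: cvgD.
    exact: (diff_continuous (C3_diff1 (VM i) (V j th) th)).
  apply: continuous_comp; first exact: (diff_continuous (C3_diff0 (VM j) th)).
  exact: (diff_continuous (C3_diff0 (VM i) th)).
apply/eqaddoP => eps e0.
have K0 : 0 < 3 * M * M + 1 by rewrite ltr_wpDl// !mulr_ge0.
apply/nbhs_ballP; exists (eps / (3 * M * M + 1)); rewrite /= ?divr_gt0// => h.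
rewrite -ball_normE /= sub0r normrN ltr_pdivlMr// => he.
rewrite !fctE /= /Qfield [h + th]addrC; set th' := th + h.
have hE : h = th' - th by rewrite /th' addrC addKr.
(* Taylor remainder of ['d (V i)] in the fixed direction, Taylor remainder of [V j], and the product
   of the two increments: all quadratic in [h]. *)
have -> : 'd (V i) th' (V j th') - ('d (V i) th (V j th) + df h) =
    ('d (V i) th' (V j th) - 'd (V i) th (V j th) - diff2 (V i) th h (V j th))
  + ('d (V i) th (V j th' - V j th - 'd (V j) th h))
  + ('d (V i) th' (V j th' - V j th) - 'd (V i) th (V j th' - V j th)).
  by rewrite /df /= -/(diff2 _ _ _ _) !linearB/=; zmod.
have h1 := C3_taylor1 (VM i) th th' (V j th); rewrite -hE in h1.
have h2 := C3_taylor0 (VM j) th th'; rewrite -hE in h2.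
have h3 := C3_lip1 (VM i) th th' (V j th' - V j th); rewrite -hE in h3.
have h4 := C3_lip0 (VM j) th th'; rewrite -hE in h4.
have h5 := C3_bound0 (VM j) th.
set X := `|h| in he h1 h2 h3 h4 *; have X0 : 0 <= X by exact: normr_ge0.
rewrite (le_trans (ler_normD _ _))//.
have h6 := C3_bound1 (VM i) th (V j th' - V j th - 'd (V j) th h).
have e1 := le_trans h1 (ler_wpM2l (mulr_ge0 M0 (exprn_ge0 2 X0)) h5).
have e2 := le_trans h6 (ler_wpM2l M0 h2).
have e3 := le_trans h3 (ler_wpM2l (mulr_ge0 M0 X0) h4).
rewrite (le_trans (lerD (le_trans (ler_normD _ _) (lerD e1 e2)) e3))//.
have -> : M * X ^+ 2 * M + M * (M * X ^+ 2) + M * X * (M * X) =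
  (X * (3 * M * M)) * X by ring.
rewrite ler_wpM2r// (le_trans _ (ltW he))// ler_wpM2l// lerDl//.
Qed.

Lemma Bfield_le i j th P : `|Bfield V j i th P| <= 2 * M * M * `|P|.
Proof.
have M0 := C3_ge0 (VM i); rewrite Bfield_E (le_trans (ler_normD _ _))//.
have h1 := C3_bound2 (VM i) th P (V j th).
have h2 := C3_bound1 (VM i) th ('d (V j) th P).
have e1 := le_trans h1 (ler_wpM2l (mulr_ge0 M0 (normr_ge0 P)) (C3_bound0 (VM j) th)).
have e2 := le_trans h2 (ler_wpM2l M0 (C3_bound1 (VM j) th P)).
by rewrite (le_trans (lerD e1 e2))//; apply: ler_eq; ring.
Qed.

Lemma Bfield_lip i j th th' P :
  `|Bfield V j i th' P - Bfield V j i th P| <= 4 * M * M * `|th' - th| * `|P|.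
Proof.
have M0 := C3_ge0 (VM i); rewrite !Bfield_E.
(* The four occurrences of the base point are moved one at a time. *)
have -> : diff2 (V i) th' P (V j th') + 'd (V i) th' ('d (V j) th' P) -
    (diff2 (V i) th P (V j th) + 'd (V i) th ('d (V j) th P)) =
    diff2 (V i) th' P (V j th' - V j th) +
    (diff2 (V i) th' P (V j th) - diff2 (V i) th P (V j th)) +
    'd (V i) th' ('d (V j) th' P - 'd (V j) th P) +
    ('d (V i) th' ('d (V j) th P) - 'd (V i) th ('d (V j) th P)).
  by rewrite -diff2_subr linearB /=; zmod.
set X := `|th' - th|; have X0 : 0 <= X by exact: normr_ge0.
have P0 := normr_ge0 P.
have e1 := le_trans (C3_bound2 (VM i) th' P (V j th' - V j th))
  (ler_wpM2l (mulr_ge0 M0 P0) (C3_lip0 (VM j) th th')).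
have e2 := le_trans (C3_lip2 (VM i) th th' P (V j th))
  (ler_wpM2l (mulr_ge0 (mulr_ge0 M0 X0) P0) (C3_bound0 (VM j) th)).
have e3 := le_trans (C3_bound1 (VM i) th' ('d (V j) th' P - 'd (V j) th P))
  (ler_wpM2l M0 (C3_lip1 (VM j) th th' P)).
have e4 := le_trans (C3_lip1 (VM i) th th' ('d (V j) th P))
  (ler_wpM2l (mulr_ge0 M0 X0) (C3_bound1 (VM j) th P)).
rewrite (le_trans (ler_normD _ _))//.
rewrite (le_trans (lerD (le_trans (ler_normD _ _) (lerD (le_trans (ler_normD _ _)
  (lerD e1 e2)) e3)) e4))// -/X.
by apply: ler_eq; ring.
Qed.

End FieldEstimates.

Section LinearCombinations.
Context {R : realType} {E : normedModType R}.

Lemma mx_entry_le m n (A : 'M[R]_(m, n)) i j : `|A i j| <= `|A|.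
Proof.
rewrite [leRHS]mx_normrE.
by apply: (le_bigmax _ (fun k : 'I_m * 'I_n => `|A k.1 k.2|) (i, j)).
Qed.

Lemma lincomb_le n (c : 'I_n -> R) (w : 'I_n -> E) a b : 0 <= b ->
  (forall i, `|c i| <= a) -> (forall i, `|w i| <= b) ->
  `|\sum_i c i *: w i| <= n%:R * (a * b).
Proof.
move=> b0 ca wb; rewrite (le_trans (ler_norm_sum _ _ _))//.
rewrite -[n in n%:R]card_ord -sum1_card natr_sum mulr_suml ler_sum// => i _.
by rewrite mul1r normrZ ler_pM.
Qed.

Lemma lincomb2_le m n (c : 'M[R]_(m, n)) (w : 'I_m -> 'I_n -> E) a b : 0 <= b ->
  `|c| <= a -> (forall j i, `|w j i| <= b) ->
  `|\sum_j \sum_i c j i *: w j i| <= m%:R * n%:R * (a * b).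
Proof.
move=> b0 ca wb; rewrite (le_trans (ler_norm_sum _ _ _))//.
rewrite -mulrA -[m in m%:R]card_ord -sum1_card natr_sum mulr_suml ler_sum// => j _.
rewrite mul1r; apply: lincomb_le => // i.
exact: le_trans (mx_entry_le _ _ _) ca.
Qed.

Lemma linear_split (g : {linear E -> E}) a b : g b = g a - g (a - b).
Proof. by rewrite linearB opprB addrC subrK. Qed.

Lemma tens_lincomb n (a b : 'rV[R]_n) (w : 'I_n -> 'I_n -> E) :
  \sum_j \sum_i (tens a b) j i *: w j i = \sum_i b 0 i *: \sum_j a 0 j *: w j i.
Proof.
rewrite exchange_big; apply: eq_bigr => i _; rewrite scaler_sumr.
apply: eq_bigr => j _; rewrite scalerA /tens mxE big_ord1 mxE.
by rewrite mulrC (ord1 ord0).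
Qed.

End LinearCombinations.

(** * The germ [Xi] and its defect *)

Section TangentGerm.
Context {R : realType} {E : normedModType R} {d : nat} (V : 'I_d -> E -> E).
Implicit Types (x tau : two_level R d) (Theta : R -> E).

(** Linearity is joint in the tangent and the state, so combinations of solutions solve the equation
    of the combined tangent, and differences solve the homogeneous one. *)
Lemma Xi_linear x tau tau' Theta s t (c : R) z z' :
  Xi V x (c *: tau + tau') Theta s t (c *: z + z') =
  c *: Xi V x tau Theta s t z + Xi V x tau' Theta s t z'.
Proof.
rewrite /Xi !scalerDr.
have h1 : \sum_i incr x.1 s t 0 i *: Afield V i (Theta s) (c *: z + z') =
    c *: (\sum_i incr x.1 s t 0 i *: Afield V i (Theta s) z) +
    \sum_i incr x.1 s t 0 i *: Afield V i (Theta s) z'.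
  rewrite scaler_sumr -big_split; apply: eq_bigr => i _ /=.
  by rewrite /Afield linearP scalerDr !scalerA mulrC.
have h2 : \sum_i incr (c *: tau + tau').1 s t 0 i *: V i (Theta s) =
    c *: (\sum_i incr tau.1 s t 0 i *: V i (Theta s)) +
    \sum_i incr tau'.1 s t 0 i *: V i (Theta s).
  rewrite scaler_sumr -big_split; apply: eq_bigr => i _ /=.
  by rewrite scalerA -scalerDl; congr (_ *: _); rewrite /incr !mxE; ring.
have h3 : \sum_j \sum_i x.2 s t j i *: Bfield V j i (Theta s) (c *: z + z') =
    c *: (\sum_j \sum_i x.2 s t j i *: Bfield V j i (Theta s) z) +
    \sum_j \sum_i x.2 s t j i *: Bfield V j i (Theta s) z'.
  rewrite scaler_sumr -big_split; apply: eq_bigr => j _ /=.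
  rewrite scaler_sumr -big_split; apply: eq_bigr => i _ /=.
  by rewrite /Bfield linearP scalerDr !scalerA mulrC.
have h4 : \sum_j \sum_i (c *: tau + tau').2 s t j i *: Qfield V j i (Theta s) =
    c *: (\sum_j \sum_i tau.2 s t j i *: Qfield V j i (Theta s)) +
    \sum_j \sum_i tau'.2 s t j i *: Qfield V j i (Theta s).
  rewrite scaler_sumr -big_split; apply: eq_bigr => j _ /=.
  rewrite scaler_sumr -big_split; apply: eq_bigr => i _ /=.
  by rewrite scalerA -scalerDl; congr (_ *: _); rewrite !mxE; ring.
by rewrite h1 h2 h3 h4; zmod.
Qed.

(** The size [N] of the tangent is kept outside the control, whose mass can then be bounded
    independently of [tau]. *)
Record driven (p u v N L : R) (f : R -> R) x tau Theta : Prop := Driven {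
  dr_x : forall s t, u <= s -> s <= t -> t <= v -> `|incr x.1 s t| <= radius p f s t;
  dr_xx : forall s t, u <= s -> s <= t -> t <= v ->
    `|x.2 s t| <= radius p f s t ^+ 2;
  dr_h : forall s t, u <= s -> s <= t -> t <= v ->
    `|incr tau.1 s t| <= N * radius p f s t;
  dr_k : forall s t, u <= s -> s <= t -> t <= v ->
    `|tau.2 s t| <= N * radius p f s t ^+ 2;
  dr_T : forall s t, u <= s -> s <= t -> t <= v ->
    `|incr Theta s t| <= L * radius p f s t;
  dr_TR : forall s t, u <= s -> s <= t -> t <= v ->
    `|incr Theta s t - first_order x (fun i => V i (Theta s)) s t|
      <= L * radius p f s t ^+ 2;
  dr_chen_x : forall s m t, u <= s -> s <= m -> m <= t -> t <= v ->
    delta2 x.2 s m t = tens (incr x.1 s m) (incr x.1 m t);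
  dr_chen_k : forall s m t, u <= s -> s <= m -> m <= t -> t <= v ->
    delta2 tau.2 s m t = tens (incr x.1 s m) (incr tau.1 m t)
                       + tens (incr tau.1 s m) (incr x.1 m t)
}.

Definition Xi2 x tau Theta s t z : E :=
  \sum_j \sum_i x.2 s t j i *: Bfield V j i (Theta s) z
  + \sum_j \sum_i tau.2 s t j i *: Qfield V j i (Theta s).

Section Estimates.
Context (M p u v N L Om : R) (f : R -> R) (x tau : two_level R d) (Theta : R -> E).
Context (VM : forall i, C3_bounded M (V i)) (M0 : 0 <= M) (p0 : 0 < p) (N0 : 0 <= N)
  (L0 : 0 <= L) (fc : additive_control u v f) (fOm : f v - f u <= Om)
  (dr : driven p u v N L f x tau Theta).
Let D : R := d%:R.
Let R0 := `|Om| `^ p^-1.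
Let R0_ge0 : 0 <= R0. Proof. exact: powR_ge0. Qed.
Let D0 : 0 <= D. Proof. exact: ler0n. Qed.
Let c1 := D * M + 2 * D * D * M * M * R0.
Let c1_ge0 : 0 <= c1.
Proof. by rewrite addr_ge0// !mulr_ge0. Qed.

Lemma XiE s t z : Xi V x tau Theta s t z =
  \sum_i incr x.1 s t 0 i *: Afield V i (Theta s) z +
  \sum_i incr tau.1 s t 0 i *: V i (Theta s) + Xi2 x tau Theta s t z.
Proof. by rewrite /Xi /Xi2 !addrA. Qed.

Lemma Xi2_le s t z : u <= s -> s <= t -> t <= v ->
  `|Xi2 x tau Theta s t z| <= 2 * D * D * M * M * radius p f s t ^+ 2 * (`|z| + N).
Proof.
move=> us st tv; set r := radius p f s t; have r0 : 0 <= r by exact: radius_ge0.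
have h1 := lincomb2_le (mulr_ge0 (mulr_ge0 (mulr_ge0 (ler0n R 2) M0) M0) (normr_ge0 z))
  (dr_xx dr us st tv) (fun j i => Bfield_le VM i j (Theta s) z).
have h2 := lincomb2_le (mulr_ge0 M0 M0) (dr_k dr us st tv)
  (fun j i => Qfield_le VM i j (Theta s)).
rewrite (le_trans (ler_normD _ _))// (le_trans (lerD h1 h2))// -/r -/D.
have h3 : 0 <= D * D * (N * r ^+ 2 * (M * M)) by rewrite !mulr_ge0.
lra.
Qed.

Lemma Xi_le s t z : u <= s -> s <= t -> t <= v ->
  `|Xi V x tau Theta s t z| <= c1 * radius p f s t * (`|z| + N).
Proof.
move=> us st tv; set r := radius p f s t; have r0 : 0 <= r by exact: radius_ge0.
have rR : r <= R0 by exact: radius_le_total fc fOm _ _ us st tv.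
have e1 i := le_trans (mx_entry_le (incr x.1 s t) 0 i) (dr_x dr us st tv).
have e2 i := le_trans (mx_entry_le (incr tau.1 s t) 0 i) (dr_h dr us st tv).
have h1 := lincomb_le (mulr_ge0 M0 (normr_ge0 z)) e1
  (fun i => C3_bound1 (VM i) (Theta s) z).
have h2 := lincomb_le M0 e2 (fun i => C3_bound0 (VM i) (Theta s)).
have h3 := Xi2_le z us st tv.
rewrite XiE (le_trans (ler_normD _ _))//.
rewrite (le_trans (lerD (le_trans (ler_normD _ _) (lerD h1 h2)) h3))// -/r -/D.
have zN : 0 <= `|z| + N by rewrite addr_ge0.
have h4 : 2 * D * D * M * M * r ^+ 2 * (`|z| + N) <=
    2 * D * D * M * M * (R0 * r) * (`|z| + N).
  by rewrite ler_wpM2r// ler_wpM2l ?mulr_ge0// expr2 ler_wpM2r.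
rewrite (le_trans (lerD (lexx _) h4))// /c1; lra.
Qed.

(** By [Bfield_E] and symmetry, the subtracted sums are $D^2V_i$ in the direction of the first-order
    part of the increment of [Theta]. What remains is a Taylor error and the controlled remainder of
    [Theta], both quadratic. *)
Lemma Afield_slope i s m z : u <= s -> s <= m -> m <= v ->
  `|Afield V i (Theta m) z - Afield V i (Theta s) z -
    (\sum_j incr x.1 s m 0 j *: Bfield V j i (Theta s) z -
     \sum_j incr x.1 s m 0 j *: Afield V i (Theta s) (Afield V j (Theta s) z))|
  <= M * L * (L + 1) * radius p f s m ^+ 2 * `|z|.
Proof.
move=> us sm mv; set r := radius p f s m; have r0 : 0 <= r by exact: radius_ge0.
have -> : \sum_j incr x.1 s m 0 j *: Bfield V j i (Theta s) z -
    \sum_j incr x.1 s m 0 j *: Afield V i (Theta s) (Afield V j (Theta s) z) =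
    diff2 (V i) (Theta s) (first_order x (fun j => V j (Theta s)) s m) z.
  rewrite -sumrB /diff2 /first_order linear_sum; apply: eq_bigr => j _ /=.
  rewrite -scalerBr linearZ (Bfield_E VM) /Afield addrK; congr (_ *: _).
  exact: (diff2_sym (VM i)).
set fo := first_order _ _ _ _; set dT := incr Theta s m.
have -> : diff2 (V i) (Theta s) fo z =
    diff2 (V i) (Theta s) dT z - diff2 (V i) (Theta s) (dT - fo) z.
  exact: (linear_split ('d (fun y => 'd (V i) y z) (Theta s))).
rewrite opprB addrCA addrC (le_trans (ler_normD _ _))//.
have h1 := C3_taylor1 (VM i) (Theta s) (Theta m) z.
have h2 := C3_bound2 (VM i) (Theta s) (dT - fo) z.
have h3 := dr_T dr us sm mv; have h4 := dr_TR dr us sm mv.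
have h5 : `|dT| ^+ 2 <= (L * r) ^+ 2.
  by rewrite lerXn2r ?nnegrE ?mulr_ge0.
have e1 := le_trans h1 (ler_wpM2r (normr_ge0 z) (ler_wpM2l M0 h5)).
have e2 := le_trans h2 (ler_wpM2r (normr_ge0 z) (ler_wpM2l M0 h4)).
rewrite (le_trans (lerD e1 e2))// -/r.
by apply: ler_eq; ring.
Qed.

Lemma field_slope i s m : u <= s -> s <= m -> m <= v ->
  `|V i (Theta m) - V i (Theta s) -
    \sum_j incr x.1 s m 0 j *: Qfield V j i (Theta s)|
  <= M * L * (L + 1) * radius p f s m ^+ 2.
Proof.
move=> us sm mv; set r := radius p f s m; have r0 : 0 <= r by exact: radius_ge0.
have -> : \sum_j incr x.1 s m 0 j *: Qfield V j i (Theta s) =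
    'd (V i) (Theta s) (first_order x (fun j => V j (Theta s)) s m).
  rewrite /first_order linear_sum; apply: eq_bigr => j _ /=.
  by rewrite linearZ.
set fo := first_order _ _ _ _; set dT := incr Theta s m.
have -> : 'd (V i) (Theta s) fo =
    'd (V i) (Theta s) dT - 'd (V i) (Theta s) (dT - fo).
  exact: (linear_split ('d (V i) (Theta s))).
rewrite opprB addrCA addrC (le_trans (ler_normD _ _))//.
have h1 := C3_taylor0 (VM i) (Theta s) (Theta m).
have h2 := C3_bound1 (VM i) (Theta s) (dT - fo).
have h3 := dr_T dr us sm mv; have h4 := dr_TR dr us sm mv.
have h5 : `|dT| ^+ 2 <= (L * r) ^+ 2.
  by rewrite lerXn2r ?nnegrE ?mulr_ge0.
have e1 := le_trans h1 (ler_wpM2l M0 h5).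
have e2 := le_trans h2 (ler_wpM2l M0 h4).
rewrite (le_trans (lerD e1 e2))// -/r.
by apply: ler_eq; ring.
Qed.

(** The last three sums are the cross terms of Chen's relation for [x] and of its linearised form
    for [tau]. *)
Lemma Xi_split s m t z : u <= s -> s <= m -> m <= t -> t <= v ->
  Xi V x tau Theta s t z = Xi V x tau Theta s m z +
  (\sum_i incr x.1 m t 0 i *: Afield V i (Theta s) z
   + \sum_i incr tau.1 m t 0 i *: V i (Theta s)
   + \sum_j \sum_i x.2 m t j i *: Bfield V j i (Theta s) z
   + \sum_j \sum_i tau.2 m t j i *: Qfield V j i (Theta s)
   + \sum_i incr x.1 m t 0 i *: \sum_j incr x.1 s m 0 j *: Bfield V j i (Theta s) z
   + \sum_i incr tau.1 m t 0 i *: \sum_j incr x.1 s m 0 j *: Qfield V j i (Theta s)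
   + \sum_i incr x.1 m t 0 i *: \sum_j incr tau.1 s m 0 j *: Qfield V j i (Theta s)).
Proof.
move=> us sm mt tv.
have incrE n (h : R -> 'rV[R]_n) : incr h s t = incr h s m + incr h m t.
  by rewrite /incr; zmod.
have x2E : x.2 s t = x.2 s m + x.2 m t + tens (incr x.1 s m) (incr x.1 m t).
  by rewrite -(dr_chen_x dr us sm mt tv) /delta2; zmod.
have k2E : tau.2 s t = tau.2 s m + tau.2 m t + (tens (incr x.1 s m) (incr tau.1 m t)
    + tens (incr tau.1 s m) (incr x.1 m t)).
  by rewrite -(dr_chen_k dr us sm mt tv) /delta2; zmod.
have add1 (h : R -> 'rV[R]_d) (y : 'I_d -> E) : \sum_i incr h s t 0 i *: y i =
    \sum_i incr h s m 0 i *: y i + \sum_i incr h m t 0 i *: y i.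
  by rewrite -big_split; apply: eq_bigr => i _; rewrite incrE mxE scalerDl.
have add2 (b c : 'M[R]_d) (y : 'I_d -> 'I_d -> E) :
    \sum_j \sum_i (b + c) j i *: y j i =
    \sum_j \sum_i b j i *: y j i + \sum_j \sum_i c j i *: y j i.
  rewrite -big_split; apply: eq_bigr => j _; rewrite -big_split.
  by apply: eq_bigr => i _; rewrite mxE scalerDl.
by rewrite /Xi x2E k2E !(add1 x.1) !(add1 tau.1) !add2 !tens_lincomb; zmod.
Qed.

Lemma Xi_addr s t y z : Xi V x tau Theta s t (y + z) = Xi V x tau Theta s t y +
  (\sum_i incr x.1 s t 0 i *: Afield V i (Theta s) z
   + \sum_j \sum_i x.2 s t j i *: Bfield V j i (Theta s) z).
Proof.
rewrite /Xi.
have -> : \sum_i incr x.1 s t 0 i *: Afield V i (Theta s) (y + z) =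
    \sum_i incr x.1 s t 0 i *: Afield V i (Theta s) y +
    \sum_i incr x.1 s t 0 i *: Afield V i (Theta s) z.
  by rewrite -big_split; apply: eq_bigr => i _; rewrite /Afield linearD scalerDr.
have -> : \sum_j \sum_i x.2 s t j i *: Bfield V j i (Theta s) (y + z) =
    \sum_j \sum_i x.2 s t j i *: Bfield V j i (Theta s) y +
    \sum_j \sum_i x.2 s t j i *: Bfield V j i (Theta s) z.
  rewrite -big_split; apply: eq_bigr => j _; rewrite -big_split.
  by apply: eq_bigr => i _; rewrite /Bfield linearD scalerDr.
by zmod.
Qed.

(** The cross terms of [Xi_split] are the first-order effects of moving the base point from
    [Theta s] to [Theta m] and of adding [w] to the state. Once they cancel, only third-order
    remainders are left. *)
Lemma Xi_defect s m t z : u <= s -> s <= m -> m <= t -> t <= v ->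
  `|Xi V x tau Theta m t (z + Xi V x tau Theta s m z) + Xi V x tau Theta s m z
    - Xi V x tau Theta s t z| <=
  (D * M * L * (L + 1) + 4 * D * D * M * M * L +
   D * (M * L * c1 + 2 * D * D * M * M * M) + 2 * D * D * M * M * c1) *
  radius p f s t ^+ 3 * (`|z| + N).
Proof.
move=> us sm mt tv; have mv := le_trans mt tv; have um := le_trans us sm.
have st := le_trans sm mt.
set r := radius p f s t; have r0 : 0 <= r by exact: radius_ge0.
have rsm : radius p f s m <= r by apply: (radius_le_sub p0 fc us).
have rmt : radius p f m t <= r by apply: (radius_le_sub p0 fc us).
have rsm2 : radius p f s m ^+ 2 <= r ^+ 2 by rewrite lerXn2r ?nnegrE ?radius_ge0.
have rmt2 : radius p f m t ^+ 2 <= r ^+ 2 by rewrite lerXn2r ?nnegrE ?radius_ge0.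
set zN := `|z| + N; have zN0 : 0 <= zN by rewrite addr_ge0.
have zzN : `|z| <= zN by rewrite lerDl.
set w := Xi V x tau Theta s m z.
have wb : `|w| <= c1 * r * zN.
  by rewrite (le_trans (Xi_le z us sm mv))// ler_wpM2r// ler_wpM2l.
have Xi_split := Xi_split z us sm mt tv.
set x1 := incr x.1 s m; set x2 := incr x.1 m t; set h1 := incr tau.1 s m.
set h2 := incr tau.1 m t; set X2 := x.2 m t; set k2 := tau.2 m t.
set w2 := Xi2 x tau Theta s m z.
have w2b : `|w2| <= 2 * D * D * M * M * r ^+ 2 * zN.
  rewrite (le_trans (Xi2_le z us sm mv))// ler_wpM2r// ler_wpM2l//.
  by rewrite !mulr_ge0.
pose a i th y := Afield V i th y.
(* In [S1], [S2] and [S5] a first level multiplies a quadratic remainder; in [S3], [S4] and [S6] a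
   second level multiplies a first-order change, of the base point or of the state. *)
pose S1 := \sum_i x2 0 i *: (a i (Theta m) z - a i (Theta s) z -
  (\sum_j x1 0 j *: Bfield V j i (Theta s) z -
   \sum_j x1 0 j *: a i (Theta s) (a j (Theta s) z))).
pose S2 := \sum_i h2 0 i *: (V i (Theta m) - V i (Theta s) -
  \sum_j x1 0 j *: Qfield V j i (Theta s)).
pose S3 := \sum_j \sum_i X2 j i *: (Bfield V j i (Theta m) z - Bfield V j i (Theta s) z).
pose S4 := \sum_j \sum_i k2 j i *: (Qfield V j i (Theta m) - Qfield V j i (Theta s)).
pose S5 := \sum_i x2 0 i *: (a i (Theta m) w - (\sum_j x1 0 j *: a i (Theta s) (a j (Theta s) z)
  + \sum_j h1 0 j *: Qfield V j i (Theta s))).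
pose S6 := \sum_j \sum_i X2 j i *: Bfield V j i (Theta m) w.
have -> : Xi V x tau Theta m t (z + w) + w - Xi V x tau Theta s t z =
    S1 + S2 + S3 + S4 + S5 + S6.
  rewrite Xi_split Xi_addr -/w /Xi /S1 /S2 /S3 /S4 /S5 /S6.
  under [X in _ = X + _ + _ + _ + _ + _]eq_bigr do rewrite !scalerBr.
  under [X in _ = _ + X + _ + _ + _ + _]eq_bigr do rewrite !scalerBr.
  under [X in _ = _ + _ + _ + _ + X + _]eq_bigr do rewrite scalerBr scalerDr.
  rewrite !sumrB !big_split /=.
  have sub2 (c : 'M[R]_d) (y y' : 'I_d -> 'I_d -> E) :
      \sum_j \sum_i c j i *: (y j i - y' j i) =
      \sum_j \sum_i c j i *: y j i - \sum_j \sum_i c j i *: y' j i.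
    rewrite -sumrB; apply: eq_bigr => j _; rewrite -sumrB.
    by apply: eq_bigr => i _; rewrite scalerBr.
  by rewrite !sub2; zmod.
have x2b i : `|x2 0 i| <= r.
  by rewrite (le_trans (mx_entry_le _ _ _))// (le_trans (dr_x dr um mt tv)).
have h2b i : `|h2 0 i| <= N * r.
  by rewrite (le_trans (mx_entry_le _ _ _))// (le_trans (dr_h dr um mt tv))// ler_wpM2l.
have X2b : `|X2| <= r ^+ 2 by rewrite (le_trans (dr_xx dr um mt tv)).
have k2b : `|k2| <= N * r ^+ 2 by rewrite (le_trans (dr_k dr um mt tv))// ler_wpM2l.
have Tsm : `|Theta m - Theta s| <= L * r.
  by rewrite (le_trans (dr_T dr us sm mv))// ler_wpM2l.
have ML0 : 0 <= M * L * (L + 1) by rewrite !mulr_ge0// addr_ge0.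
have b1 : `|S1| <= D * (r * (M * L * (L + 1) * r ^+ 2 * `|z|)).
  apply: lincomb_le => // [|i]; first by rewrite !mulr_ge0 ?addr_ge0.
  by rewrite (le_trans (Afield_slope _ _ us sm mv))// ler_wpM2r// ler_wpM2l.
have b2 : `|S2| <= D * (N * r * (M * L * (L + 1) * r ^+ 2)).
  apply: lincomb_le => // [|i]; first by rewrite !mulr_ge0 ?addr_ge0.
  by rewrite (le_trans (field_slope _ us sm mv))// ler_wpM2l.
have b3 : `|S3| <= D * D * (r ^+ 2 * (4 * M * M * (L * r) * `|z|)).
  apply: lincomb2_le => // [|j i]; first by rewrite !mulr_ge0.
  rewrite (le_trans (Bfield_lip VM _ _ _ _ _))// ler_wpM2r//.
  by rewrite ler_wpM2l ?mulr_ge0.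
have b4 : `|S4| <= D * D * (N * r ^+ 2 * (4 * M * M * (L * r))).
  apply: lincomb2_le => // [|j i]; first by rewrite !mulr_ge0.
  rewrite (le_trans (Qfield_lip VM _ _ _ _))//.
  apply: ler_pM; rewrite ?mulr_ge0// !ler_wpM2r//; lra.
have b5 : `|S5| <= D * (r * ((M * L * c1 + 2 * D * D * M * M * M) * r ^+ 2 * zN)).
  apply: lincomb_le => // [|i].
    by rewrite !mulr_ge0 ?addr_ge0 ?mulr_ge0.
  have -> : a i (Theta m) w - (\sum_j x1 0 j *: a i (Theta s) (a j (Theta s) z) +
      \sum_j h1 0 j *: Qfield V j i (Theta s)) =
      (a i (Theta m) w - a i (Theta s) w) + a i (Theta s) w2.
    rewrite [X in _ = _ - X + _](_ : _ = (\sum_j x1 0 j *: a i (Theta s) (a j (Theta s) z) +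
      \sum_j h1 0 j *: Qfield V j i (Theta s)) + a i (Theta s) w2); last first.
      rewrite {1}/w XiE /a /Afield linearD linearD /= !linear_sum /=; congr (_ + _).
      by congr (_ + _); apply: eq_bigr => j _; rewrite linearZ.
    by zmod.
  rewrite (le_trans (ler_normD _ _))//.
  have g1 := le_trans (C3_lip1 (VM i) (Theta s) (Theta m) w)
    (ler_pM (mulr_ge0 M0 (normr_ge0 _)) (normr_ge0 _) (ler_wpM2l M0 Tsm) wb).
  have g2 := le_trans (C3_bound1 (VM i) (Theta s) w2) (ler_wpM2l M0 w2b).
  rewrite (le_trans (lerD g1 g2))//.
  by apply: ler_eq; ring.
have b6 : `|S6| <= D * D * (r ^+ 2 * (2 * M * M * (c1 * r * zN))).
  apply: lincomb2_le => // [|j i]; first by rewrite !mulr_ge0.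
  by rewrite (le_trans (Bfield_le VM _ _ _ _))// ler_wpM2l ?mulr_ge0.
rewrite (le_trans (ler_normD _ _))//.
rewrite (le_trans (lerD (le_trans (ler_normD _ _) (lerD (le_trans (ler_normD _ _) (lerD
  (le_trans (ler_normD _ _) (lerD (le_trans (ler_normD _ _) (lerD b1 b2)) b3)) b4)) b5)) b6))//.
by apply: ler_eq; rewrite /zN; ring.
Qed.

End Estimates.
End TangentGerm.

(** * Completeness of bounded continuous functions *)

Section BoundedContinuousComplete.
Context {R : realType}.

(** Pointwise limits exist by completeness of [W]. The Cauchy property in the sup norm makes the
    convergence uniform, which preserves continuity and boundedness. *)
Lemma bcont_seq_complete (W : normedModType R) :
  seq_complete W -> seq_complete (bcont R W).
Proof.
move=> Wc y yC.
have yCx z : forall eps : R, 0 < eps -> exists N, forall m n, (N <= m)%N -> (N <= n)%N ->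
    `|y m z - y n z| < eps.
  move=> e /yC[N HN]; exists N => m n Nm Nn; apply: le_lt_trans (HN m n Nm Nn).
  exact: (sup_norm_ge (y m - y n) z).
have /choice[l Hl] := fun z => Wc (fun n => y n z) (yCx z).
have unif eps : 0 < eps -> exists N, forall n, (N <= n)%N -> forall z,
    `|y n z - l z| <= eps.
  move=> e0; have [N HN] := yC eps e0; exists N => n Nn z.
  apply/ler_addgt0Pr => e' e'0; have [N' HN'] := Hl z e' e'0.
  rewrite -(subrKA (y (maxn N N') z)) (le_trans (ler_normD _ _))// lerD//.
    rewrite (le_trans (sup_norm_ge (y n - y (maxn N N')) z))// ltW//.
    by apply: HN => //; exact: leq_maxl.
  by rewrite ltW// HN'// leq_maxr.
have yc n : continuous (y n) by case: (y n) => f /= /asboolP[].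
have lb : l \in bcont_pred.
  apply/asboolP; split.
    move=> z; apply/cvgrPdistC_le => e e0; have e3 : 0 < e / 3 by rewrite divr_gt0.
    have [N HN] := unif _ e3; have /cvgrPdistC_le/(_ _ e3) := yc N z.
    apply: filterS => z' h; have h1 := HN N (leqnn N) z; have h2 := HN N (leqnn N) z'.
    have -> : l z' - l z = (l z' - y N z') + ((y N z' - y N z) + (y N z - l z)).
      by rewrite !subrKA.
    rewrite (le_trans (ler_normD _ _))//.
    have := ler_normD (y N z' - y N z) (y N z - l z); rewrite distrC in h2.
    by move: h1 h2 h; lra.
  have [N HN] := unif 1 ltr01; exists (1 + sup_norm (y N)) => z.
  rewrite -[l z](subrK (y N z)) (le_trans (ler_normD _ _))// lerD ?sup_norm_ge//.
  by rewrite distrC HN.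
exists (BCont lb) => e e0; have e2 : 0 < e / 2 by rewrite divr_gt0.
have [N HN] := unif _ e2; exists N => n Nn.
apply: (@le_lt_trans _ _ (e / 2)); last by rewrite ltr_pdivrMr// ltr_pMr// ltr1n.
by apply: sup_norm_le => z; exact: HN.
Qed.

End BoundedContinuousComplete.

(** * Passing between controls and additive controls *)

Section ContinuousControls.
Context {R : realType}.

Lemma additive_control_is_control (u v : R) f :
  additive_control u v f -> is_control u v (fun s t => f t - f s).
Proof.
move=> [mf cf]; split.
- apply/within_continuousP => -[s t] [/= us st tv] e e0.
  have e2 : 0 < e / 2 by rewrite divr_gt0.
  have [d d0 fd] := cf _ e2; exists d => // -[s' t'] [/= us' st' tv'] [].
  rewrite -!ball_normE /= => h1 h2.
  have near a b : u <= a -> a <= v -> u <= b -> b <= v -> `|a - b| < d ->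
      `|f a - f b| < e / 2.
    move=> ua av ub bv; have [ab|ba] := leP a b.
      rewrite ler0_norm ?subr_le0// opprB => ab'; rewrite distrC ger0_norm ?subr_ge0 ?mf//.
      exact: fd.
    rewrite gtr0_norm ?subr_gt0// => ab'; rewrite ger0_norm ?subr_ge0 ?mf ?(ltW ba)//.
    by apply: fd => //; exact: ltW.
  have g1 := near s s' us (le_trans st tv) us' (le_trans st' tv') h1.
  have g2 := near t t' (le_trans us st) tv (le_trans us' st') tv' h2.
  have -> : f t' - f s' - (f t - f s) = (f s - f s') - (f t - f t') by ring.
  by rewrite (le_lt_trans (ler_normB _ _))// (splitr e) ltrD.
- by move=> s t us st tv; rewrite subr_ge0 mf.
- by move=> t _; rewrite subrr.
- by move=> s m t us sm mt tv; rewrite addrC subrKA.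
Qed.

(** Superadditivity says $w(s,t) \le w(u,t) - w(u,s)$, so [w u] dominates. *)
Lemma is_control_additive (u v : R) w : u <= v -> is_control u v w ->
  exists2 g, additive_control u v g &
    forall s t, u <= s -> s <= t -> t <= v -> 0 <= w s t <= g t - g s.
Proof.
move=> uv [/within_continuousP wc w0 wd wa]; exists (w u); last first.
  move=> s t us st tv; rewrite w0//=.
  by have := wa u s t (lexx u) us st tv; lra.
have mono s t : u <= s -> s <= t -> t <= v -> w u s <= w u t.
  move=> us st tv; have := wa u s t (lexx u) us st tv.
  by have := w0 s t us st tv; lra.
split=> // e e0; have e2 : 0 < e / 2 by rewrite divr_gt0.
have [|d d0 H] := @segment_uniform R u v (fun d x => forall s, x <= s -> s <= v ->
    s - x < d -> w u s - w u x < e).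
  move=> x /andP[ux xv].
  have sx : simplex u v (u, x) by [].
  have [eta eta0 He] := wc (u, x) sx _ e2.
  have near y : u <= y -> y <= v -> `|y - x| < eta -> `|w u y - w u x| < e / 2.
    move=> uy yv yx; apply: (He (u, y)); first by split.
    split; first exact: ballxx.
    by rewrite -ball_normE /= distrC.
  exists (eta / 2) => [|d y d0 de /andP[uy yv] yx s ys sv sy]; first by rewrite divr_gt0.
  have h1 := near y uy yv; have h2 := near s (le_trans uy ys) sv.
  have /h1 : `|y - x| < eta by lra.
  have /h2 : `|s - x| < eta.
    rewrite -(subrKA y) (le_lt_trans (ler_normD _ _))//.
    by rewrite [`|s - y|]ger0_norm ?subr_ge0//; lra.
  by rewrite !ltr_norml => /andP[_ ?] /andP[? _]; lra.
exists d => // s t us st tv td; apply: H => //; rewrite us; exact: le_trans tv.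
Qed.

Lemma within_comp {T T' : pseudoMetricType R} {F : normedModType R}
    (A : set T) (B : set T') (g : T -> F) (phi : T' -> T) :
  continuous phi -> (forall z, B z -> A (phi z)) -> {within A, continuous g} ->
  {within B, continuous (fun z => g (phi z))}.
Proof.
move=> phic BA /within_continuousP gc; apply/within_continuousP => z Bz e e0.
have [d d0 H] := gc _ (BA z Bz) e e0.
have := phic z (ball (phi z) d) (nbhsx_ballx _ _ d0).
move=> /nbhs_ballP[d' d'0 H']; exists d' => // y By zy.
by apply: H; [exact: BA|exact: H'].
Qed.

Lemma within_sum {T : pseudoMetricType R} {F : normedModType R} (A : set T) n
    (g : 'I_n -> T -> F) : (forall i, {within A, continuous (g i)}) ->
  {within A, continuous (fun z => \sum_i g i z)}.
Proof.
move=> gc; elim: (index_enum _) => [|i r IH].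
  rewrite (_ : (fun z => _) = fun=> 0); last by apply/funext => z; rewrite big_nil.
  by move=> z; exact: cvg_cst.
rewrite (_ : (fun z => _) = fun z => g i z + \sum_(j <- r) g j z); last first.
  by apply/funext => z; rewrite big_cons.
by move=> z; apply: cvgD; [exact: gc|exact: IH].
Qed.

Lemma within_entry {T : pseudoMetricType R} (A : set T) m n (g : T -> 'M[R]_(m, n)) i j :
  {within A, continuous g} -> {within A, continuous (fun z => g z i j)}.
Proof.
move=> /within_continuousP gc; apply/within_continuousP => z Az e e0.
have [d d0 H] := gc z Az e e0; exists d => // y Ay zy.
have := H y Ay zy; apply: le_lt_trans.
have := mx_entry_le (g y - g z) i j; by rewrite !mxE.
Qed.

Lemma within_incr {F : normedModType R} (u v : R) (h : R -> F) :
  {within `[u, v], continuous h} ->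
  {within simplex u v, continuous (fun z : R * R => incr h z.1 z.2)}.
Proof.
move=> hc z; apply: cvgB.
  apply: (within_comp (A := `[u, v]%classic) (phi := snd) _ _ hc).
    by move=> y; exact: cvg_snd.
  by move=> [a b] [/= ua ab bv]; rewrite in_itv/= bv (le_trans ua).
apply: (within_comp (A := `[u, v]%classic) (phi := fst) _ _ hc).
  by move=> y; exact: cvg_fst.
by move=> [a b] [/= ua ab bv]; rewrite in_itv/= ua (le_trans ab).
Qed.

Lemma within_fst {F : normedModType R} (u v : R) (h : R -> F) :
  {within `[u, v], continuous h} ->
  {within simplex u v, continuous (fun z : R * R => h z.1)}.
Proof.
apply: within_comp => [y|[a b] [/= ua ab bv]]; first exact: cvg_fst.
by rewrite in_itv/= ua (le_trans ab).
Qed.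

Lemma within_first_order {F : normedModType R} n (u v : R) (x : two_level R n)
    (c : 'I_n -> R -> F) : {within `[u, v], continuous x.1} ->
  (forall i, {within `[u, v], continuous (c i)}) ->
  {within simplex u v, continuous
    (fun z : R * R => first_order x (fun i => c i z.1) z.1 z.2)}.
Proof.
move=> xc cc; apply: within_sum => i z; apply: cvgZ.
  have h := within_entry (i := 0) (j := i) (within_incr xc); exact: (h z).
have h := within_fst (cc i); exact: (h z).
Qed.

Lemma within_comp_continuous {T : pseudoMetricType R} {F G : normedModType R}
    (A : set T) (g : T -> F) (phi : F -> G) :
  continuous phi -> {within A, continuous g} ->
  {within A, continuous (fun z => phi (g z))}.
Proof. by move=> phic gc z; apply: continuous_comp; [exact: gc|exact: phic]. Qed.

Lemma within_subset {T : pseudoMetricType R} {F : normedModType R} (A B : set T)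
    (g : T -> F) : B `<=` A -> {within A, continuous g} -> {within B, continuous g}.
Proof. exact: continuous_subspaceW. Qed.

Lemma within_bounded {F : normedModType R} (u v : R) (P : R -> F) : u <= v ->
  {within `[u, v], continuous P} ->
  exists2 B, 0 <= B & forall t, u <= t -> t <= v -> `|P t| <= B.
Proof.
move=> uv Pc; have [|c _ Hc] := @EVT_max R (fun t => `|P t|) u v uv.
  by move=> z; apply: cvg_norm; exact: Pc.
exists `|P c| => // t ut tv; apply: Hc; by rewrite in_itv/= ut.
Qed.

Lemma additive_control_continuous {F : normedModType R} (p u v c : R) f (P : R -> F) :
  0 < p -> 0 <= c -> additive_control u v f ->
  (forall s t, u <= s -> s <= t -> t <= v -> `|P t - P s| <= c * radius p f s t) ->
  {within `[u, v], continuous P}.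
Proof.
move=> p0 c0 [mf cf] Pf; apply/within_continuousP => t; rewrite /= in_itv/= => /andP[ut tv].
move=> e e0; have e1 : 0 < (e / (c + 1)) `^ p by rewrite powR_gt0// divr_gt0// ltr_wpDl.
have [d d0 fd] := cf _ e1; exists d => // s; rewrite in_itv/= => /andP[us sv].
rewrite -ball_normE /=.
have key a b : u <= a -> a <= b -> b <= v -> b - a < d -> `|P b - P a| < e.
  move=> ua ab bv bad; apply: le_lt_trans (Pf a b ua ab bv) _.
  have fab : 0 <= f b - f a by rewrite subr_ge0 mf.
  have : radius p f a b <= e / (c + 1).
    rewrite -[leRHS](@powRVK _ p)//; last by rewrite divr_ge0 ?ltW// ltr_wpDl.
    apply: ge0_ler_powR; rewrite ?nnegrE ?invr_ge0 ?(ltW p0) ?powR_ge0//.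
    by rewrite ltW// fd.
  move=> rle; have c1 : 0 < c + 1 by rewrite ltr_wpDl.
  apply: (@le_lt_trans _ _ (c * (e / (c + 1)))); first by rewrite ler_wpM2l.
  by rewrite mulrA ltr_pdivrMr// mulrC ltr_pM2l//; lra.
have [st|ts] := leP s t.
  rewrite ger0_norm ?subr_ge0// => h; rewrite distrC; exact: key.
rewrite ltr0_norm ?subr_lt0// opprB => h; apply: key => //; exact: ltW.
Qed.

End ContinuousControls.

(** * One control for the base path, its solution and the tangent *)

Section DrivenPaths.
Context {R : realType} {E : normedModType R} {d : nat} (V : 'I_d -> E -> E).
Context (M p T u v : R).
Context (VM : forall i, C3_bounded M (V i)) (M0 : 0 <= M) (p23 : 2 < p < 3)
  (u0 : 0 <= u) (uv : u <= v) (vT : v <= T).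
Implicit Types (x tau : two_level R d) (Theta : R -> E).

Lemma driven_scale N L f x tau Theta (c : R) :
  driven V p u v N L f x tau Theta ->
  driven V p u v (`|c| * N) L f x (c *: tau) Theta.
Proof.
have incrZ s t : incr (c *: tau).1 s t = c *: incr tau.1 s t.
  by rewrite /incr scalerBr.
move=> dr; split; try (by case: dr).
- move=> s t us st tv; rewrite incrZ normrZ -mulrA ler_wpM2l//; exact: (dr_h dr).
- move=> s t us st tv; rewrite normrZ -mulrA ler_wpM2l//; exact: (dr_k dr).
move=> s m t us sm mt tv; rewrite !incrZ.
have := dr_chen_k dr us sm mt tv; rewrite /delta2 => e.
rewrite (_ : _ - _ = c *: (tau.2 s t - tau.2 s m - tau.2 m t)); last first.
  by rewrite !scalerBr.
by rewrite e scalerDr /tens -scalemxAr [(c *: _)^T]linearZ /= -scalemxAl.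
Qed.

Let p0 : 0 < p. Proof. by case/andP: p23 => h _; lra. Qed.

Let half_root f s t : (f t - f s) `^ (p / 2)^-1 = radius p f s t ^+ 2.
Proof. by rewrite radius_sqr// invf_div. Qed.

Lemma sqr_le_radius f g s t s' t' : 0 <= f t - f s -> f t - f s <= g t' - g s' ->
  radius p f s t ^+ 2 <= radius p g s' t' ^+ 2.
Proof. by move=> f0 fg; rewrite lerXn2r ?nnegrE ?radius_ge0// le_radius. Qed.

(** The control adds up those of both levels of [x], of the remainder of [Theta] and of both levels
    of [tau]. [L] and [Om] are fixed before [tau]. *)
Lemma rde_driven x Theta : 0 <= T -> WGOmega p T x -> rde_solution p V x Theta u v ->
  exists L Om, 0 <= L /\ forall tau N, tangent p T x tau -> 0 < N ->
    (tangent_norm p T tau <= N%:E)%E -> exists f,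
    [/\ additive_control u v f, f v - f u <= Om & driven V p u v N L f x tau Theta].
Proof.
move=> T0 [[xc x0 xfin] [xxc xx0 xxfin] xchen _] [Tc Tv [Tf TRfin] _].
have q0 : 0 < p / 2 by rewrite divr_gt0.
have subT : `[u, v]%classic `<=` `[0, T]%classic.
  by move=> t /=; rewrite !in_itv/= => /andP[ut tv]; rewrite (le_trans u0)// (le_trans tv).
have [fx [fxc fxb _]] := var2_control p0 T0 (within_incr xc)
  (fun t _ _ => subrr _) xfin.
have [fxx [fxxc fxxb _]] := var2_control q0 T0 xxc
  (fun t h1 h2 => xx0 t (introT andP (conj h1 h2))) xxfin.
have TRc : {within simplex u v, continuous (fun z : R * R =>
    incr Theta z.1 z.2 - first_order x ((fun i t => V i (Theta t))^~ z.1) z.1 z.2)}.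
  move=> z; apply: cvgB; first by have h := within_incr Tc; exact: (h z).
  apply: (@within_first_order _ _ _ u v x (fun i t => V i (Theta t))).
    exact: within_subset subT xc.
  move=> i; apply: within_comp_continuous Tc => th.
  exact: differentiable_continuous (C3_diff0 (VM i) th).
have TR0 t : u <= t -> t <= v ->
    incr Theta t t - first_order x ((fun i t => V i (Theta t))^~ t) t t = 0.
  move=> _ _; rewrite /incr subrr /first_order big1 ?subr0// => i _.
  by rewrite /incr subrr mxE scale0r.
have [fT [fTc fTb _]] := var2_control q0 uv TRc TR0 TRfin.
pose f0 t := fx t + fxx t + fT t.
have fxc' := additive_controlW u0 vT fxc; have fxxc' := additive_controlW u0 vT fxxc.
have f0c : additive_control u v f0.
  by apply: additive_controlD fTc; exact: additive_controlD.
(* The [2] makes room for the two levels of [tau], each contributing mass at most one after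
   normalisation. *)
pose R0 := `|f0 v - f0 u + 2| `^ p^-1.
(* [d%:R * M] bounds the first-order part of [Theta], [R0] the quadratic remainder seen as a
   first-order quantity; the [1] ensures [1 <= L]. *)
pose L := 1 + d%:R * M + R0.
have R00 : 0 <= R0 by exact: powR_ge0.
have L1 : 1 <= L by rewrite /L -addrA lerDl addr_ge0// mulr_ge0.
exists L, (f0 v - f0 u + 2); split; first by rewrite (le_trans ler01).
move=> tau N [[hc h0 hfin] [kc k0 kfin] kchen _] N0 tN.
have hN : (var1 p tau.1 0 T <= N%:E)%E.
  by apply: le_trans tN; rewrite leeDl// poweR_ge0.
have kN : (var2 (p / 2) tau.2 0 T <= N%:E)%E.
  by apply: le_trans tN; rewrite leeDr// poweR_ge0.
have [fh [fhc fhb fhN]] := var2_control p0 T0 (within_incr hc)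
  (fun t _ _ => subrr _) hfin.
have [fk [fkc fkb fkN]] := var2_control q0 T0 kc
  (fun t h1 h2 => k0 t (introT andP (conj h1 h2))) kfin.
have {}fhN := fhN N (ltW N0) hN; have {}fkN := fkN N (ltW N0) kN.
have fhc' := additive_controlW u0 vT fhc; have fkc' := additive_controlW u0 vT fkc.
(* Normalising [tau] by [N] keeps the total mass of the control independent of
   [tau]. *)
pose a := (N `^ p)^-1; pose b := (N `^ (p / 2))^-1.
have a0 : 0 < a by rewrite invr_gt0 powR_gt0.
have b0 : 0 < b by rewrite invr_gt0 powR_gt0.
pose f t := f0 t + (a * fh t + b * fk t).
have fc : additive_control u v f.
  apply: additive_controlD f0c _; apply: additive_controlD.
    by apply: additive_controlZ => //; exact: ltW.
  by apply: additive_controlZ => //; exact: ltW.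
have part s t : u <= s -> s <= t -> t <= v -> [/\
    [/\ 0 <= fx t - fx s, 0 <= fxx t - fxx s & 0 <= fT t - fT s],
    0 <= a * (fh t - fh s), 0 <= b * (fk t - fk s) &
    f t - f s = (fx t - fx s) + (fxx t - fxx s) + (fT t - fT s) +
      (a * (fh t - fh s) + b * (fk t - fk s))].
  move=> us st tv; case: fxc' => mx _; case: fxxc' => mxx _; case: fTc => mT _.
  case: fhc' => mh _; case: fkc' => mk _.
  split; [split; rewrite subr_ge0| | |rewrite /f /f0; ring].
  - exact: mx. - exact: mxx. - exact: mT.
  - by rewrite mulr_ge0 ?(ltW a0)// subr_ge0 mh.
  - by rewrite mulr_ge0 ?(ltW b0)// subr_ge0 mk.
have fOm : f v - f u <= f0 v - f0 u + 2.
  have [_ _ _ ->] := part u v (lexx u) uv (lexx v); rewrite /f0.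
  have mono g : additive_control 0 T g -> g v - g u <= g T - g 0.
    by move=> [mg _]; apply: lerB; apply: mg => //; [exact: le_trans u0 uv|exact: le_trans uv vT].
  have h1 : a * (fh v - fh u) <= 1.
    rewrite /a mulrC ler_pdivrMr ?powR_gt0// mul1r.
    exact: le_trans (mono _ fhc) fhN.
  have h2 : b * (fk v - fk u) <= 1.
    rewrite /b mulrC ler_pdivrMr ?powR_gt0// mul1r.
    exact: le_trans (mono _ fkc) fkN.
  lra.
have w0T s t : u <= s -> s <= t -> t <= v -> [/\ 0 <= s, s <= t & t <= T].
  by move=> us st tv; rewrite (le_trans u0)// (le_trans tv).
have bx s t : u <= s -> s <= t -> t <= v -> `|incr x.1 s t| <= radius p f s t.
  move=> us st tv; have [s0 _ tT] := w0T s t us st tv.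
  have [[? ? ?] ? ? fE] := part s t us st tv.
  apply: le_trans (fxb s t s0 st tT) _; apply: le_radius => //; lra.
have bTR s t : u <= s -> s <= t -> t <= v ->
    `|incr Theta s t - first_order x (fun i => V i (Theta s)) s t|
      <= radius p f s t ^+ 2.
  move=> us st tv; have [[? ? ?] ? ? fE] := part s t us st tv.
  apply: le_trans (fTb s t us st tv) _; rewrite half_root; apply: sqr_le_radius => //; lra.
exists f; split=> //; split=> //.
- move=> s t us st tv; have [s0 _ tT] := w0T s t us st tv.
  have [[? ? ?] ? ? fE] := part s t us st tv.
  apply: le_trans (fxxb s t s0 st tT) _; rewrite half_root.
  by apply: sqr_le_radius => //; lra.
- move=> s t us st tv; have [s0 _ tT] := w0T s t us st tv.
  have [[? ? ?] hs ? fE] := part s t us st tv.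
  apply: le_trans (fhb s t s0 st tT) _.
  have fh0 : 0 <= fh t - fh s by rewrite -(pmulr_rge0 _ a0).
  have fhE : fh t - fh s = N `^ p * (a * (fh t - fh s)).
    by rewrite mulrA mulfV ?gt_eqF ?powR_gt0// mul1r.
  rewrite [in leLHS]fhE powRM ?powR_ge0// powRVK ?(ltW N0)//.
  rewrite ler_wpM2l ?(ltW N0)// /radius.
  apply: ge0_ler_powR; rewrite ?nnegrE ?invr_ge0 ?(ltW p0)//; lra.
- move=> s t us st tv; have [s0 _ tT] := w0T s t us st tv.
  have [[? ? ?] ? ks fE] := part s t us st tv.
  apply: le_trans (fkb s t s0 st tT) _.
  have fkE : fk t - fk s = N `^ (p / 2) * (b * (fk t - fk s)).
    by rewrite mulrA mulfV ?gt_eqF ?powR_gt0// mul1r.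
  rewrite [in leLHS]fkE powRM ?powR_ge0// powRVK ?(ltW N0)//.
  rewrite ler_wpM2l ?(ltW N0)// -half_root.
  apply: ge0_ler_powR; rewrite ?nnegrE ?invr_ge0 ?(ltW q0)//; lra.
- move=> s t us st tv; have [[? ? ?] ? ? fE] := part s t us st tv.
  have rR : radius p f s t <= R0 by exact: radius_le_total p0 fc fOm _ _ us st tv.
  have r0 : 0 <= radius p f s t by exact: radius_ge0.
  rewrite -[incr Theta s t](subrK (first_order x (fun i => V i (Theta s)) s t)).
  have h1 := lincomb_le M0 (fun i => le_trans (mx_entry_le (incr x.1 s t) 0 i)
    (bx s t us st tv)) (fun i => C3_bound0 (VM i) (Theta s)).
  rewrite (le_trans (ler_normD _ _))// (le_trans (lerD (bTR s t us st tv) h1))//.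
  have h2 : radius p f s t ^+ 2 <= R0 * radius p f s t.
    by rewrite expr2 ler_wpM2r.
  by rewrite /L; lra.
- move=> s t us st tv; apply: le_trans (bTR s t us st tv) _.
  by rewrite ler_peMl// sqr_ge0.
- by move=> s m t us sm mt tv; apply: xchen => //;
    [exact: le_trans us|exact: le_trans tv vT].
- by move=> s m t us sm mt tv; apply: kchen => //;
    [exact: le_trans us|exact: le_trans tv vT].
Qed.

End DrivenPaths.

(** * The linear equation with an adjoined constant coordinate *)

Section TangentFlow.
Context {R : realType} {E : normedModType R} {d : nat} (V : 'I_d -> E -> E).
Context (M : R) (VM : forall i, C3_bounded M (V i)) (M0 : 0 <= M).
Implicit Types (x tau : two_level R d) (Theta P : R -> E).

Lemma Xi_bounds (p L Om : R) : 0 < p -> 0 <= L -> exists c C, [/\ 0 <= c, 0 <= C &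
  forall u v N f x tau Theta, 0 <= N -> additive_control u v f -> f v - f u <= Om ->
    driven V p u v N L f x tau Theta ->
    [/\ forall s t z, u <= s -> s <= t -> t <= v ->
          `|Xi V x tau Theta s t z| <= c * radius p f s t * (`|z| + N),
        forall s t z, u <= s -> s <= t -> t <= v ->
          `|Xi2 V x tau Theta s t z| <= c * radius p f s t ^+ 2 * (`|z| + N)
      & forall s m t z, u <= s -> s <= m -> m <= t -> t <= v ->
          `|Xi V x tau Theta m t (z + Xi V x tau Theta s m z)
            + Xi V x tau Theta s m z - Xi V x tau Theta s t z|
          <= C * radius p f s t ^+ 3 * (`|z| + N)]].
Proof.
move=> p0 L0; pose D : R := d%:R; pose R0 := `|Om| `^ p^-1.
have D0 : 0 <= D by exact: ler0n.
have R00 : 0 <= R0 by exact: powR_ge0.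
pose c1 := D * M + 2 * D * D * M * M * R0.
have c10 : 0 <= c1 by rewrite addr_ge0// !mulr_ge0.
have c20 : 0 <= 2 * D * D * M * M by rewrite !mulr_ge0.
pose C := D * M * L * (L + 1) + 4 * D * D * M * M * L +
  D * (M * L * c1 + 2 * D * D * M * M * M) + 2 * D * D * M * M * c1.
exists (c1 + 2 * D * D * M * M), C; split.
- exact: addr_ge0.
- by rewrite /C !addr_ge0 ?mulr_ge0 ?addr_ge0 ?mulr_ge0.
move=> u v N f x tau Theta N0 fc fOm dr.
have zN0 z : 0 <= `|z : E| + N by rewrite addr_ge0.
split.
- move=> s t z us st tv; apply: le_trans (Xi_le VM M0 p0 N0 fc fOm dr z us st tv) _.
  by rewrite ler_wpM2r// ler_wpM2r ?radius_ge0// lerDl.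
- move=> s t z us st tv; apply: le_trans (Xi2_le VM M0 N0 dr z us st tv) _.
  by rewrite ler_wpM2r// ler_wpM2r ?sqr_ge0// lerDr.
- move=> s m t z us sm mt tv.
  exact: (Xi_defect VM M0 p0 N0 L0 fc fOm dr z us sm mt tv).
Qed.

(** The second coordinate weights the tangent: [z.2 = N] gives [tau] and [z.2 = 0] the homogeneous
    equation. Thanks to the division by [N], the tangent at weight [l] has size [|l|], so the
    constants of the generator do not involve [N]. *)
Definition pair_germ x tau N Theta s t (z : E * R^o) : (E * R^o)%type :=
  (Xi V x ((z.2 / N) *: tau) Theta s t z.1, 0).

Lemma XiB x tau tau' Theta s t z z' : Xi V x (tau - tau') Theta s t (z - z') =
  Xi V x tau Theta s t z - Xi V x tau' Theta s t z'.
Proof.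
have := Xi_linear V x tau' tau Theta s t (-1) z' z.
by rewrite !scaleN1r [- tau' + tau]addrC [- z' + z]addrC [RHS]addrC.
Qed.

Lemma pair_germ_generator (p L Om : R) : 0 < p -> 0 <= L ->
  exists c C, [/\ 0 <= c, 0 <= C &
  forall u v N f x tau Theta, 0 < N -> additive_control u v f -> f v - f u <= Om ->
    driven V p u v N L f x tau Theta ->
    rough_generator p c C u v f (pair_germ x tau N Theta)].
Proof.
move=> p0 L0; have [c [C [c0 C0 H]]] := Xi_bounds Om p0 L0.
exists (2 * c), (2 * C); split; rewrite ?mulr_ge0// => u v N f x tau Theta N0 fc fOm dr.
have nE (z : E * R^o) : `|z| = Num.max `|z.1| `|z.2| by exact: prod_normE.
have n1 (z : E * R^o) : `|z.1| <= `|z| by rewrite nE le_max lexx.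
have n2 (z : E * R^o) : `|z.2| <= `|z| by rewrite nE le_max lexx orbT.
have n12 (z : E * R^o) : `|z.1| + `|z.2| <= 2 * `|z|.
  by rewrite mulr_natl mulr2n lerD.
have dr' (l : R) : driven V p u v `|l| L f x ((l / N) *: tau) Theta.
  have := driven_scale (l / N) dr.
  by rewrite normrM normfV (gtr0_norm N0) divfK ?gt_eqF.
have bnd l := H u v `|l| f x _ Theta (normr_ge0 l) fc fOm (dr' l).
have pn (y : E) : `|(y, 0) : E * R^o| = `|y|.
  by rewrite nE/= normr0; apply/max_idPl.
split.
- move=> s t [y1 y2] [z1 z2] us st tv.
  have e : ((y2 : R) - z2) / N = y2 / N - z2 / N by rewrite mulrBl.
  have h := XiB x ((y2 / N) *: tau) ((z2 / N) *: tau) Theta s t y1 z1.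
  rewrite -scalerBl -e in h.
  transitivity ((Xi V x ((((y2 : R) - z2) / N) *: tau) Theta s t (y1 - z1), 0) : E * R^o).
    by [].
  by rewrite h; congr (_, _); rewrite /= subrr.
- move=> s z us sv; rewrite /pair_germ; congr (_, _).
  have [h _ _] := bnd z.2; apply/eqP; rewrite -normr_le0.
  apply: le_trans (h s s z.1 us (lexx s) sv) _.
  by rewrite /radius subrr powR0 ?invr_neq0 ?gt_eqF// mulr0 mul0r.
- move=> s t z us st tv; rewrite pn; have [h _ _] := bnd z.2.
  apply: le_trans (h s t z.1 us st tv) _.
  have cr : 0 <= c * radius p f s t by rewrite mulr_ge0 ?radius_ge0.
  apply: le_trans (ler_wpM2l cr (n12 z)) _.
  by apply: ler_eq; ring.
- move=> s m t [z1 z2] us sm mt tv; have [_ _ h] := bnd z2.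
  set W := pair_germ x tau N Theta.
  pose w := Xi V x ((z2 / N) *: tau) Theta.
  have -> : W m t ((z1, z2) + W s m (z1, z2)) + W s m (z1, z2) - W s t (z1, z2) =
      ((w m t (z1 + w s m z1) + w s m z1 - w s t z1, 0) : E * R^o).
    transitivity ((Xi V x ((((z2 : R) + 0) / N) *: tau) Theta m t (z1 + w s m z1)
      + w s m z1 - w s t z1, (0 : R) + 0 - 0) : E * R^o); first by [].
    by rewrite !addr0 subr0.
  rewrite pn; apply: le_trans (h s m t z1 us sm mt tv) _.
  have r0 : 0 <= radius p f s t ^+ 3 by rewrite exprn_ge0 ?radius_ge0.
  have Cr : 0 <= C * radius p f s t ^+ 3 by rewrite mulr_ge0.
  apply: le_trans (ler_wpM2l Cr (n12 (z1, z2))) _.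
  by apply: ler_eq; ring.
Qed.

(** Increments of order $3/p > 1$ are Riemann limits of the zero germ. *)
Lemma constant_of_cube {F : normedModType R} (p u v C : R) f (g : R -> F) :
  0 < p < 3 -> 0 <= C -> additive_control u v f ->
  (forall s t, u <= s -> s <= t -> t <= v -> `|g t - g s| <= C * radius p f s t ^+ 3) ->
  forall s t, u <= s -> s <= t -> t <= v -> g t = g s.
Proof.
move=> p03 C0 fc gf s t us st tv.
have lim : riemann_limit (fun _ _ => 0) s t (incr g s t).
  by apply: (germ_riemann_limit p03 C0 fc) => // a b ua ab bv; rewrite subr0; exact: gf.
apply/eqP; rewrite -subr_eq0 -normr_le0 -[X in `|X|]subr0.
apply: (mesh_limit_le st lim ltr01) => D _ _.
by rewrite subr0 /riemann_sum big1// normr0.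
Qed.

End TangentFlow.

(** * Existence, uniqueness and estimates for intrinsic solutions *)

Section IntrinsicSolutions.
Context {R : realType} {E : normedModType R} {d : nat} (V : 'I_d -> E -> E).
Context (M p T u v : R).
Context (VM : forall i, C3_bounded M (V i)) (M0 : 0 <= M) (p23 : 2 < p < 3)
  (u0 : 0 <= u) (uv : u <= v) (vT : v <= T).
Implicit Types (x tau : two_level R d) (Theta P : R -> E).

Let p0 : 0 < p. Proof. by case/andP: p23 => h _; lra. Qed.
Let p03 : 0 < p < 3. Proof. by rewrite p0; case/andP: p23. Qed.

(** [linear_flow] for [pair_germ], with terminal value [(0, N)] for existence. The weight [l] is
    left free in the a priori part: [l = N] bounds a solution, and [l = 0] shows that a difference
    of solutions vanishes. *)
Lemma tangent_flow (L Om : R) : 0 <= L -> exists2 K, 0 <= K &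
  forall N f x tau Theta, 0 < N -> additive_control u v f -> f v - f u <= Om ->
    driven V p u v N L f x tau Theta ->
    (seq_complete E -> exists P, [/\ P v = 0,
       forall s, u <= s -> s <= v -> `|P s| <= K * N &
       forall s t, u <= s -> s <= t -> t <= v ->
       `|P t - P s - Xi V x tau Theta s t (P s)| <= K * radius p f s t ^+ 3 * N]) /\
    (forall P (l : R) g C B, 0 <= C -> additive_control u v g -> P v = 0 ->
      (forall s, u <= s -> s <= v -> `|P s| <= B) ->
      (forall s t, u <= s -> s <= t -> t <= v ->
        `|P t - P s - Xi V x ((l / N) *: tau) Theta s t (P s)|
        <= C * radius p g s t ^+ 3) ->
      forall s t, u <= s -> s <= t -> t <= v -> `|P s| <= K * `|l| /\
        `|P t - P s - Xi V x ((l / N) *: tau) Theta s t (P s)|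
        <= K * radius p f s t ^+ 3 * `|l|).
Proof.
move=> L0; have [c [C [c0 C0 HW]]] := pair_germ_generator VM M0 Om p0 L0.
have [K K0 HK] := linear_flow Om p03 c0 C0.
exists K => // N f x tau Theta N0 fc fOm dr.
have nE (z : E * R^o) : `|z| = Num.max `|z.1| `|z.2| by exact: prod_normE.
have n1 (z : E * R^o) : `|z.1| <= `|z| by rewrite nE le_max lexx.
have n2 (z : E * R^o) : `|z.2| <= `|z| by rewrite nE le_max lexx orbT.
have p1 (y : E) : `|(y, 0) : E * R^o| = `|y|.
  by rewrite nE/= normr0; apply/max_idPl.
have p2 (l : R) : `|(0, l) : E * R^o| = `|l|.
  by rewrite nE/= normr0; apply/max_idPr.
have [ex ap] := HK _ u v f _ fc uv fOm (HW u v N f x tau Theta N0 fc fOm dr).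
split=> [Ec|P l g C' B C'0 gc Pv PB Perr s t us st tv].
  have [zt [ztv ztK zterr]] := ex (pair_seq_complete Ec) (0, N).
  rewrite p2 (gtr0_norm N0) in zterr ztK.
  have KN : 0 <= K * N by rewrite mulr_ge0// ltW.
  (* The germ has no second component, so that coordinate stays at its terminal value and the weight
     [N / N] restores [tau]. *)
  have zt2 s : u <= s -> s <= v -> (zt s).2 = N.
    move=> us sv; have h := @constant_of_cube _ R^o p u v (K * N) f
      (fun s => (zt s).2) p03 KN fc.
    rewrite -(h _ s v us sv (lexx v)) ?ztv// => a b ua ab bv.
    have := le_trans (n2 _) (zterr a b ua ab bv).
    by rewrite /= subr0 mulrAC.
  exists (fun s => (zt s).1); split; first by rewrite ztv.
    by move=> s us sv; apply: le_trans (n1 _) (ztK s us sv).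
  move=> s t us st tv; have := le_trans (n1 _) (zterr s t us st tv).
  by rewrite /= zt2 ?(le_trans st)// divff ?gt_eqF// scale1r.
pose zt s : (E * R^o)%type := (P s, l).
have err a b : zt b - zt a - pair_germ V x tau N Theta a b (zt a) =
    (P b - P a - Xi V x ((l / N) *: tau) Theta a b (P a), 0) :> (E * R^o).
  transitivity ((P b - P a - Xi V x ((l / N) *: tau) Theta a b (P a), l - l - 0) : E * R^o).
    by [].
  by rewrite subrr subr0.
have ztB a : u <= a -> a <= v -> `|zt a| <= B + `|l|.
  move=> ua av; have B0 : 0 <= B by exact: le_trans (normr_ge0 _) (PB a ua av).
  by rewrite nE ge_max /= ler_wpDr ?PB//= lerDr.
have zterr a b : u <= a -> a <= b -> b <= v ->
    `|zt b - zt a - pair_germ V x tau N Theta a b (zt a)| <= C' * radius p g a b ^+ 3.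
  by move=> ua ab bv; rewrite err p1; exact: Perr.
have ztvl : `|zt v| = `|l| by rewrite /zt Pv p2.
have [h1 h2] := ap zt g C' _ C'0 gc ztB zterr s t us st tv.
rewrite ztvl in h1 h2; split; first exact: le_trans (n1 _) h1.
by have := h2; rewrite err p1.
Qed.

Lemma intrinsic_bounded x tau Theta P : intrinsic_solution p V x tau Theta P u v ->
  exists B g C, [/\ 0 <= C, additive_control u v g, P v = 0,
    forall s, u <= s -> s <= v -> `|P s| <= B
  & forall s t, u <= s -> s <= t -> t <= v ->
    `|P t - P s - Xi V x tau Theta s t (P s)| <= C * radius p g s t ^+ 3].
Proof.
move=> [Pc Pv [w [C [wc Perr]]]].
have [B B0 PB] := within_bounded uv Pc.
have [g gc wg] := is_control_additive uv wc.
exists B, g, `|C|; split=> // s t us st tv; apply: le_trans (Perr s t us st tv) _.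
have /andP[w0 wle] := wg s t us st tv.
rewrite radius_cube//; apply: (@le_trans _ _ (`|C| * w s t `^ (3 / p))).
  by rewrite ler_wpM2r ?powR_ge0 ?ler_norm.
rewrite ler_wpM2l//; apply: ge0_ler_powR; rewrite ?nnegrE ?divr_ge0 ?(ltW p0)//.
exact: le_trans wle.
Qed.

(** The conclusion of [rde_driven] as a hypothesis, so that the constant below depends on [x] and
    [Theta] through [L] and [Om] only. *)
Definition drivable (L Om : R) x Theta : Prop :=
  forall tau N, tangent p T x tau -> 0 < N -> (tangent_norm p T tau <= N%:E)%E ->
  exists f, [/\ additive_control u v f, f v - f u <= Om
    & driven V p u v N L f x tau Theta].

Definition intrinsic_estimates (K N : R) f x tau Theta P : Prop :=
  forall s t, u <= s -> s <= t -> t <= v ->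
  [/\ `|P s| <= K * N, `|P t - P s| <= K * N * radius p f s t,
      `|tangent_remainder V x tau Theta P s t| <= K * N * radius p f s t ^+ 2
    & `|P t - P s - Xi V x tau Theta s t (P s)| <= K * N * radius p f s t ^+ 3].

Lemma estimates_intrinsic K N f x tau Theta P : 0 <= K -> 0 <= N ->
  additive_control u v f -> P v = 0 -> intrinsic_estimates K N f x tau Theta P ->
  intrinsic_solution p V x tau Theta P u v.
Proof.
move=> K0 N0 fc Pv PK; split=> //.
  apply: (additive_control_continuous p0 (mulr_ge0 K0 N0) fc) => s t us st tv.
  by have [] := PK s t us st tv.
exists (fun s t => f t - f s), (K * N); split; first exact: additive_control_is_control.
by move=> s t us st tv; have [_ _ _] := PK s t us st tv; rewrite radius_cube.
Qed.

Lemma intrinsic_theory (L Om : R) : 0 <= L -> exists2 K, 0 <= K &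
  forall x Theta, drivable L Om x Theta ->
  forall tau N, tangent p T x tau -> 0 < N -> (tangent_norm p T tau <= N%:E)%E ->
  [/\ seq_complete E -> exists P, intrinsic_solution p V x tau Theta P u v,
      forall P, intrinsic_solution p V x tau Theta P u v -> exists f,
        [/\ additive_control u v f, f v - f u <= Om,
            driven V p u v N L f x tau Theta
          & intrinsic_estimates K N f x tau Theta P]
    & forall P P', intrinsic_solution p V x tau Theta P u v ->
        intrinsic_solution p V x tau Theta P' u v ->
        forall t, u <= t -> t <= v -> P t = P' t].
Proof.
move=> L0; have [K K0 HK] := tangent_flow Om L0.
have [c [C [c0 C0 HX]]] := Xi_bounds VM M0 Om p0 L0.
pose R0 := `|Om| `^ p^-1; have R00 : 0 <= R0 by exact: powR_ge0.
(* [c * (K + 1)] comes from the germ, as [|P s| + N] is at most [(K + 1) * N]. The factors [R0 ^+ 2]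
   and [R0] lower the cubic error to order one and order two. *)
pose K' := K + c * (K + 1) + K * R0 ^+ 2 + K * R0.
have K'0 : 0 <= K' by rewrite !addr_ge0 ?mulr_ge0 ?addr_ge0 ?exprn_ge0.
exists K' => // x Theta Hdr tau N tg N0 tN.
have [f [fc fOm dr]] := Hdr tau N tg N0 tN.
have [ex ap] := HK N f x tau Theta N0 fc fOm dr.
have [Xib Xi2b _] := HX u v N f x tau Theta (ltW N0) fc fOm dr.
have estim P : (forall s, u <= s -> s <= v -> `|P s| <= K * N) ->
    (forall s t, u <= s -> s <= t -> t <= v ->
      `|P t - P s - Xi V x tau Theta s t (P s)| <= K * radius p f s t ^+ 3 * N) ->
    intrinsic_estimates K' N f x tau Theta P.
  move=> PK Perr s t us st tv; set r := radius p f s t.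
  have r0 : 0 <= r by exact: radius_ge0.
  have rR : r <= R0 by exact: (radius_le_total p0 fc fOm).
  have Ps := PK s us (le_trans st tv).
  have h1 := Xib s t (P s) us st tv; have h2 := Xi2b s t (P s) us st tv.
  have h3 := Perr s t us st tv; rewrite -/r in h1 h2 h3.
  have PN : `|P s| + N <= (K + 1) * N by rewrite mulrDl mul1r lerD2r.
  have g1 := le_trans h1 (ler_wpM2l (mulr_ge0 c0 r0) PN).
  have g2 := le_trans h2 (ler_wpM2l (mulr_ge0 c0 (exprn_ge0 2 r0)) PN).
  have r3 : r ^+ 3 <= R0 * r ^+ 2 by rewrite exprS ler_wpM2r ?exprn_ge0.
  have r31 : r ^+ 3 <= R0 ^+ 2 * r.
    by rewrite exprSr ler_wpM2r// lerXn2r ?nnegrE.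
  have KN0 : 0 <= K * N by rewrite mulr_ge0// ltW.
  have cN0 : 0 <= c * (K + 1) * N.
    by rewrite !mulr_ge0 ?addr_ge0// ltW.
  have KR0 : 0 <= K * R0 * N by rewrite !mulr_ge0// ltW.
  have KR2 : 0 <= K * R0 ^+ 2 * N by rewrite !mulr_ge0 ?exprn_ge0// ltW.
  split.
  - by apply: le_trans Ps _; rewrite /K'; lra.
  - rewrite -[P t - P s](subrK (Xi V x tau Theta s t (P s))).
    rewrite (le_trans (ler_normD _ _))// (le_trans (lerD h3 g1))//.
    have := ler_wpM2l KN0 r31; have := mulr_ge0 KN0 r0; have := mulr_ge0 KR0 r0.
    by rewrite /K'; lra.
  - have -> : tangent_remainder V x tau Theta P s t =
        (P t - P s - Xi V x tau Theta s t (P s)) + Xi2 V x tau Theta s t (P s).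
      by rewrite XiE /tangent_remainder /incr; zmod.
    rewrite (le_trans (ler_normD _ _))// (le_trans (lerD h3 g2))//.
    have r20 := exprn_ge0 2 r0.
    have := ler_wpM2l KN0 r3; have := mulr_ge0 KN0 r20; have := mulr_ge0 KR2 r20.
    by rewrite /K'; lra.
  - apply: le_trans h3 _; have r30 := exprn_ge0 3 r0.
    have := mulr_ge0 cN0 r30; have := mulr_ge0 KR0 r30; have := mulr_ge0 KR2 r30.
    by rewrite /K'; lra.
have tauE : (N / N) *: tau = tau by rewrite divff ?gt_eqF// scale1r.
split.
- move=> Ec; have [P [Pv PK Perr]] := ex Ec; exists P.
  exact: (estimates_intrinsic K'0 (ltW N0) fc Pv (estim P PK Perr)).
- move=> P /intrinsic_bounded[B [g [C' [C'0 gc Pv PB Perr]]]].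
  exists f; split=> //.
  have := ap P N g C' B C'0 gc Pv PB; rewrite tauE gtr0_norm// => /(_ Perr) h.
  apply: estim => [s us sv|s t us st tv]; first by have [] := h s v us sv (lexx v).
  by have [] := h s t us st tv.
- move=> P P' /intrinsic_bounded[B [g [C1 [C10 gc Pv PB Perr]]]].
  move=> /intrinsic_bounded[B' [g' [C1' [C10' gc' Pv' PB' Perr']]]] t ut tv.
  apply/eqP; rewrite -subr_eq0 -normr_le0.
  (* The difference has weight zero, and its error is measured by the sum of the two controls. *)
  have h := ap (fun t => P t - P' t) 0 (fun t => g t + g' t) (C1 + C1') (B + B')
    (addr_ge0 C10 C10') (additive_controlD gc gc').
  have Dv : P v - P' v = 0 by rewrite Pv Pv' subrr.
  have DB s : u <= s -> s <= v -> `|P s - P' s| <= B + B'.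
    move=> us sv; apply: le_trans (ler_normB _ _) _.
    by rewrite lerD ?PB ?PB'.
  have Derr a b : u <= a -> a <= b -> b <= v ->
      `|P b - P' b - (P a - P' a) - Xi V x ((0 / N) *: tau) Theta a b (P a - P' a)|
      <= (C1 + C1') * radius p (fun t => g t + g' t) a b ^+ 3.
    move=> ua ab bv.
    have tau0 : (0 / N) *: tau = tau - tau by rewrite mul0r scale0r subrr.
    have -> : P b - P' b - (P a - P' a) - Xi V x ((0 / N) *: tau) Theta a b (P a - P' a) =
        (P b - P a - Xi V x tau Theta a b (P a)) -
        (P' b - P' a - Xi V x tau Theta a b (P' a)).
      by rewrite tau0 XiB; zmod.
    have [mg _] := gc; have [mg' _] := gc'.
    have g0 := mg a b ua ab bv; have g0' := mg' a b ua ab bv.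
    rewrite (le_trans (ler_normB _ _))// mulrDl lerD//.
      apply: le_trans (Perr a b ua ab bv) _; rewrite ler_wpM2l//.
      by rewrite lerXn2r ?nnegrE ?radius_ge0//; apply: le_radius => //; lra.
    apply: le_trans (Perr' a b ua ab bv) _; rewrite ler_wpM2l//.
    by rewrite lerXn2r ?nnegrE ?radius_ge0//; apply: le_radius => //; lra.
  by have [] := h Dv DB Derr t v ut tv (lexx v); rewrite normr0 mulr0.
Qed.

End IntrinsicSolutions.

(** * Linear combinations of tangents and of solutions *)

Section LinearStructure.
Context {R : realType}.

Lemma within_linear {T : pseudoMetricType R} {F : normedModType R} (A : set T) (c : R)
    (g h : T -> F) : {within A, continuous g} -> {within A, continuous h} ->
  {within A, continuous (fun z => c *: g z + h z)}.
Proof.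
move=> gc hc z; apply: cvgD; last exact: hc.
by apply: cvgZ; [exact: cvg_cst|exact: gc].
Qed.

(** Only finiteness is claimed, so adding the controls of the two terms replaces Minkowski's
    inequality. *)
Lemma var2_linear_lty {F : normedModType R} (r u v c : R) (K1 K2 : R -> R -> F) :
  0 < r -> u <= v ->
  {within simplex u v, continuous (fun z : R * R => K1 z.1 z.2)} ->
  {within simplex u v, continuous (fun z : R * R => K2 z.1 z.2)} ->
  (forall t, u <= t -> t <= v -> K1 t t = 0) ->
  (forall t, u <= t -> t <= v -> K2 t t = 0) ->
  (var2 r K1 u v < +oo)%E -> (var2 r K2 u v < +oo)%E ->
  (var2 r (fun s t => c *: K1 s t + K2 s t)%R u v < +oo)%E.
Proof.
move=> r0 uv c1 c2 d1 d2 f1 f2.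
have [g1 [[m1 _] b1 _]] := var2_control r0 uv c1 d1 f1.
have [g2 [[m2 _] b2 _]] := var2_control r0 uv c2 d2 f2.
have cc : 0 <= `|c| + 1 by rewrite addr_ge0.
have mg s t : u <= s -> s <= t -> t <= v -> g1 s + g2 s <= g1 t + g2 t.
  by move=> us st tv; rewrite lerD ?m1 ?m2.
apply: (@le_lt_trans _ _ _ _ _ (var2_le (f := fun t => g1 t + g2 t) r0 cc uv mg _));
  last exact: ltry.
move=> s t us st tv; rewrite (le_trans (ler_normD _ _))// mulrDl mul1r normrZ.
have n1 := m1 s t us st tv; have n2 := m2 s t us st tv.
have mono (a b : R) : 0 <= a -> a <= b -> a `^ r^-1 <= b `^ r^-1.
  by move=> a0 ab; apply: ge0_ler_powR; rewrite ?nnegrE ?invr_ge0 ?(ltW r0)// (le_trans a0).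
rewrite lerD//.
  rewrite ler_wpM2l//; apply: le_trans (b1 s t us st tv) _; apply: mono; lra.
by apply: le_trans (b2 s t us st tv) _; apply: mono; lra.
Qed.

Lemma incr_linear {F : normedModType R} (c : R) (g h : R -> F) s t :
  incr (c *: g + h) s t = c *: incr g s t + incr h s t.
Proof. by rewrite /incr !fctE scalerBr; zmod. Qed.

Lemma tens_linearr n (c : R) (a b b' : 'rV[R]_n) :
  tens a (c *: b + b') = c *: tens a b + tens a b'.
Proof. by rewrite /tens mulmxDr scalemxAr. Qed.

Lemma tens_linearl n (c : R) (a a' b : 'rV[R]_n) :
  tens (c *: a + a') b = c *: tens a b + tens a' b.
Proof. by rewrite /tens !raddfD /= linearZ /= mulmxDl scalemxAl. Qed.

Lemma tangent_linear (p T c : R) n (x tau1 tau2 : two_level R n) : 0 < p -> 0 <= T ->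
  tangent p T x tau1 -> tangent p T x tau2 -> tangent p T x (c *: tau1 + tau2).
Proof.
move=> p0 T0 [[h1 h10 h1f] [k1 k10 k1f] ch1 s1] [[h2 h20 h2f] [k2 k20 k2f] ch2 s2].
have q0 : 0 < p / 2 by rewrite divr_gt0.
have E1 : (c *: tau1 + tau2).1 = c *: tau1.1 + tau2.1 by [].
have E2 s t : (c *: tau1 + tau2).2 s t = c *: tau1.2 s t + tau2.2 s t by [].
split.
- split; first exact: (within_linear (c := c) h1 h2).
    by rewrite E1 !fctE h10 h20 scaler0 addr0.
  have iE : incr (c *: tau1 + tau2).1 =
      fun s t => c *: incr tau1.1 s t + incr tau2.1 s t.
    by apply/funext => s; apply/funext => t; rewrite E1 incr_linear.
  rewrite /var1 iE.
  exact: (@var2_linear_lty _ p 0 T c (incr tau1.1) (incr tau2.1) p0 T0 (within_incr h1)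
    (within_incr h2) (fun t _ _ => subrr _) (fun t _ _ => subrr _) h1f h2f).
- split; first exact: (within_linear (c := c) k1 k2).
    by move=> t t0T; rewrite E2 k10// k20// scaler0 addr0.
  exact: (@var2_linear_lty _ (p / 2) 0 T c tau1.2 tau2.2 q0 T0 k1 k2
    (fun t h h' => k10 t (introT andP (conj h h')))
    (fun t h h' => k20 t (introT andP (conj h h'))) k1f k2f).
- move=> s m t s0 sm mt tT; rewrite E1 !incr_linear.
  have e1 := ch1 s m t s0 sm mt tT; have e2 := ch2 s m t s0 sm mt tT.
  have -> : delta2 (c *: tau1 + tau2).2 s m t =
      c *: delta2 tau1.2 s m t + delta2 tau2.2 s m t.
    by rewrite /delta2 !E2 !scalerBr; zmod.
  by rewrite e1 e2 tens_linearr tens_linearl scalerDr addrACA.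
move=> s t s0 st tT; rewrite E1 E2 !incr_linear.
have e1 := s1 s t s0 st tT; have e2 := s2 s t s0 st tT.
have -> : sym_part (c *: tau1.2 s t + tau2.2 s t) =
    c *: sym_part (tau1.2 s t) + sym_part (tau2.2 s t).
  by apply/matrixP => i j; rewrite !mxE; ring.
rewrite e1 e2 tens_linearr tens_linearl.
move: (tens _ _) (tens _ _) (tens _ _) (tens _ _) => A B C D.
by apply/matrixP => i j; rewrite !mxE; ring.
Qed.

Lemma tangent_norm_fin (p T : R) n (x tau : two_level R n) :
  tangent p T x tau -> exists2 N : R, 0 < N & (tangent_norm p T tau <= N%:E)%E.
Proof.
move=> [[_ _ hf] [_ _ kf] _ _].
have h0 : (0 <= var1 p tau.1 0 T)%E by exact: poweR_ge0.
have k0 : (0 <= var2 (p / 2) tau.2 0 T)%E by exact: poweR_ge0.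
exists (fine (var1 p tau.1 0 T) + fine (var2 (p / 2) tau.2 0 T) + 1).
  by rewrite ltr_wpDl// addr_ge0// fine_ge0.
rewrite /tangent_norm !EFinD !fineK ?ge0_fin_numE//.
by rewrite leeDl.
Qed.

Lemma is_controlD (u v : R) w1 w2 : is_control u v w1 -> is_control u v w2 ->
  is_control u v (fun s t => w1 s t + w2 s t).
Proof.
move=> [c1 n1 d1 a1] [c2 n2 d2 a2]; split.
- by move=> z; apply: cvgD; [exact: c1|exact: c2].
- by move=> s t us st tv; rewrite addr_ge0 ?n1 ?n2.
- by move=> t utv; rewrite d1// d2// addr0.
- move=> s m t us sm mt tv; have := a1 s m t us sm mt tv.
  by have := a2 s m t us sm mt tv; lra.
Qed.

Lemma intrinsic_linear {E : normedModType R} {d : nat} (V : 'I_d -> E -> E)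
    (p u v c : R) (x tau1 tau2 : two_level R d) Theta (P1 P2 : R -> E) : 0 < p ->
  intrinsic_solution p V x tau1 Theta P1 u v ->
  intrinsic_solution p V x tau2 Theta P2 u v ->
  intrinsic_solution p V x (c *: tau1 + tau2) Theta (c *: P1 + P2) u v.
Proof.
move=> p0 [Pc1 Pv1 [w1 [C1 [wc1 err1]]]] [Pc2 Pv2 [w2 [C2 [wc2 err2]]]]; split.
- exact: (within_linear (c := c) Pc1 Pc2).
- by rewrite !fctE Pv1 Pv2 scaler0 addr0.
exists (fun s t => w1 s t + w2 s t), (`|c| * `|C1| + `|C2|); split.
  exact: is_controlD.
move=> s t us st tv; rewrite incr_linear Xi_linear.
have -> : c *: incr P1 s t + incr P2 s t -
    (c *: Xi V x tau1 Theta s t (P1 s) + Xi V x tau2 Theta s t (P2 s)) =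
    c *: (incr P1 s t - Xi V x tau1 Theta s t (P1 s)) +
    (incr P2 s t - Xi V x tau2 Theta s t (P2 s)).
  by rewrite [in RHS](scalerBr c (incr P1 s t)); zmod.
have [_ n1 _ _] := wc1; have [_ n2 _ _] := wc2.
have w10 := n1 s t us st tv; have w20 := n2 s t us st tv.
have q0 : 0 <= 3 / p by rewrite divr_ge0 ?ltW.
have mono (a b : R) : 0 <= a -> a <= b -> a `^ (3 / p) <= b `^ (3 / p).
  by move=> a0 ab; apply: ge0_ler_powR; rewrite ?nnegrE// (le_trans a0).
have bound (C a b : R) : 0 <= a -> a <= b -> C * a `^ (3 / p) <= `|C| * b `^ (3 / p).
  move=> a0 ab; apply: (@le_trans _ _ (`|C| * a `^ (3 / p))).
    by rewrite ler_wpM2r ?powR_ge0 ?ler_norm.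
  by rewrite ler_wpM2l ?mono.
rewrite (le_trans (ler_normD _ _))// normrZ mulrDl lerD//.
  rewrite -mulrA ler_wpM2l//; apply: le_trans (err1 s t us st tv) _.
  by apply: bound; lra.
by apply: le_trans (err2 s t us st tv) _; apply: bound; lra.
Qed.

End LinearStructure.

(** * The germ of a joint-lift representative *)

Section RepresentativeGerm.
Context {R : realType} {E : normedModType R} {d : nat} (V : 'I_d -> E -> E).
Context (M p T : R) (VM : forall i, C3_bounded M (V i)).
Implicit Types (x tau : two_level R d) (Theta P : R -> E) (a : R -> 'M[R]_d).

(** The subtracted terms, with indices exchanged and the sign absorbed by [A], are the part of the
    full sum below the diagonal; the diagonal vanishes. *)
Lemma skew_sum n (A : 'M[R]_n) (w : 'I_n -> 'I_n -> E) : A^T = - A ->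
  \sum_(i < n) \sum_(j < n | (i < j)%N) A i j *: (w i j - w j i) = \sum_i \sum_j A i j *: w i j.
Proof.
move=> AT; have Aij (i j : 'I_n) : A j i = - A i j by have /matrixP/(_ i j) := AT; rewrite !mxE.
have Aii (i : 'I_n) : A i i = 0.
  by apply/eqP; have := Aij i i; move/eqP; rewrite -subr_eq0 opprK -mulr2n mulrn_eq0.
transitivity (\sum_(i < n) \sum_(j < n | (i < j)%N) A i j *: w i j +
              \sum_(i < n) \sum_(j < n | (j < i)%N) A i j *: w i j).
  rewrite [X in _ = _ + X](exchange_big_dep xpredT)//= -big_split; apply: eq_bigr => i _ /=.
  rewrite -big_split; apply: eq_bigr => j _ /=.
  by rewrite scalerBr [A j i]Aij scaleNr.
rewrite -big_split; apply: eq_bigr => i _ /=.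
rewrite [RHS](bigID (fun j : 'I_n => (i < j)%N)) /=; congr (_ + _).
rewrite [RHS](bigD1 i) ?ltnn//= Aii scale0r add0r; apply: eq_bigl => j.
by rewrite -leqNgt ltn_neqAle andbC.
Qed.

Lemma representative_entries x tau Z a s t : representative p T x tau Z a ->
  0 <= s -> s <= t -> t <= T ->
  [/\ forall i, incr Z.1 s t 0 (lshift d i) = incr x.1 s t 0 i,
      forall i, incr Z.1 s t 0 (rshift d i) = incr tau.1 s t 0 i,
      forall j i, Z.2 s t (lshift d j) (lshift d i) = x.2 s t j i
    & forall j i, tau.2 s t j i = Z.2 s t (lshift d j) (rshift d i) +
        Z.2 s t (rshift d j) (lshift d i) + incr a s t j i].
Proof.
move=> [_ Z1 Z2 _ Z3] s0 st tT.
have s0T : 0 <= s <= T by rewrite s0 (le_trans st).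
have t0T : 0 <= t <= T by rewrite tT (le_trans s0).
have [ls rs] := Z1 s s0T; have [lt rt] := Z1 t t0T; split.
- by move=> i; rewrite /incr -ls -lt !mxE.
- by move=> i; rewrite /incr -rs -rt !mxE.
- by move=> j i; rewrite -(Z2 s t s0 st tT) !mxE.
- by move=> j i; rewrite (Z3 s t s0 st tT) /ursubmx /dlsubmx !mxE.
Qed.

Lemma split_lshift (i : 'I_d) : fintype.split (lshift d i) = inl i.
Proof. exact: (unsplitK (inl i : 'I_d + 'I_d)). Qed.

Lemma split_rshift (i : 'I_d) : fintype.split (rshift d i) = inr i.
Proof. exact: (unsplitK (inr i : 'I_d + 'I_d)). Qed.

Lemma representative_first_order x tau Z a Theta P s t r :
  representative p T x tau Z a -> 0 <= s -> s <= t -> t <= T ->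
  first_order Z ((var_integrand V Theta P)^~ r) s t =
  \sum_i incr x.1 s t 0 i *: Afield V i (Theta r) (P r) +
  \sum_i incr tau.1 s t 0 i *: V i (Theta r).
Proof.
move=> ZR s0 st tT; have [e1 e2 _ _] := representative_entries ZR s0 st tT.
rewrite /first_order big_split_ord /=; congr (_ + _); apply: eq_bigr => i _.
  by rewrite e1 /var_integrand split_lshift.
by rewrite e2 /var_integrand split_rshift.
Qed.

Lemma representative_remainder x tau Z a Theta P s t :
  representative p T x tau Z a -> 0 <= s -> s <= t -> t <= T ->
  incr P s t - first_order Z ((var_integrand V Theta P)^~ s) s t =
  tangent_remainder V x tau Theta P s t.
Proof.
move=> ZR s0 st tT; rewrite (representative_first_order _ _ _ ZR)//.
by rewrite opprD addrA.
Qed.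

Lemma young_germE x tau Z a Theta s t :
  representative p T x tau Z a -> 0 <= s -> s <= t -> t <= T ->
  young_germ V a Theta s t = \sum_j \sum_i incr a s t j i *: Qfield V j i (Theta s).
Proof.
move=> [_ _ _ [_ aT] _] s0 st tT; rewrite -skew_sum//.
by rewrite /incr raddfB /= !aT ?s0 ?(le_trans st)// ?tT ?(le_trans s0)//; zmod.
Qed.

(** Block by block: the [x]-[x] block meets $D^2V_i$ plus the iterated [Afield], which is [Bfield];
    both cross blocks and [a] meet [Qfield] and add up to [tau.2]; the [h]-[h] block meets zero. *)
Lemma representative_germ x tau Z a Theta P s t :
  representative p T x tau Z a -> 0 <= s -> s <= t -> t <= T ->
  first_order Z ((var_integrand V Theta P)^~ s) s t
    + \sum_j \sum_i Z.2 s t j i *: var_integrand' V Theta P j i s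
    + young_germ V a Theta s t = Xi V x tau Theta s t (P s).
Proof.
move=> ZR s0 st tT; rewrite (representative_first_order _ _ _ ZR)//.
rewrite (young_germE Theta ZR)// /Xi -!addrA; congr (_ + (_ + _)).
have [_ _ e3 e4] := representative_entries ZR s0 st tT.
rewrite big_split_ord /=.
have -> : \sum_(j < d) \sum_(i < d + d) Z.2 s t (lshift d j) i *:
      var_integrand' V Theta P (lshift d j) i s =
    \sum_j \sum_i x.2 s t j i *: Bfield V j i (Theta s) (P s) +
    \sum_j \sum_i Z.2 s t (lshift d j) (rshift d i) *: Qfield V j i (Theta s).
  rewrite -big_split; apply: eq_bigr => j _; rewrite big_split_ord /=.
  congr (_ + _); apply: eq_bigr => i _; last first.
    by rewrite /var_integrand' split_lshift split_rshift.
  rewrite e3 /var_integrand' !split_lshift (Bfield_E VM); congr (_ *: (_ + _)).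
  exact: (diff2_sym (VM i)).
have -> : \sum_(j < d) \sum_(i < d + d) Z.2 s t (rshift d j) i *:
      var_integrand' V Theta P (rshift d j) i s =
    \sum_j \sum_i Z.2 s t (rshift d j) (lshift d i) *: Qfield V j i (Theta s).
  apply: eq_bigr => j _; rewrite big_split_ord /= [X in _ + X]big1 ?addr0.
    by apply: eq_bigr => i _; rewrite /var_integrand' split_lshift split_rshift.
  by move=> i _; rewrite /var_integrand' !split_rshift scaler0.
rewrite -!addrA; congr (_ + _); rewrite -!big_split; apply: eq_bigr => j _ /=.
rewrite -!big_split; apply: eq_bigr => i _ /=.
by rewrite -!scalerDl e4 addrA.
Qed.

End RepresentativeGerm.

(** * Variation equation and intrinsic equation *)

Section VariationEquation.
Context {R : realType} {E : normedModType R} {d : nat} (V : 'I_d -> E -> E).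
Context (M p T u v : R).
Context (VM : forall i, C3_bounded M (V i)) (M0 : 0 <= M) (p23 : 2 < p < 3)
  (u0 : 0 <= u) (uv : u <= v) (vT : v <= T).
Context (x tau : two_level R d) (Z : two_level R (d + d)) (a : R -> 'M[R]_d)
  (ZR : representative p T x tau Z a).
Context (L Om N : R) (f : R -> R) (Theta : R -> E) (L0 : 0 <= L) (N0 : 0 <= N)
  (fc : additive_control u v f) (fOm : f v - f u <= Om)
  (dr : driven V p u v N L f x tau Theta).

Let p0 : 0 < p. Proof. by case/andP: p23 => h _; lra. Qed.
Let q0 : 0 < p / 2. Proof. by rewrite divr_gt0. Qed.
Let p03 : 0 < p < 3. Proof. by rewrite p0; case/andP: p23. Qed.
Let half_root g s t : (g t - g s) `^ (p / 2)^-1 = radius p g s t ^+ 2.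
Proof. by rewrite radius_sqr// invf_div. Qed.

Let in0T s t : u <= s -> s <= t -> t <= v -> [/\ 0 <= s, s <= t & t <= T].
Proof. by move=> us st tv; rewrite (le_trans u0)// (le_trans tv). Qed.

Lemma Afield_path_le P i s t : `|Afield V i (Theta t) (P t) - Afield V i (Theta s) (P s)|
  <= M * `|Theta t - Theta s| * `|P t| + M * `|P t - P s|.
Proof.
have -> : Afield V i (Theta t) (P t) - Afield V i (Theta s) (P s) =
    (Afield V i (Theta t) (P t) - Afield V i (Theta s) (P t)) +
    Afield V i (Theta s) (P t - P s).
  have -> : Afield V i (Theta s) (P t - P s) =
      Afield V i (Theta s) (P t) - Afield V i (Theta s) (P s) by exact: linearB.
  by rewrite subrKA.
rewrite (le_trans (ler_normD _ _))// lerD//.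
  exact: (C3_lip1 (VM i)).
exact: (C3_bound1 (VM i)).
Qed.

Lemma var_integrand_bound P B k s t : 0 <= B ->
  (forall s, u <= s -> s <= v -> `|P s| <= B) ->
  u <= s -> s <= t -> t <= v ->
  `|var_integrand V Theta P k t - var_integrand V Theta P k s| <=
  M * (B + 1) * `|Theta t - Theta s| + M * `|P t - P s|.
Proof.
move=> B0 PB us st tv; rewrite /var_integrand; case: fintype.split => i.
  apply: le_trans (Afield_path_le P i s t) _; rewrite lerD2r.
  rewrite mulrAC ler_wpM2r// ler_wpM2l// (le_trans (PB t _ _)) ?lerDl//.
  exact: le_trans st.
apply: le_trans (C3_lip0 (VM i) _ _) _.
have h1 : 0 <= M * B * `|Theta t - Theta s| by rewrite !mulr_ge0.
have h2 : 0 <= M * `|P t - P s| by rewrite mulr_ge0.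
lra.
Qed.

Lemma var_integrand_continuous P k :
  {within `[u, v], continuous Theta} -> {within `[u, v], continuous P} ->
  {within `[u, v], continuous (var_integrand V Theta P k)}.
Proof.
move=> Tc Pc; have [B B0 PB] := within_bounded uv Pc.
apply/within_continuousP => s sI e e0.
have K0 : 0 < M * (B + 1) + M + 1 by rewrite ltr_wpDl// addr_ge0// mulr_ge0// addr_ge0.
have e1 : 0 < e / (M * (B + 1) + M + 1) by rewrite divr_gt0.
have /within_continuousP/(_ s sI _ e1)[d1 d10 H1] := Tc.
have /within_continuousP/(_ s sI _ e1)[d2 d20 H2] := Pc.
exists (Num.min d1 d2) => [|t tI]; first by rewrite lt_min d10.
rewrite -ball_normE /= lt_min => /andP[b1 b2].
have h1 := H1 t tI; have h2 := H2 t tI.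
rewrite -!ball_normE /= in h1 h2; have {}h1 := h1 b1; have {}h2 := h2 b2.
have bound r r' : `|Theta r - Theta r'| < e / (M * (B + 1) + M + 1) ->
    `|P r - P r'| < e / (M * (B + 1) + M + 1) ->
    M * (B + 1) * `|Theta r - Theta r'| + M * `|P r - P r'| < e.
  move=> g1 g2; set q := e / _ in g1 g2.
  have qE : q * (M * (B + 1) + M + 1) = e by rewrite /q divfK ?gt_eqF.
  have g3 : M * (B + 1) * `|Theta r - Theta r'| <= M * (B + 1) * q.
    by rewrite ler_wpM2l ?mulr_ge0 ?addr_ge0// ltW.
  have g4 : M * `|P r - P r'| <= M * q by rewrite ler_wpM2l// ltW.
  have : 0 < q by exact: e1.
  lra.
move: sI tI; rewrite /= !in_itv/= => /andP[us sv] /andP[ut tv].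
have [st|ts] := leP s t.
  by apply: le_lt_trans (var_integrand_bound k B0 PB us st tv) _; exact: bound.
rewrite distrC; apply: le_lt_trans (var_integrand_bound k B0 PB ut (ltW ts) sv) _.
by apply: bound; rewrite distrC.
Qed.

(** The Young integral exists by additive sewing: its defect pairs an increment of [a], of order
    $2/p$, with one of [Qfield] along [Theta], of order $1/p$. Compensated sums of [Xi] tend to the
    increment of [P], and removing the Young sums leaves the rough integral. *)
Lemma intrinsic_variation K P : seq_complete E -> 0 <= K ->
  intrinsic_solution p V x tau Theta P u v ->
  intrinsic_estimates V p u v K N f x tau Theta P ->
  variation_solution p V Z a Theta P u v.
Proof.
move=> Ec K0 [Pc Pv _] PK; have [mf _] := fc.
have KN0 : 0 <= K * N by rewrite mulr_ge0.
have PB s : u <= s -> s <= v -> `|P s| <= K * N.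
  by move=> us sv; have [] := PK s v us sv (lexx v).
split=> //.
  split=> [k|].
    have c0 : 0 <= M * (K * N + 1) * L + M * (K * N).
      by rewrite addr_ge0// !mulr_ge0// addr_ge0.
    apply: (@le_lt_trans _ _ _ _ _ (var2_le p0 c0 uv mf _)); last exact: ltry.
    move=> s t us st tv; apply: le_trans (var_integrand_bound k KN0 PB us st tv) _.
    have h1 := dr_T dr us st tv; have [_ h2 _ _] := PK s t us st tv.
    have := ler_wpM2l M0 h2; have := ler_wpM2l (mulr_ge0 M0 (addr_ge0 KN0 ler01)) h1.
    by rewrite -/(radius p f s t) /incr; lra.
  apply: (@le_lt_trans _ _ _ _ _ (var2_le q0 KN0 uv mf _)); last exact: ltry.
  move=> s t us st tv; have [s0 _ tT] := in0T us st tv.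
  rewrite (representative_remainder _ _ _ ZR)// half_root.
  by have [_ _] := PK s t us st tv.
have [_ _ _ [[ac _ afin] _] _] := ZR.
have T0 : 0 <= T by rewrite (le_trans u0)// (le_trans uv).
have [fa [fac fab _]] := var2_control q0 T0 (within_incr ac) (fun t _ _ => subrr _) afin.
have {}fac := additive_controlW u0 vT fac; have [mfa _] := fac.
pose g t := f t + fa t; have gc : additive_control u v g by exact: additive_controlD.
pose R0 := `|g v - g u| `^ p^-1; have R00 : 0 <= R0 by exact: powR_ge0.
have rR := radius_le_total p0 gc (lexx (g v - g u)).
have ab s t : u <= s -> s <= t -> t <= v -> `|incr a s t| <= radius p g s t ^+ 2.
  move=> us st tv; have [s0 _ tT] := in0T us st tv.
  apply: le_trans (fab s t s0 st tT) _; rewrite half_root.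
  rewrite lerXn2r ?nnegrE ?radius_ge0//; apply: le_radius => //.
    by rewrite subr_ge0 mfa.
  by rewrite /g; have := mf s t us st tv; lra.
have fg s t : u <= s -> s <= t -> t <= v -> radius p f s t <= radius p g s t.
  move=> us st tv; apply: le_radius => //; first by rewrite subr_ge0 mf.
  by rewrite /g; have := mfa s t us st tv; lra.
pose Y s t := \sum_j \sum_i incr a s t j i *: Qfield V j i (Theta s).
pose c := d%:R * d%:R * (R0 * (M * M)).
pose C := d%:R * d%:R * (2 * M * M * L).
have c0 : 0 <= c by rewrite !mulr_ge0.
have C0 : 0 <= C by rewrite !mulr_ge0.
have [K' _ HK] := additive_sewing (g v - g u) p03 c0 C0.
have [|s t us st tv|s m t us sm mt tv|_ Ylim] := HK E u v g Y gc (lexx _).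
- move=> s _ _; rewrite /Y big1// => j _; rewrite big1// => i _.
  by rewrite /incr subrr mxE scale0r.
- have r0 : 0 <= radius p g s t by exact: radius_ge0.
  apply: le_trans (lincomb2_le (mulr_ge0 M0 M0) (ab s t us st tv)
    (fun j i => Qfield_le VM i j (Theta s))) _.
  have rr : radius p g s t ^+ 2 <= R0 * radius p g s t.
    by rewrite expr2 ler_wpM2r// rR.
  have dd : 0 <= d%:R * d%:R :> R by rewrite mulr_ge0.
  apply: le_trans (ler_wpM2l dd (ler_wpM2r (mulr_ge0 M0 M0) rr)) _.
  by apply: ler_eq; rewrite /c; ring.
- have us' := le_trans us sm; have mv := le_trans mt tv.
  have -> : Y s m + Y m t - Y s t =
      \sum_j \sum_i incr a m t j i *: (Qfield V j i (Theta m) - Qfield V j i (Theta s)).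
    rewrite /Y -big_split -sumrB; apply: eq_bigr => j _ /=.
    rewrite -big_split -sumrB; apply: eq_bigr => i _ /=.
    have -> : incr a s t = incr a s m + incr a m t by rewrite /incr; zmod.
    by move: (incr a s m) (incr a m t) => A B; rewrite mxE scalerDl scalerBr; zmod.
  set r := radius p g s t; have r0 : 0 <= r by exact: radius_ge0.
  have rsm : radius p f s m <= r.
    by apply: le_trans (fg s m us sm mv) _; apply: (radius_le_sub p0 gc us).
  have rmt : radius p g m t <= r by apply: (radius_le_sub p0 gc us).
  have TL : `|Theta m - Theta s| <= L * r.
    by apply: le_trans (dr_T dr us sm mv) _; rewrite ler_wpM2l.
  have QL j i : `|Qfield V j i (Theta m) - Qfield V j i (Theta s)| <= 2 * M * M * (L * r).
    by apply: le_trans (Qfield_lip VM i j _ _) _; rewrite ler_wpM2l// !mulr_ge0.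
  have amt : `|incr a m t| <= r ^+ 2.
    by apply: le_trans (ab m t us' mt tv) _; rewrite lerXn2r ?nnegrE ?radius_ge0.
  have b0 : 0 <= 2 * M * M * (L * r) by rewrite !mulr_ge0.
  apply: le_trans (lincomb2_le b0 amt QL) _.
  by apply: ler_eq; rewrite /C; ring.
- move=> s t us st tv; have [J HJ] := Ylim Ec s t us st tv.
  have sub s' t' : s <= s' -> s' <= t' -> t' <= t ->
      [/\ 0 <= s', s' <= t' & t' <= T].
    by move=> ss' st' tt'; apply: in0T => //; [exact: le_trans us ss'|exact: le_trans tt' tv].
  exists (incr P s t - J), J; split; last by rewrite subrK.
    have XiP : riemann_limit (fun s t => Xi V x tau Theta s t (P s)) s t (incr P s t).
      apply: (germ_riemann_limit (P := P) p03 KN0 fc) => // s' t' us' st' tv'.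
      by have [_ _ _] := PK s' t' us' st' tv'.
    rewrite -scaleN1r; apply: riemann_limit_eq (riemann_limit_lincomb (c := -1) _ XiP HJ).
      move=> s' t' ss' st' tt'; have [s'0 _ t'T] := sub s' t' ss' st' tt'.
      rewrite -(representative_germ VM Theta P ZR)// (young_germE V Theta ZR)//.
      by rewrite scaleN1r addrK.
    by rewrite normrN1.
  apply: riemann_limit_eq HJ => s' t' ss' st' tt'.
  by have [s'0 _ t'T] := sub s' t' ss' st' tt'; rewrite (young_germE V Theta ZR).
Qed.

(** The controlled structure bounds the distance from [P] to its germ only quadratically. This is
    enough to make the germ [Xi] along [P] additive up to cubes, and sewing then places its Riemann
    limit, the increment of [P], at cubic distance. *)
Lemma variation_intrinsic P : {within `[u, v], continuous Theta} ->
  variation_solution p V Z a Theta P u v ->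
  intrinsic_solution p V x tau Theta P u v.
Proof.
move=> Tc [Pc Pv [_ Rfin] eqn]; have [mf _] := fc.
have [B B0 PB] := within_bounded uv Pc.
have [[[Zc _ _] _ _ _] _ _ _ _] := ZR.
have Zc' : {within `[u, v], continuous Z.1}.
  apply: within_subset Zc => t /=; rewrite !in_itv/= => /andP[ut tv].
  by rewrite (le_trans u0)// (le_trans tv).
have Rc : {within simplex u v, continuous (fun z : R * R => incr P z.1 z.2 -
    first_order Z ((var_integrand V Theta P)^~ z.1) z.1 z.2)}.
  move=> z; apply: cvgB; first by have h := within_incr Pc; exact: (h z).
  apply: (@within_first_order _ _ _ u v Z (var_integrand V Theta P) Zc').
  by move=> k; exact: var_integrand_continuous.
have R00 t : u <= t -> t <= v ->
    incr P t t - first_order Z ((var_integrand V Theta P)^~ t) t t = 0.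
  move=> _ _; rewrite /incr subrr /first_order big1 ?subr0// => i _.
  by rewrite /incr subrr mxE scale0r.
have [fR [fRc fRb _]] := var2_control q0 uv Rc R00 Rfin; have [mfR _] := fRc.
pose g t := f t + fR t; have gc : additive_control u v g by exact: additive_controlD.
pose r s t := radius p g s t.
have r0 s t : 0 <= r s t by exact: radius_ge0.
have fr s t : u <= s -> s <= t -> t <= v -> radius p f s t <= r s t.
  move=> us st tv; apply: le_radius => //; first by rewrite subr_ge0 mf.
  by rewrite /g; have := mfR s t us st tv; lra.
have fr2 s t : u <= s -> s <= t -> t <= v -> radius p f s t ^+ 2 <= r s t ^+ 2.
  by move=> us st tv; rewrite lerXn2r ?nnegrE ?radius_ge0// fr.
have PR s t : u <= s -> s <= t -> t <= v ->
    `|tangent_remainder V x tau Theta P s t| <= r s t ^+ 2.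
  move=> us st tv; have [s0 _ tT] := in0T us st tv.
  rewrite -(representative_remainder V Theta P ZR)//.
  apply: le_trans (fRb s t us st tv) _; rewrite half_root.
  rewrite lerXn2r ?nnegrE ?radius_ge0//; apply: le_radius => //.
    by rewrite subr_ge0 mfR.
  by rewrite /g; have := mf s t us st tv; lra.
have [c [C [c0 C0 HX]]] := Xi_bounds VM M0 Om p0 L0.
have [Xib Xi2b Xid] := HX u v N f x tau Theta N0 fc fOm dr.
(* The zero tangent gives the homogeneous part of [Xi], which acts on the quadratic error [D] in the
   defect below. *)
have dr0 : driven V p u v 0 L f x (tau - tau) Theta.
  by have := driven_scale 0 dr; rewrite normr0 mul0r scale0r subrr.
have [Xib0 _ _] := HX u v 0 f x (tau - tau) Theta (lexx 0) fc fOm dr0.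
pose G s t := Xi V x tau Theta s t (P s).
have PG s t : u <= s -> s <= t -> t <= v ->
    `|P t - P s - G s t| <= (c * (B + N) + 1) * r s t ^+ 2.
  move=> us st tv.
  have -> : P t - P s - G s t = tangent_remainder V x tau Theta P s t -
      Xi2 V x tau Theta s t (P s).
    by rewrite /G XiE /tangent_remainder /incr; zmod.
  rewrite (le_trans (ler_normB _ _))// mulrDl mul1r [leRHS]addrC lerD ?PR//.
  apply: le_trans (Xi2b s t (P s) us st tv) _.
  apply: (@le_trans _ _ (c * r s t ^+ 2 * (B + N))).
    apply: ler_pM; rewrite ?mulr_ge0 ?addr_ge0 ?exprn_ge0 ?radius_ge0//.
      by rewrite ler_wpM2l// fr2.
    by rewrite lerD2r PB// (le_trans st).
  by rewrite mulrAC.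
pose c' := c * (B + N); pose C' := C * (B + N) + c * (c * (B + N) + 1).
have c'0 : 0 <= c' by rewrite mulr_ge0// addr_ge0.
have C'0 : 0 <= C' by rewrite addr_ge0// mulr_ge0// addr_ge0.
have [K K0 HK] := additive_sewing (g v - g u) p03 c'0 C'0.
have [|s t us st tv|s m t us sm mt tv|Gsum _] := HK E u v g G gc (lexx _).
- move=> s us sv; apply/eqP; rewrite -normr_le0.
  apply: le_trans (Xib s s (P s) us (lexx s) sv) _.
  by rewrite /radius subrr powR0 ?invr_neq0 ?gt_eqF// mulr0 mul0r.
- apply: le_trans (Xib s t (P s) us st tv) _; rewrite -!mulrA ler_wpM2l// [leRHS]mulrC.
  apply: ler_pM; rewrite ?addr_ge0 ?radius_ge0 ?fr//.
  by rewrite lerD2r PB// (le_trans st).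
- have us' := le_trans us sm; have mv := le_trans mt tv; have st := le_trans sm mt.
  pose D := P m - P s - G s m.
  have -> : G s m + G m t - G s t =
      (Xi V x tau Theta m t (P s + Xi V x tau Theta s m (P s)) +
        Xi V x tau Theta s m (P s) - Xi V x tau Theta s t (P s)) +
      Xi V x (tau - tau) Theta m t D.
    have -> : D = P m - (P s + Xi V x tau Theta s m (P s)) by rewrite /D /G; zmod.
    by rewrite XiB /G; zmod.
  have rsm : r s m <= r s t by apply: (radius_le_sub p0 gc us).
  have rmt : r m t <= r s t by apply: (radius_le_sub p0 gc us).
  have h1 : C * radius p f s t ^+ 3 * (`|P s| + N) <= C * r s t ^+ 3 * (B + N).
    apply: ler_pM; rewrite ?mulr_ge0 ?addr_ge0 ?exprn_ge0 ?radius_ge0//.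
      by rewrite ler_wpM2l// lerXn2r ?nnegrE ?radius_ge0// fr.
    by rewrite lerD2r PB// (le_trans sm).
  have h2 : `|D| <= (c * (B + N) + 1) * r s t ^+ 2.
    apply: le_trans (PG s m us sm mv) _; rewrite ler_wpM2l ?addr_ge0//.
    by rewrite lerXn2r ?nnegrE.
  have h3 : c * radius p f m t * (`|D| + 0) <=
      c * r s t * ((c * (B + N) + 1) * r s t ^+ 2).
    rewrite addr0; apply: ler_pM; rewrite ?mulr_ge0 ?radius_ge0//.
    by rewrite ler_wpM2l// (le_trans (fr m t us' mt tv)).
  rewrite (le_trans (ler_normD _ _))//.
  rewrite (le_trans (lerD (le_trans (Xid s m t (P s) us sm mt tv) h1)
    (le_trans (Xib0 m t D us' mt tv) h3)))//.
  by apply: ler_eq; rewrite /C' -/(r s t); ring.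
split=> //; exists (fun s t => g t - g s), K; split.
  exact: additive_control_is_control.
move=> s t us st tv; have [J [J' [HJ HJ' ->]]] := eqn s t us st tv.
rewrite -(radius_cube g s t p0).
have lim : riemann_limit G s t (J + 1 *: J').
  apply: riemann_limit_eq (riemann_limit_lincomb (c := 1) _ HJ HJ').
    move=> s' t' ss' st' tt'.
    have [s'0 _ t'T] := in0T (le_trans us ss') st' (le_trans tt' tv).
    by rewrite scale1r (representative_germ VM Theta P ZR).
  by rewrite normr1.
rewrite scale1r in lim.
apply: (mesh_limit_le st lim ltr01) => D sD _.
exact: Gsum.
Qed.

End VariationEquation.

Lemma row_seq_complete (R : realType) n : seq_complete 'rV[R]_n.
Proof.
move=> y yC.
have yCj j : exists l : R^o, forall e : R, 0 < e -> exists N, forall k, (N <= k)%N ->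
    `|y k 0 j - l| < e.
  apply: (@complete_seq_complete R R^o (fun k => y k 0 j)) => e /yC[N HN].
  exists N => k m Nk Nm; apply: le_lt_trans (HN k m Nk Nm).
  by have := mx_entry_le (y k - y m) 0 j; rewrite !mxE.
have [l Hl] := choice yCj; exists (\row_j l j) => e e0.
have [N HN] := choice (fun j => Hl j e e0).
exists (\max_j N j) => k Nk; rewrite [ltLHS]mx_normrE.
apply/bigmax_ltP; split=> // -[i j] _ /=; rewrite !mxE (ord1 i).
by apply: HN; apply: leq_trans Nk; exact: leq_bigmax.
Qed.

(** * The tangent solution operator *)

Section TangentOperator.
Context {R : realType} {E : normedModType R} {d : nat} (V : 'I_d -> E -> E).
Implicit Types (x tau : two_level R d) (Theta P : R -> E).

Lemma C3_bounded_le (M M' : R) (F G : normedModType R) (f : F -> G) : M <= M' ->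
  C3_bounded M f -> C3_bounded M' f.
Proof.
move=> MM' fM; split; try (by case: fM).
- exact: le_trans (C3_ge0 fM) MM'.
- by move=> z; apply: le_trans (C3_bound0 fM z) MM'.
- by move=> z b; apply: le_trans (C3_bound1 fM z b) _; rewrite ler_wpM2r.
- by move=> z b c; apply: le_trans (C3_bound2 fM z b c) _; rewrite !ler_wpM2r.
- by move=> y z b c; apply: le_trans (C3_lip2 fM y z b c) _; rewrite !ler_wpM2r.
Qed.

Lemma uniform_C3_bounded : (forall i, Cb_frechet 3 (V i)) ->
  exists2 M, 0 <= M & forall i, C3_bounded M (V i).
Proof.
move=> VC; have /choice[M VM] := fun i => Cb_frechet_C3_bounded (VC i).
have Mi0 i : 0 <= M i by exact: C3_ge0 (VM i).
exists (\sum_i M i) => [|i]; first by apply: sumr_ge0 => i _.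
apply: C3_bounded_le (VM i); rewrite (bigD1 i)//= lerDl.
by apply: sumr_ge0 => j _.
Qed.

Context (M p T u v : R).
Context (VM : forall i, C3_bounded M (V i)) (M0 : 0 <= M) (p23 : 2 < p < 3)
  (u0 : 0 <= u) (uv : u <= v) (vT : v <= T).

Let p0 : 0 < p. Proof. by case/andP: p23 => h _; lra. Qed.
Let q0 : 0 < p / 2. Proof. by rewrite divr_gt0. Qed.
Let T0 : 0 <= T. Proof. by rewrite (le_trans u0)// (le_trans uv). Qed.

Lemma estimates_norm (K N Om : R) f x tau Theta P : 0 <= K -> 0 <= N ->
  additive_control u v f -> f v - f u <= Om ->
  intrinsic_estimates V p u v K N f x tau Theta P ->
  (Vp_norm p P u v + var2 (p / 2) (tangent_remainder V x tau Theta P) u v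
   <= (K * (1 + `|Om| `^ p^-1 + `|Om| `^ (p / 2)^-1) * N)%:E)%E.
Proof.
move=> K0 N0 [mf cf] fOm PK; have KN0 : 0 <= K * N by rewrite mulr_ge0.
have fuv : 0 <= f v - f u by rewrite subr_ge0 mf.
have total r : 0 < r -> K * N * (f v - f u) `^ r^-1 <= K * N * `|Om| `^ r^-1.
  move=> r0; rewrite ler_wpM2l//; apply: ge0_ler_powR; rewrite ?nnegrE ?invr_ge0 ?(ltW r0)//.
  by rewrite (le_trans fOm)// ler_norm.
have h1 : (ereal_sup [set `|P t|%:E | t in `[u, v]] <= (K * N)%:E)%E.
  apply: ge_ereal_sup => _ [t /= + <-]; rewrite in_itv/= => /andP[ut tv].
  by rewrite lee_fin; have [] := PK t v ut tv (lexx v).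
have h2 : (var1 p P u v <= (K * N * `|Om| `^ p^-1)%:E)%E.
  apply: (@le_trans _ _ (K * N * (f v - f u) `^ p^-1)%:E); last by rewrite lee_fin total.
  by apply: var2_le => // s t us st tv; have [] := PK s t us st tv.
have h3 : (var2 (p / 2) (tangent_remainder V x tau Theta P) u v
    <= (K * N * `|Om| `^ (p / 2)^-1)%:E)%E.
  apply: (@le_trans _ _ (K * N * (f v - f u) `^ (p / 2)^-1)%:E); last by rewrite lee_fin total.
  apply: var2_le => // s t us st tv; have [_ _ + _] := PK s t us st tv.
  by rewrite radius_sqr// invf_div.
rewrite /Vp_norm; apply: le_trans (leeD (leeD h1 h2) h3) _.
by rewrite -!EFinD lee_fin; apply: ler_eq; ring.
Qed.

(** The estimates hold for every positive [N] above the tangent norm. Positivity is forced by the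
    division by [N], so the norm itself, possibly zero, is reached by letting [N] decrease to it. *)
Lemma intrinsic_norm x Theta : WGOmega p T x -> rde_solution p V x Theta u v ->
  exists2 C, 0 <= C & forall tau P, tangent p T x tau ->
    intrinsic_solution p V x tau Theta P u v ->
    (Vp_norm p P u v + var2 (p / 2) (tangent_remainder V x tau Theta P) u v
     <= C%:E * tangent_norm p T tau)%E.
Proof.
move=> WG rde; have [L [Om [L0 Hdr]]] := rde_driven VM M0 p23 u0 uv vT T0 WG rde.
have [K K0 HK] := intrinsic_theory T VM M0 p23 uv Om L0.
pose C := K * (1 + `|Om| `^ p^-1 + `|Om| `^ (p / 2)^-1).
have C0 : 0 <= C by rewrite mulr_ge0// !addr_ge0 ?powR_ge0.
exists C => // tau P tg PI.
have bound N : 0 < N -> (tangent_norm p T tau <= N%:E)%E ->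
    (Vp_norm p P u v + var2 (p / 2) (tangent_remainder V x tau Theta P) u v
     <= (C * N)%:E)%E.
  move=> N0 tN; have [_ /(_ P PI)[f [fc fOm _ PK]] _] := HK x Theta Hdr tau N tg N0 tN.
  exact: estimates_norm K0 (ltW N0) fc fOm PK.
have [N N0 tN] := tangent_norm_fin tg.
have t0 : (0 <= tangent_norm p T tau)%E by rewrite adde_ge0// poweR_ge0.
have tfin : tangent_norm p T tau \is a fin_num.
  by rewrite ge0_fin_numE// (le_lt_trans tN)// ltry.
move: t0 bound; rewrite -(fineK tfin); set n := fine _; rewrite lee_fin => n0 bound.
apply/lee_addgt0Pr => e e0; rewrite -EFinM -EFinD.
have C1 : 0 < C + 1 by rewrite ltr_wpDl.
have nn : 0 < n + e / (C + 1) by rewrite ltr_wpDl// divr_gt0.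
apply: le_trans (bound _ nn _) _; first by rewrite lee_fin lerDl divr_ge0 ?ltW.
rewrite lee_fin mulrDr lerD2l mulrA ler_pdivrMr// mulrC ler_wpM2l ?(ltW e0)//.
by rewrite lerDl.
Qed.

Lemma intrinsic_unique x Theta tau P P' : WGOmega p T x ->
  rde_solution p V x Theta u v -> tangent p T x tau ->
  intrinsic_solution p V x tau Theta P u v ->
  intrinsic_solution p V x tau Theta P' u v ->
  forall t, u <= t <= v -> P t = P' t.
Proof.
move=> WG rde tg PI PI' t /andP[ut tv].
have [L [Om [L0 Hdr]]] := rde_driven VM M0 p23 u0 uv vT T0 WG rde.
have [K K0 HK] := intrinsic_theory T VM M0 p23 uv Om L0.
have [N N0 tN] := tangent_norm_fin tg.
by have [_ _ uniq] := HK x Theta Hdr tau N tg N0 tN; exact: uniq.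
Qed.

Lemma intrinsic_exists x Theta tau : seq_complete E -> WGOmega p T x ->
  rde_solution p V x Theta u v -> tangent p T x tau ->
  exists P, intrinsic_solution p V x tau Theta P u v.
Proof.
move=> Ec WG rde tg.
have [L [Om [L0 Hdr]]] := rde_driven VM M0 p23 u0 uv vT T0 WG rde.
have [K K0 HK] := intrinsic_theory T VM M0 p23 uv Om L0.
have [N N0 tN] := tangent_norm_fin tg.
by have [ex _ _] := HK x Theta Hdr tau N tg N0 tN; exact: ex.
Qed.

Lemma representative_intrinsic x Theta tau Z a P : seq_complete E -> WGOmega p T x ->
  rde_solution p V x Theta u v -> tangent p T x tau -> representative p T x tau Z a ->
  variation_solution p V Z a Theta P u v <->
  intrinsic_solution p V x tau Theta P u v.
Proof.
move=> Ec WG rde tg ZR; have [Tc _ _ _] := rde.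
have [L [Om [L0 Hdr]]] := rde_driven VM M0 p23 u0 uv vT T0 WG rde.
have [N N0 tN] := tangent_norm_fin tg; split=> [PV|PI].
  have [f [fc fOm dr]] := Hdr tau N tg N0 tN.
  exact: (variation_intrinsic VM M0 p23 u0 uv vT ZR L0 (ltW N0) fc fOm dr Tc PV).
have [K K0 HK] := intrinsic_theory T VM M0 p23 uv Om L0.
have [_ /(_ P PI)[f [fc fOm dr PK]] _] := HK x Theta Hdr tau N tg N0 tN.
exact: (intrinsic_variation VM M0 p23 u0 uv vT ZR L0 (ltW N0) fc dr Ec K0 PI PK).
Qed.

Lemma tangent_sub x tau tau' : tangent p T x tau -> tangent p T x tau' ->
  tangent p T x (tau - tau').
Proof.
move=> tg tg'; have -> : tau - tau' = -1 *: tau' + tau by rewrite scaleN1r addrC.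
exact: tangent_linear.
Qed.

Lemma intrinsic_sub x tau tau' Theta P P' :
  intrinsic_solution p V x tau Theta P u v ->
  intrinsic_solution p V x tau' Theta P' u v ->
  intrinsic_solution p V x (tau - tau') Theta (P - P') u v.
Proof.
move=> PI PI'; have -> : tau - tau' = -1 *: tau' + tau by rewrite scaleN1r addrC.
have -> : P - P' = -1 *: P' + P by rewrite scaleN1r addrC.
exact: intrinsic_linear.
Qed.

End TangentOperator.

Theorem proposition5p1 (R : realType) (d : nat) (p T : R)
    (H : 'I_d -> R -> R) (chi : 'rV[R]_3 -> R) (U : set 'rV[R]_3)
    (V : 'I_d -> Ejet R -> Ejet R) (x : two_level R d) :
  2 < p < 3 -> 0 < T ->
  (forall i, Cb_real 9 (H i)) ->
  is_cutoff chi U ->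
  (forall i, reset_field (H i) chi (V i)) ->
  (forall i, Cb_frechet 3 (V i)) ->
  WGOmega p T x ->
  (forall (u v : R) (Theta : R -> Ejet R),
    0 <= u -> u <= v -> v <= T ->
    reset_interval p T U V x u v ->
    rde_solution p V x Theta u v ->
    exists (C : R) (Psol : two_level R d -> R -> Ejet R),
      0 <= C /\
      (forall tau, tangent p T x tau ->
        intrinsic_solution p V x tau Theta (Psol tau) u v /\
        forall P : R -> Ejet R, intrinsic_solution p V x tau Theta P u v ->
          forall t, u <= t <= v -> P t = Psol tau t) /\
      (forall (c : R) tau1 tau2, tangent p T x tau1 -> tangent p T x tau2 ->
        forall t, u <= t <= v ->
          Psol (c *: tau1 + tau2) t = c *: Psol tau1 t + Psol tau2 t) /\
      (forall tau0, tangent p T x tau0 ->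
        forall eps : R, 0 < eps -> exists2 delta : R, 0 < delta &
          forall tau, tangent p T x tau ->
            (tangent_norm p T (tau - tau0)%R < delta%:E)%E ->
            (Vp_norm p (Psol tau - Psol tau0)%R u v < eps%:E)%E) /\
      (forall tau, tangent p T x tau ->
        (Vp_norm p (Psol tau) u v
         + var2 (p / 2) (tangent_remainder V x tau Theta (Psol tau)) u v
         <= C%:E * tangent_norm p T tau)%E) /\
      (forall tau (Z : two_level R (d + d)) (a : R -> 'M[R]_d),
        tangent p T x tau -> representative p T x tau Z a ->
        variation_solution p V Z a Theta (Psol tau) u v /\
        forall P : R -> Ejet R, variation_solution p V Z a Theta P u v ->
          forall t, u <= t <= v -> P t = Psol tau t)) /\
  (forall (Pi : seq R) (Theta : R -> R -> R -> Ejet R),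
    reset_partition p T U V x Pi ->
    (forall u v, partition_piece 0 Pi u v ->
      rde_solution p V x (Theta u v) u v) ->
    forall M L : R, exists C : R, 0 <= C /\
      forall u v, partition_piece 0 Pi u v ->
      forall tau (Z : two_level R (d + d)) (a : R -> 'M[R]_d),
        tangent p T x tau -> (tangent_norm p T tau <= M%:E)%E ->
        representative p T x tau Z a ->
        (rho p T Z + var1 (p / 2) a 0 T <= L%:E)%E ->
      forall P : R -> Ejet R, variation_solution p V Z a (Theta u v) P u v ->
        (Vp_norm p P u v
         + var2 (p / 2) (tangent_remainder V x tau (Theta u v) P) u v
         <= C%:E * tangent_norm p T tau)%E).
Proof.
move=> p23 T0 _ _ _ VC WG.
have Ec : seq_complete (Ejet R).
  by apply: bcont_seq_complete; exact: row_seq_complete.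
have [M M0 VM] := uniform_C3_bounded VC.
have p0 : 0 < p by case/andP: p23 => h _; lra.
split=> [u v Theta u0 uv vT _ rde|Pi Theta [PiT _] rde N L].
  have [C C0 HC] := intrinsic_norm VM M0 p23 u0 uv vT WG rde.
  have uniq := intrinsic_unique VM M0 p23 u0 uv vT WG rde.
  (* Outside the tangent space [Psol] takes the zero path as a default value. *)
  have /choice[Psol HP] : forall tau, exists P, tangent p T x tau ->
      intrinsic_solution p V x tau Theta P u v.
    move=> tau; have [tg|ntg] := pselect (tangent p T x tau); last by exists 0.
    by have [P PI] := intrinsic_exists VM M0 p23 u0 uv vT Ec WG rde tg; exists P.
  have repr tau Z a P (tg : tangent p T x tau) (ZR : representative p T x tau Z a) :=
    representative_intrinsic VM M0 p23 u0 uv vT P Ec WG rde tg ZR.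
  exists C, Psol; split=> //; split; [|split; [|split; [|split]]].
  - move=> tau tg; split; first exact: HP.
    by move=> P PI; apply: uniq tg PI (HP tau tg).
  (* The combination of the two solutions solves the combined equation, so uniqueness identifies
     it. *)
  - move=> c tau1 tau2 tg1 tg2; have tg := tangent_linear c p0 (ltW T0) tg1 tg2.
    exact: uniq tg (HP _ tg) (intrinsic_linear c p0 (HP _ tg1) (HP _ tg2)).
  (* Continuity follows from the bound applied to [tau - tau0], whose solution is the difference. *)
  - move=> tau0 tg0 e e0; have C1 : 0 < C + 1 by rewrite ltr_wpDl.
    exists (e / (C + 1)) => [|tau tg tn]; first by rewrite divr_gt0.
    have tgB := tangent_sub p23 u0 uv vT tg tg0.
    have := HC _ _ tgB (intrinsic_sub p23 (HP _ tg) (HP _ tg0)).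
    set n := tangent_norm _ _ _ in tn *; set w := var2 _ _ _ _ => h.
    have w0 : (0 <= w)%E by exact: poweR_ge0.
    apply: (@le_lt_trans _ _ (C%:E * n)%E).
      by apply: le_trans h; rewrite leeDl.
    apply: (@le_lt_trans _ _ (C%:E * (e / (C + 1))%:E)%E).
      by apply: lee_wpmul2l; [rewrite lee_fin|exact: ltW].
    rewrite -EFinM lte_fin mulrA ltr_pdivrMr// mulrC ltr_pM2l//; lra.
  - by move=> tau tg; apply: HC tg (HP _ tg).
  - move=> tau Z a tg ZR; split; first by apply/(repr _ _ _ _ tg ZR); exact: HP.
    by move=> P /(repr _ _ _ _ tg ZR) PI; apply: uniq tg PI (HP _ tg).
(* One constant per index of the finite partition, with the default [0] past its end; their sum
   dominates each of them. *)
have piece i : exists C, 0 <= C /\ forall u v, (i < size Pi)%N ->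
    u = nth 0 (0 :: Pi) i -> v = nth 0 (0 :: Pi) i.+1 ->
    forall tau (Z : two_level R (d + d)) (a : R -> 'M[R]_d) P,
    tangent p T x tau -> representative p T x tau Z a ->
    variation_solution p V Z a (Theta u v) P u v ->
    (Vp_norm p P u v + var2 (p / 2) (tangent_remainder V x tau (Theta u v) P) u v
     <= C%:E * tangent_norm p T tau)%E.
  have [iPi|iPi] := ltnP i (size Pi); last by exists 0; split.
  set u := nth 0 (0 :: Pi) i; set v := nth 0 (0 :: Pi) i.+1.
  have uvPi : partition_piece 0 Pi u v by exists i.
  have [u0 /ltW uv vT] := partition_piece_itv PiT uvPi.
  have [C C0 HC] := intrinsic_norm VM M0 p23 u0 uv vT WG (rde u v uvPi).
  exists C; split=> // _ _ _ -> -> tau Z a P tg ZR PV; apply: HC => //.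
  exact/(representative_intrinsic VM M0 p23 u0 uv vT P Ec WG (rde u v uvPi) tg ZR).
have [C HC] := choice piece.
exists (\sum_(i < size Pi) C i); split.
  by apply: sumr_ge0 => i _; have [] := HC i.
move=> u v [i [iPi uE vE]] tau Z a tg _ ZR _ P PV.
have [_ /(_ u v iPi uE vE tau Z a P tg ZR PV) h] := HC i.
apply: le_trans h _; apply: lee_wpmul2r; first by rewrite adde_ge0// poweR_ge0.
rewrite lee_fin (bigD1 (Ordinal iPi))//= lerDl.
by apply: sumr_ge0 => j _; have [] := HC j.
Qed.
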